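(* Let $\varkappa\in\mathbb C$, $\varkappa\ne0$, let $k=\varkappa-h^\vee$, $\bar k=-\varkappa-h^\vee$ (with $h^\vee=2$), and let $$\hat{\mathbb F}_\varkappa=\hat F(\beta,\gamma)\otimes\hat F(\bar\beta,\bar\gamma)\otimes\tilde{\mathbb F}_\varkappa.$$ (1) The space $\hat{\mathbb F}_\varkappa$ has a $\hat{\mathfrak g}_k\oplus\hat{\mathfrak g}_{\bar k}$-module structure (two commuting actions of $\hat{\mathfrak g}$, of levels $k$ and $\bar k$), defined by $$\mathbf e(z)=\gamma(z),\qquad \mathbf h(z)=2:\beta(z)\gamma(z):+a(z),$$ $$\mathbf f(z)=-:\beta(z)^2\gamma(z):-\beta(z)a(z)-k\beta'(z)+\mathbb Y(-2,z)\bar\gamma(z),$$ and $$\bar{\mathbf e}(z)=\bar\gamma(z),\qquad \bar{\mathbf h}(z)=2:\bar\beta(z)\bar\gamma(z):+\bar a(z),$$ $$\bar{\mathbf f}(z)=-:\bar\beta(z)^2\bar\gamma(z):-\bar\beta(z)\bar a(z)-\bar k\bar\beta'(z)+\mathbb Y(-2,z)\gamma(z).$$ (2) The space $\hat{\mathbb F}_\varkappa$ has a compatible vertex operator algebra structure with $\operatorname{rank}\hat{\mathbb F}_\varkappa=6$. (Compatible means that the operators $\mathcal Y(v,z)$ are $\hat{\mathfrak g}_k\oplus\hat{\mathfrak g}_{\bar k}$-intertwining operators in the VOA sense.)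
   Context: $\hat{\mathfrak g}=\widehat{\mathfrak{sl}}(2,\mathbb C)$ has basis $\mathbf e_n,\mathbf h_n,\mathbf f_n$ ($n\in\mathbb Z$) and central $\mathbf k$, with $[\mathbf h_m,\mathbf e_n]=2\mathbf e_{m+n}$, $[\mathbf h_m,\mathbf f_n]=-2\mathbf f_{m+n}$, $[\mathbf h_m,\mathbf h_n]=2m\delta_{m+n,0}\mathbf k$, $[\mathbf e_m,\mathbf f_n]=\mathbf h_{m+n}+m\delta_{m+n,0}\mathbf k$, $[\mathbf e_m,\mathbf e_n]=[\mathbf f_m,\mathbf f_n]=0$. For $X\in\{\mathbf e,\mathbf h,\mathbf f\}$, $X(z)=\sum_nX_nz^{-n-1}$. $\hat{\mathfrak g}_k$ refers to $\hat{\mathfrak g}$ acting with $\mathbf k=k$; bars denote a second copy. Vertex algebra: a space $\mathcal V$ with state-field map $v\mapsto\mathcal Y(v,z)=\sum_nv_{(n)}z^{-n-1}$, vacuum $\mathbf 1$, translation operator $\mathcal D$, satisfying locality, $\mathcal Y(\mathbf 1,z)=\mathrm{Id}$, $\mathcal Y(v,z)\mathbf 1|_{z=0}=v$, $\mathcal D\mathbf 1=0$, $[\mathcal D,\mathcal Y(v,z)]=\frac d{dz}\mathcal Y(v,z)$. It is a vertex operator algebra (VOA) of rank $c$ if there is $\boldsymbol\omega\in\mathcal V$ such that $\mathcal Y(\boldsymbol\omega,z)=\sum_n\mathcal L_nz^{-n-2}$ satisfies $\mathcal L_{-1}=\mathcal D$ and $[\mathcal L_m,\mathcal L_n]=(m-n)\mathcal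 L_{m+n}+\delta_{m+n,0}\frac{m^3-m}{12}c$. Compatibility of the vertex structure with the action amounts to the six fields above being of the form $\mathcal Y(u,z)$ for suitable vectors $u$. $\hat F(\beta,\gamma)$: vertex algebra (Fock space) generated by $\beta(z)=\sum_n\beta_nz^{-n}$, $\gamma(z)=\sum_n\gamma_nz^{-n-1}$ with $[\beta_m,\gamma_n]=\delta_{m+n,0}$, $[\beta_m,\beta_n]=[\gamma_m,\gamma_n]=0$, vacuum annihilated by $\beta_n$ ($n\ge1$), $\gamma_n$ ($n\ge0$). $\hat F(\bar\beta,\bar\gamma)$ is a second copy. $\tilde{\mathbb F}_\varkappa=\hat F_\varkappa(a)\otimes\hat F_{-\varkappa}(\bar a)\otimes\mathbb C[\mathbf P]$, $\mathbf P=\mathbb Z$: here $a(z)=\sum a_nz^{-n-1}$, $\bar a(z)=\sum\bar a_nz^{-n-1}$, $[a_m,a_n]=2\varkappa m\delta_{m+n,0}$, $[\bar a_m,\bar a_n]=-2\varkappa m\delta_{m+n,0}$, $[a_m,\bar a_n]=0$; the first two factors are Fock spaces freely generated by $a_n$, resp. $\bar a_n$, $n<0$; $\mathbb C[\mathbf P]$ has basis $\mathbf 1_\lambda$, annihilated (with Fock vacua) by $a_n,\bar a_n$, $n>0$, and $a_0\mathbf 1_\lambda=\bar a_0\mathbf 1_\lambda=\lambda\mathbf 1_\lambda$. For $\mu\in\mathbf P$, $$\mathbb Y(\mu,z)=\exp\Big(\tfrac\mu{2\varkappa}\sum_{n<0}\tfrac{a_n}{-n}z^{-n}\Big)\exp\Big(\tfrac\mu{2\varkappa}\sum_{n>0}\tfrac{a_n}{-n}z^{-n}\Big)\exp\Big(-\tfrac\mu{2\varkappa}\sum_{n<0}\tfrac{\bar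 a_n}{-n}z^{-n}\Big)\exp\Big(-\tfrac\mu{2\varkappa}\sum_{n>0}\tfrac{\bar a_n}{-n}z^{-n}\Big)\mathbf 1_\mu,$$ where $\mathbf 1_\mu$ acts on $\mathbb C[\mathbf P]$ by $\mathbf 1_\lambda\mapsto\mathbf 1_{\lambda+\mu}$. Normal ordering: $:X(z)Y(w):=X_-(z)Y(w)+Y(w)X_+(z)$ where $X(z)=\sum_n X_{(n)}z^{-n-1}$, $X_+(z)=\sum_{n\ge0}X_{(n)}z^{-n-1}$, $X_-(z)=\sum_{n<0}X_{(n)}z^{-n-1}$; for several factors it is defined inductively. *)

(* Defs.v *)
From HB Require Import structures.
From mathcomp Require Import all_boot all_order all_algebra.
From mathcomp Require Import finmap multiset.
From mathcomp Require Import boolp classical_sets functions cardinality fsbigop.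
From mathcomp Require Import reals.
From mathcomp.real_closed Require Export complex.
From mathcomp.multinomials Require Import monalg.

Set Implicit Arguments.
Unset Strict Implicit.
Unset Printing Implicit Defensive.

Import GRing.Theory Num.Theory.

Local Open Scope ring_scope.

(* Operator-valued formal series.  [A : series V] stands for                *)
(* A(z) = \sum_n A_(n) z^(-n-1), and [A n] is the operator A_(n).  All the  *)
(* infinite sums below are evaluated on a vector, with the                  *)
(* finitely-supported sums of [fsbigop]; these return 0 on infinitely many  *)
(* nonzero terms, so they are meaningful only for series whose products are *)
(* locally finite, as is the case for all the series used below.            *)

Definition series (V : Type) := int -> V -> V.

Section Series.
Context {C : numFieldType} {V : lmodType C}.
Implicit Types (A B : series V) (T : V -> V).

Definition sadd A B : series V := fun n v => A n v + B n v.

Definition sscale (c : C) A : series V := fun n v => c *: A n v.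

(* d/dz \sum_n A_(n) z^(-n-1) = \sum_n (- n) A_(n-1) z^(-n-1) *)
Definition sderiv A : series V := fun n v => (- n)%:~R *: A (n - 1) v.

(* The series reduced to its coefficient of z^0. *)
Definition sconst T : series V := fun n v => if n == -1 then T v else 0.

Definition sprod A B : series V :=
  fun n v => \sum_(j \in [set: int]) A j (B (n - 1 - j) v).

(* :A(z)B(z): = A_-(z) B(z) + B(z) A_+(z) *)
Definition nop A B : series V := fun n v =>
  \sum_(j \in [set j : int | j < 0]) A j (B (n - 1 - j) v) +
  \sum_(j \in [set j : int | 0 <= j]) B (n - 1 - j) (A j v).

Definition spow A (r : nat) : series V := iter r (sprod A) (sconst id).

Definition sexp A : series V :=
  fun n v => \sum_(r \in [set: nat]) (r`!%:R)^-1 *: spow A r n v.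

(* The coefficient of z^(-m-1) w^(-n-1) in (z - w)^N [A(z), B(w)] vanishes  *)
(* for all m and n.                                                         *)
Definition mutually_local A B : Prop :=
  exists N : nat, forall (m n : int) (v : V),
    \sum_(i < N.+1) ((-1) ^+ i *+ 'C(N, i)) *:
      (A (m + N%:Z - i%:Z) (B (n + i%:Z) v) -
       B (n + i%:Z) (A (m + N%:Z - i%:Z) v)) = 0 :> V.

End Series.

Section VertexAlgebra.
Context {C : numFieldType} {V : lmodType C}.
Variable (Y : V -> series V) (vac : V) (D : V -> V).

Record is_vertex_algebra : Prop := VertexAlgebra {
  va_state_linear : forall n v, linear (fun u => Y u n v);
  va_mode_linear : forall u n, linear (Y u n);
  va_truncation : forall u v, exists N : int, forall n, N <= n -> Y u n v = 0;
  va_locality : forall u v, mutually_local (Y u) (Y v);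
  va_vacuum : forall n v, Y vac n v = sconst id n v;
  va_creation_regular : forall u n, 0 <= n -> Y u n vac = 0;
  va_creation : forall u, Y u (-1) vac = u;
  va_D_linear : linear D;
  va_D_vacuum : D vac = 0;
  va_translation : forall u n v,
    D (Y u n v) - Y u n (D v) = sderiv (Y u) n v
}.

(* Y(omega, z) = \sum_n L_n z^(-n-2) *)
Definition virasoro_mode (omega : V) (n : int) : V -> V := Y omega (n + 1).

Record is_voa_of_rank (omega : V) (c : C) : Prop := VOA {
  voa_vertex_algebra : is_vertex_algebra;
  voa_Lm1 : forall v, virasoro_mode omega (-1) v = D v;
  voa_virasoro : forall (m n : int) v,
    virasoro_mode omega m (virasoro_mode omega n v) -
    virasoro_mode omega n (virasoro_mode omega m v) =
    (m - n)%:~R *: virasoro_mode omega (m + n) v +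
    (if m + n == 0 then ((m ^+ 3 - m)%:~R / 12%:R * c) *: v else 0)
}.

End VertexAlgebra.

Inductive sl2_basis := sl2e | sl2h | sl2f.

(* [X x n] is the action of x_n, and the central element acts by [k]. *)
Record is_affine_sl2_module (C : numFieldType) (V : lmodType C) (k : C)
    (X : sl2_basis -> series V) : Prop := AffineSl2Module {
  aff_linear : forall x n, linear (X x n);
  aff_he : forall m n v,
    X sl2h m (X sl2e n v) - X sl2e n (X sl2h m v) = 2 *: X sl2e (m + n) v;
  aff_hf : forall m n v,
    X sl2h m (X sl2f n v) - X sl2f n (X sl2h m v) = - 2 *: X sl2f (m + n) v;
  aff_hh : forall m n v,
    X sl2h m (X sl2h n v) - X sl2h n (X sl2h m v) =
    if m + n == 0 then ((2 * m)%:~R * k) *: v else 0;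
  aff_ef : forall m n v,
    X sl2e m (X sl2f n v) - X sl2f n (X sl2e m v) =
    X sl2h (m + n) v + (if m + n == 0 then (m%:~R * k) *: v else 0);
  aff_ee : forall m n v, X sl2e m (X sl2e n v) - X sl2e n (X sl2e m v) = 0;
  aff_ff : forall m n v, X sl2f m (X sl2f n v) - X sl2f n (X sl2f m v) = 0
}.

Inductive boson := Beta | Gamma | Heis.

Definition nat_of_boson (b : boson) : nat :=
  match b with Beta => 0 | Gamma => 1 | Heis => 2 end.
Definition boson_of_nat (n : nat) : boson :=
  match n with 0 => Beta | 1 => Gamma | _ => Heis end.
Lemma nat_of_bosonK : cancel nat_of_boson boson_of_nat.
Proof. by case. Qed.
HB.instance Definition _ := Choice.copy boson (can_type nat_of_bosonK).

(* The creation operators.  The boolean is [true] for the barred copy, and  *)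
(* (Beta, s, p), (Gamma, s, p), (Heis, s, p) are beta_(-p), gamma_(-p-1),   *)
(* a_(-p-1) respectively, for p : nat.                                      *)
Definition creator : choiceType := (boson * bool * nat)%type.

(* A basis of F(beta,gamma) (x) F(betabar,gammabar) (x) F(a) (x) F(abar)    *)
(* (x) C[Z]: a monomial in the creation operators, applied to 1_lambda.     *)
Definition fock_basis : choiceType := (multiset creator * int)%type.

Definition Fock (C : numFieldType) : lmodType C := {malg C[fock_basis]}.

Section FockSpace.
Variables (C : numFieldType) (kappa : C).
Local Notation F := (Fock C).

Definition ket (b : fock_basis) : F := << b >>.

Definition linear_extension (g : fock_basis -> F) (v : F) : F :=
  \sum_(b <- msupp v) v@_b *: g b.

Definition create (x : creator) : F -> F :=
  linear_extension (fun b => ket ((x +` b.1)%mset, b.2)).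

(* The derivation with respect to the variable x. *)
Definition annihilate (x : creator) : F -> F :=
  linear_extension (fun b => (b.1 x)%:R *: ket ((b.1 `\ x)%mset, b.2)).

Definition momentum : F -> F := linear_extension (fun b => b.2%:~R *: ket b).

Definition shift (mu : int) : F -> F :=
  linear_extension (fun b => ket (b.1, b.2 + mu)).

(* The parameter of the Heisenberg algebra: kappa for a, - kappa for abar. *)
Definition hkappa (s : bool) : C := if s then - kappa else kappa.

Definition beta_mode (s : bool) (n : int) : F -> F :=
  match n with
  | Posz 0 => create (Beta, s, 0)
  | Posz p.+1 => annihilate (Gamma, s, p)
  | Negz p => create (Beta, s, p.+1)
  end.

Definition gamma_mode (s : bool) (n : int) : F -> F :=
  match n with
  | Posz p => fun v => - annihilate (Beta, s, p) v
  | Negz p => create (Gamma, s, p)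
  end.

Definition a_mode (s : bool) (n : int) : F -> F :=
  match n with
  | Posz 0 => momentum
  | Posz p.+1 => fun v => (2 * hkappa s * p.+1%:R) *: annihilate (Heis, s, p) v
  | Negz p => create (Heis, s, p)
  end.

(* beta(z) = \sum_n beta_n z^(-n), whence the index shift. *)
Definition beta (s : bool) : series F := fun n => beta_mode s (n + 1).
Definition gamma (s : bool) : series F := gamma_mode s.
Definition afield (s : bool) : series F := a_mode s.

(* \sum_(n < 0) a_n / (- n) z^(-n) and \sum_(n > 0) a_n / (- n) z^(-n) *)
Definition aint_neg (s : bool) : series F := fun j v =>
  let n := j + 1 in if n < 0 then (- n)%:~R^-1 *: a_mode s n v else 0.
Definition aint_pos (s : bool) : series F := fun j v =>
  let n := j + 1 in if 0 < n then (- n)%:~R^-1 *: a_mode s n v else 0.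

(* The factors of YY(mu, z) for a and abar are of the same form, with       *)
(* mu / (2 kappa) and - mu / (2 kappa) = mu / (2 (- kappa)).                *)
Definition vexp (s : bool) (mu : int) (A : series F) : series F :=
  sexp (sscale (mu%:~R / (2 * hkappa s)) A).

Definition YY (mu : int) : series F :=
  sprod (vexp false mu (aint_neg false))
 (sprod (vexp false mu (aint_pos false))
 (sprod (vexp true mu (aint_neg true))
 (sprod (vexp true mu (aint_pos true))
        (sconst (shift mu))))).

Definition dual_coxeter : C := 2.

(* The level: k = kappa - h^vee, and kbar = - kappa - h^vee for the barred  *)
(* copy.                                                                    *)
Definition level (s : bool) : C := hkappa s - dual_coxeter.

Definition sl2_field (s : bool) (x : sl2_basis) : series F :=
  match x with
  | sl2e => gamma s
  | sl2h => sadd (sscale 2 (nop (beta s) (gamma s))) (afield s)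
  | sl2f =>
      sadd (sscale (-1) (nop (beta s) (nop (beta s) (gamma s))))
     (sadd (sscale (-1) (sprod (beta s) (afield s)))
     (sadd (sscale (- level s) (sderiv (beta s)))
           (sprod (YY (-2)) (gamma (~~ s)))))
  end.

End FockSpace.

(* Main.v *)
Require Import Defs.
From mathcomp Require Import all_boot all_order all_algebra.
From mathcomp Require Import finmap multiset.
From mathcomp Require Import boolp classical_sets functions fsbigop.
From mathcomp Require Import reals.
From mathcomp.multinomials Require Import monalg.
From mathcomp Require Import zify ring.

(* Call a series good if it is truncated, translation covariant and local    *)
(* with the generating series: the modes of beta, gamma and a (both copies)  *)
(* and the vertex operators YY(mu).  By Goddard's uniqueness theorem a good  *)
(* series is determined by its value at the vacuum, and by Dong's lemma good *)
(* series are closed under derivatives, normally ordered products and j-th   *)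
(* products, so every state comes from exactly one of them; this is the      *)
(* state-field map.  The currents are good, so all their commutators follow  *)
(* from the commutator formula once their j-th products, j >= 0, have been   *)
(* computed on states; the same holds for the Virasoro relations.            *)
(*                                                                           *)
(* Dong's lemma needs no binomial identities: multiplications by z - w and   *)
(* z - u commute, and if each is nilpotent on a distribution then so is their *)
(* difference w - u.  The locality of the YY(mu) is checked on the vectors   *)
(* 1_lambda, since the relation [a_m, YY(mu)_n] = mu YY(mu)_(m+n) propagates *)
(* it to the whole space.                                                    *)

Set Implicit Arguments.
Unset Strict Implicit.
Unset Printing Implicit Defensive.

Import Order.TTheory GRing.Theory Num.Theory.

Local Open Scope ring_scope.

(** * Linear maps and finitely supported sums *)

(** Without the terms [YY (-2)] gamma, each half of the formulas is the Wakimoto realization, of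
    level [hkappa s - 2]: the Heisenberg field contributes [2 * hkappa s] to the bracket of two
    Cartan fields and the beta-gamma system contributes -4. The new term in f(z) must then disturb
    nothing and must make the two halves commute. It mixes them, so this is checked through operator
    products.

    The vertex operators are exponentials of the field a - abar. As a and abar have opposite
    parameters, the modes of this field commute with each other; hence all [YY mu] commute
    ([vertex_opC]), and the derivative of [YY (-2)] is -1/kappa times (a - abar) [YY (-2)]. Being of
    weight -2 for both Cartan fields, [YY (-2)] times gammabar has weight -2 for h and weight 0 for
    hbar. In f f its products with -beta a, taken in the two orders, cancel. In f fbar the
    second-order pole is (k + kbar + 4) [YY (-2)] = 0, and the first-order pole cancels by the
    formula for the derivative of [YY (-2)] ([lowering_lowering_bar]).

    For the vertex algebra, the translation operator is by definition the mode L_(-1) of the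
    free-field stress tensor. The fields beta, gamma, a and [YY mu] are covariant for it and
    mutually local, and their modes generate the space from the vacuum. A reconstruction theorem
    ([state_field_vertex_algebra]) applies to any such data: [good_generated] produces a series for
    every state, [good_eq0] makes it unique, and Dong's lemma ([dong_nop], [dong_nprod]) keeps
    locality. The same theory gives the commutator formula [good_commutator], which reduces a
    commutator of fields to finitely many vectors A_(j) B_(-1) 1 with j >= 0. Both the affine
    relations and the Virasoro relations follow by computing these vectors; the central charge is 2
    + 2 + 1 + 1 = 6. *)

Section LinearFunctions.
Context {C : pzRingType} {U V : lmodType C} (f : U -> V).
Hypothesis fL : linear f.

Lemma linfD u v : f (u + v) = f u + f v.
Proof. by have := fL 1 u v; rewrite !scale1r. Qed.

Lemma linf0 : f 0 = 0.
Proof. by apply: (addrI (f 0)); rewrite -linfD !addr0. Qed.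

Lemma linfZ a u : f (a *: u) = a *: f u.
Proof. by have := fL a u 0; rewrite !addr0 linf0 addr0. Qed.

Lemma linfN u : f (- u) = - f u.
Proof. by rewrite -scaleN1r linfZ scaleN1r. Qed.

Lemma linfB u v : f (u - v) = f u - f v.
Proof. by rewrite linfD linfN. Qed.

Lemma linf_sum I (r : seq I) (P : pred I) F :
  f (\sum_(i <- r | P i) F i) = \sum_(i <- r | P i) f (F i).
Proof. exact: (big_morph f linfD linf0). Qed.

End LinearFunctions.

Lemma comp_linear (C : pzRingType) (U V W : lmodType C) (g : V -> W) (f : U -> V) :
  linear g -> linear f -> linear (g \o f).
Proof. by move=> gL fL a u v /=; rewrite fL gL. Qed.

Lemma sum_linear (C : comPzRingType) (U V : lmodType C) N (f : nat -> U -> V) :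
  (forall i, linear (f i)) -> linear (fun v => \sum_(i < N) f i v).
Proof.
by move=> fL a u v; rewrite scaler_sumr -big_split; apply: eq_bigr => i _; apply: fL.
Qed.

Lemma int_ind2 (P : int -> Prop) (n0 : int) :
  P n0 -> (forall n, n0 <= n -> P n -> P (n + 1)) ->
  (forall n, n <= n0 -> P n -> P (n - 1)) -> forall n, P n.
Proof.
move=> P0 PS PP n.
have up k : P (n0 + k%:Z).
  elim: k => [|k IH]; first by rewrite addr0.
  by rewrite -addn1 PoszD addrA; apply: PS => //; lia.
have dn k : P (n0 - k%:Z).
  elim: k => [|k IH]; first by rewrite subr0.
  by rewrite -addn1 PoszD opprD addrA; apply: PP => //; lia.
have [h|h] := lerP n0 n.
  by have -> : n = n0 + `|n - n0|%N%:Z by lia.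
by have -> : n = n0 - `|n - n0|%N%:Z by lia.
Qed.

Section NatSums.
Variable V : zmodType.
Implicit Types f : nat -> V.

Definition nsum f := \sum_(i \in [set: nat]) f i.

Lemma nsumE N f : (forall i, (N <= i)%N -> f i = 0) -> nsum f = \sum_(i < N) f i.
Proof.
move=> f0; rewrite /nsum (fsbigE (iota 0 N)) ?iota_uniq//; last first.
  by move=> i _; rewrite mem_iota /= add0n -leqNgt; apply: f0.
under eq_bigl do rewrite in_setT.
by rewrite -(big_mkord xpredT f) /index_iota subn0.
Qed.

Lemma eq_nsum f g : f =1 g -> nsum f = nsum g.
Proof. by move=> fg; apply: eq_fsbigr => i _; apply: fg. Qed.

Lemma nsum_recl f N : (forall i, (N <= i)%N -> f i = 0) ->
  nsum f = f 0%N + nsum (fun i => f i.+1).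
Proof.
move=> f0; rewrite (@nsumE N.+1) => [|i Ni]; last by apply: f0; lia.
by rewrite (@nsumE N) => [|i Ni]; [rewrite big_ord_recl | apply: f0; lia].
Qed.

Lemma nsum0 f : (forall i, f i = 0) -> nsum f = 0.
Proof. by move=> f0; apply: fsbig1. Qed.

Lemma fsum_int_neg (f : int -> V) :
  \sum_(j \in [set j : int | j < 0]) f j = nsum (fun i => f (- 1 - i%:Z)).
Proof.
rewrite /nsum; apply: (reindex_fsbig (fun i : nat => - 1 - i%:Z)); split.
- by move=> i _ /=; lia.
- by move=> i j _ _; lia.
- by move=> j /= j0; exists (absz (j + 1)) => //; lia.
Qed.

Lemma fsum_int_nneg (f : int -> V) :
  \sum_(j \in [set j : int | 0 <= j]) f j = nsum (fun i => f i%:Z).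
Proof.
rewrite /nsum; apply: (reindex_fsbig (fun i : nat => i%:Z)); split.
- by move=> i _ /=; lia.
- by move=> i j _ _; lia.
- by move=> j /= j0; exists (absz j) => //; lia.
Qed.

Lemma fsum_int (f : int -> V) N :
  (forall i : nat, (N <= i)%N -> f i%:Z = 0 /\ f (- 1 - i%:Z) = 0) ->
  \sum_(j \in [set: int]) f j =
  nsum (fun i => f (- 1 - i%:Z)) + nsum (fun i => f i%:Z).
Proof.
move=> f0; rewrite (@nsumE N) => [|i Ni]; last by case: (f0 _ Ni).
rewrite (@nsumE N) => [|i Ni]; last by case: (f0 _ Ni).
pose r := [seq - 1 - i%:Z | i <- iota 0 N] ++ [seq i%:Z | i <- iota 0 N].
rewrite (fsbigE r)//; last first.
- move=> j _; rewrite mem_cat negb_or => /andP[j1 j2].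
  have [j0|j0] := lerP 0 j.
    have jE : j = (absz j)%:Z by lia.
    rewrite jE; apply: (f0 _ _).1; rewrite leqNgt; apply: contra j2 => jN.
    by apply/mapP; exists (absz j) => //; rewrite mem_iota; lia.
  have jE : j = - 1 - (absz (j + 1))%:Z by lia.
  rewrite jE; apply: (f0 _ _).2; rewrite leqNgt; apply: contra j1 => jN.
  by apply/mapP; exists (absz (j + 1)) => //; rewrite mem_iota; lia.
- rewrite cat_uniq !map_inj_uniq ?iota_uniq /= ?andbT; try by move=> x y; lia.
  by apply/hasPn => _ /mapP[i _ ->]; apply/mapP => -[k _]; lia.
under eq_bigl do rewrite in_setT.
rewrite big_cat !big_map -(big_mkord xpredT (fun i : nat => f (- 1 - i%:Z))).
by rewrite -(big_mkord xpredT (fun i : nat => f i%:Z)) /index_iota subn0.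
Qed.

End NatSums.

(** Induction on the total exponent: one factor P + Q applied to x leaves Px and Qx, and for each of
    them one of the two exponents has dropped by one. Commutation keeps the other exponent valid. *)
Lemma nilpotent_add (M : zmodType) (P Q : M -> M) a b x :
  {morph P : y z / y + z} -> {morph Q : y z / y + z} ->
  (forall y, P (Q y) = Q (P y)) ->
  iter a P x = 0 -> iter b Q x = 0 -> iter (a + b) (fun y => P y + Q y) x = 0.
Proof.
move=> PD QD PQ.
have P0 : P 0 = 0 by apply: (addrI (P 0)); rewrite -PD !addr0.
have Q0 : Q 0 = 0 by apply: (addrI (Q 0)); rewrite -QD !addr0.
set S := fun y => _.
have SD y z : S (y + z) = S y + S z by rewrite /S PD QD addrACA.
have SnD n y z : iter n S (y + z) = iter n S y + iter n S z.
  by elim: n => //= n ->; apply: SD.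
have Sn0 n : iter n S 0 = 0 by elim: n => //= n ->; rewrite /S P0 Q0 addr0.
have QPn n y : Q (iter n P y) = iter n P (Q y).
  by elim: n => //= n <-; rewrite PQ.
have PQn n y : P (iter n Q y) = iter n Q (P y).
  by elim: n => //= n <-; rewrite PQ.
have [n abn] : exists n, n = (a + b)%N by exists (a + b)%N.
rewrite -abn; elim: n a b abn x => [|n IH] a b abn x Pa Qb.
  by have a0 : a = 0%N; [lia | rewrite a0 in Pa].
rewrite iterSr {2}/S SnD.
case: a abn Pa => [|a] abn Pa; first by rewrite /= in Pa; rewrite Pa P0 Q0 !Sn0 addr0.
case: b abn Qb => [|b] abn Qb; first by rewrite /= in Qb; rewrite Qb P0 Q0 !Sn0 addr0.
have h1 : iter n S (P x) = 0.
  apply: (IH a b.+1); [lia | by rewrite -iterSr | by rewrite -PQn Qb P0].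
have h2 : iter n S (Q x) = 0.
  apply: (IH a.+1 b); [lia | by rewrite -QPn Pa Q0 | by rewrite -iterSr].
by rewrite h1 h2 addr0.
Qed.
(* Equalities between linear combinations are decided by comparing the      *)
(* coefficients of the atoms, which leaves ring identities over the scalars. *)
Section ModuleReflection.
Variables (C : comPzRingType) (V : lmodType C).

Inductive lexp :=
  LVar of nat | LZero | LAdd of lexp & lexp | LOpp of lexp | LScale of C & lexp.

Fixpoint leval (vs : seq V) e : V :=
  match e with
  | LVar i => nth 0 vs i
  | LZero => 0
  | LAdd e1 e2 => leval vs e1 + leval vs e2
  | LOpp e => - leval vs e
  | LScale c e => c *: leval vs e
  end.

(** [eqn] instead of [==], so that [cbn] reduces the comparison of two numerals. *)
Fixpoint lcoef (i : nat) e : C :=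
  match e with
  | LVar j => if eqn i j then 1 else 0
  | LZero => 0
  | LAdd e1 e2 => lcoef i e1 + lcoef i e2
  | LOpp e => - lcoef i e
  | LScale c e => c * lcoef i e
  end.

Fixpoint lcoefs_eq n e1 e2 : Prop :=
  match n with
  | 0 => True
  | n'.+1 => lcoef n' e1 = lcoef n' e2 /\ lcoefs_eq n' e1 e2
  end.

Lemma lexpE vs e : leval vs e = \sum_(i < size vs) lcoef i e *: nth 0 vs i.
Proof.
elim: e => [j||e1 IH1 e2 IH2|e IH|c e IH] /=.
- have [jv|jv] := ltnP j (size vs).
    rewrite (bigD1 (Ordinal jv)) //= (introT eqnP erefl) scale1r big1 ?addr0 // => i ij.
    rewrite (_ : eqn i j = false) ?scale0r //.
    by apply/eqnP => E; case/eqP: ij; apply: val_inj.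
  rewrite nth_default // big1 // => i _.
  rewrite (_ : eqn i j = false) ?scale0r //.
  by apply/eqnP => E; have := ltn_ord i; rewrite E ltnNge jv.
- by rewrite big1 // => i _; rewrite scale0r.
- by rewrite IH1 IH2 -big_split; apply: eq_bigr => i _; rewrite scalerDl.
- by rewrite IH -sumrN; apply: eq_bigr => i _; rewrite scaleNr.
- by rewrite IH scaler_sumr; apply: eq_bigr => i _; rewrite scalerA.
Qed.

Lemma leval_eq vs e1 e2 : lcoefs_eq (size vs) e1 e2 -> leval vs e1 = leval vs e2.
Proof.
move=> h; rewrite !lexpE; apply: eq_bigr => i _; congr (_ *: _).
by elim: (size vs) i h => [[]//|n IH] i [h1 h2]; have [i_n|i_n] := eqVneq (i : nat) n;
  [rewrite i_n | have in' : (i < n)%N by [have := ltn_ord i; lia];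
   apply: (IH (Ordinal in') h2)].
Qed.

End ModuleReflection.

Ltac lm_mem x l :=
  lazymatch l with
  | nil => constr:(false)
  | cons ?y ?t => lazymatch x with y => constr:(true) | _ => lm_mem x t end
  end.
Ltac lm_index x l :=
  lazymatch l with
  | cons ?y ?t => lazymatch x with y => constr:(0%N) | _ => let n := lm_index x t in constr:(S n) end
  end.
Ltac lm_atoms C V t l :=
  lazymatch t with
  | (?a + ?b)%R => let l1 := lm_atoms C V a l in lm_atoms C V b l1
  | (- ?a)%R => lm_atoms C V a l
  | (?c *: ?a)%R => lm_atoms C V a l
  | 0%R => l
  | ?x => let b := lm_mem x l in
     lazymatch b with true => l | false => constr:(@cons V x l) end
  end.
Ltac lm_reify C V t l :=
  lazymatch t with
  | (?a + ?b)%R => let e1 := lm_reify C V a l in let e2 := lm_reify C V b l in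
     constr:(@LAdd C e1 e2)
  | (- ?a)%R => let e := lm_reify C V a l in constr:(@LOpp C e)
  | (?c *: ?a)%R => let e := lm_reify C V a l in constr:(@LScale C c e)
  | 0%R => constr:(@LZero C)
  | ?x => let n := lm_index x l in constr:(@LVar C n)
  end.
Ltac lmod_coefs C V :=
  lazymatch goal with
  | |- @eq _ ?a ?b =>
    let l0 := lm_atoms C V a (@nil V) in
    let l := lm_atoms C V b l0 in
    let e1 := lm_reify C V a l in
    let e2 := lm_reify C V b l in
    apply: (@leval_eq C V l e1 e2); cbn [lcoefs_eq lcoef size eqn]; repeat split
  end.
Ltac lmod_ring C V := lmod_coefs C V; ring.

(** * Formal distributions and locality *)

Section AdditiveIteration.
Variables (M : zmodType) (P : M -> M).
Hypothesis PD : {morph P : y z / y + z}.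

Lemma iter_addfD n : {morph iter n P : y z / y + z}.
Proof. by move=> y z; elim: n => //= n ->; apply: PD. Qed.

Lemma iter_addf0 n : iter n P 0 = 0.
Proof. by apply: (addrI (iter n P 0)); rewrite -iter_addfD !addr0. Qed.

Lemma iter_addfN n : {morph iter n P : y / - y}.
Proof.
by move=> y; apply: (addrI (iter n P y)); rewrite -iter_addfD !subrr iter_addf0.
Qed.

Lemma iter_eq0_le n k x : (n <= k)%N -> iter n P x = 0 -> iter k P x = 0.
Proof. by move=> /subnK <- Px; rewrite iterD Px iter_addf0. Qed.

End AdditiveIteration.

Lemma iter_comm T (P Q : T -> T) a b x :
  (forall y, P (Q y) = Q (P y)) -> iter a P (iter b Q x) = iter b Q (iter a P x).
Proof.
move=> PQ; have h y : P (iter b Q y) = iter b Q (P y).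
  by elim: b => //= b <-; rewrite PQ.
by elim: a => //= a ->; rewrite h.
Qed.

Section FormalDistributions.

(* Multiplication by z - w of \sum F(m, n) z^(-m-1) w^(-n-1). *)
Definition dzw (M : zmodType) (F : int -> int -> M) : int -> int -> M :=
  fun m n => F (m + 1) n - F m (n + 1).

Lemma dzwD (M : zmodType) : {morph @dzw M : F G / F + G}.
Proof.
move=> F G; apply/funext => m; apply/funext => n.
by rewrite /dzw !addrfctE opprD addrACA.
Qed.

Lemma iter_dzw_map (M M' : zmodType) (f : M -> M') N F :
  {morph f : x y / x - y} ->
  iter N (@dzw M') (fun m n => f (F m n)) = fun m n => f (iter N (@dzw M) F m n).
Proof. by move=> fB; elim: N => //= N ->; rewrite /dzw; do 2!apply/funext=> ?; rewrite fB. Qed.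

(** A distribution killed by z - w is constant along each line m + n = const. Sliding along the line
    makes n as large as desired, where F vanishes. *)
Lemma dzw_eq0 (M : zmodType) (F : int -> int -> M) :
  dzw F = 0 -> (exists n0 : int, forall m n, n0 <= n -> F m n = 0) -> F = 0.
Proof.
move=> dF [n0 F0]; apply/funext => m; apply/funext => n.
have FS m' n' : F (m' + 1) n' = F m' (n' + 1).
  by apply/eqP; rewrite -subr_eq0; have := congr1 (fun G => G m' n') dF; rewrite /dzw => ->.
have step k : F m n = F (m - k%:Z) (n + k%:Z).
  elim: k => [|k ->]; first by rewrite subr0 addr0.
  have -> : m - k%:Z = m - k.+1%:Z + 1 by lia.
  by rewrite FS; congr (F _ _); lia.
by rewrite (step (absz (n0 - n))) F0//; lia.
Qed.

Lemma dzw_eq0_sym (M : zmodType) (F : int -> int -> M) :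
  dzw F = 0 -> (exists m0 : int, forall m n, m0 <= m -> F m n = 0) -> F = 0.
Proof.
move=> dF [m0 F0].
suff F'0 : (fun m n => F n m) = 0.
  by apply/funext => m; apply/funext => n; apply: (congr1 (fun G => G n m) F'0).
apply: dzw_eq0; last by exists m0 => m n; apply: F0.
apply/funext => m; apply/funext => n; rewrite /dzw.
by have := congr1 (fun G => - G n m) dF; rewrite /dzw /= opprB => ->; rewrite oppr0.
Qed.

(** The kernel of z - w consists of the products of delta(z - w) with a series in w, and the row m =
    0 recovers that series. *)
Lemma dzw_base_eq0 (M : zmodType) (F : int -> int -> M) :
  dzw F = 0 -> (forall n, F 0 n = 0) -> F = 0.
Proof.
move=> dF F0; apply/funext => m; apply/funext => n.
have FS m' n' : F (m' + 1) n' = F m' (n' + 1).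
  by apply/eqP; rewrite -subr_eq0; have := congr1 (fun G => G m' n') dF; rewrite /dzw => ->.
move: m n; apply: (int_ind2 (n0 := 0)) => [n|m _ IH n|m _ IH n]; first exact: F0.
  by rewrite FS IH.
by have -> : n = n - 1 + 1 by [lia]; rewrite -FS subrK.
Qed.

Lemma iter_dzw_swap (M : zmodType) N (F : int -> int -> M) :
  iter N (@dzw M) F = 0 -> iter N (@dzw M) (fun m n => F n m) = 0.
Proof.
elim: N F => [|N IH] F.
  by move=> F0; apply/funext => m; apply/funext => n; apply: (congr1 (fun G => G n m) F0).
rewrite !iterSr => dF.
have -> : dzw (fun m n => F n m) = fun m n => (- dzw F) n m.
  by apply/funext => m; apply/funext => n; rewrite /dzw !opprfctE opprB.
by apply: IH; rewrite (iter_addfN (@dzwD M)) dF oppr0.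
Qed.

End FormalDistributions.

Section Locality.
Context {C : numFieldType} {V : lmodType C}.
Implicit Types A B D : series V.

Definition comm A B (v : V) : int -> int -> V :=
  fun m n => A m (B n v) - B n (A m v).

Definition local A B := exists N, forall v, iter N (@dzw V) (comm A B v) = 0.

Definition linear_modes A := forall n, linear (A n).

Definition truncated A := forall v, exists N : int, forall n, N <= n -> A n v = 0.

(** Passes from powers of the operator z - w, convenient in proofs, to the binomial sum that defines
    [mutually_local]. *)
Lemma iter_dzwE N (F : int -> int -> V) m n :
  iter N (@dzw V) F m n =
  \sum_(i < N.+1) ((-1) ^+ i *+ 'C(N, i) : C) *: F (m + N%:Z - i%:Z) (n + i%:Z).
Proof.
elim: N m n => [|N IH] m n.
  by rewrite big_ord1 /= bin0 expr0 mulr1n scale1r; congr (F _ _); lia.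
rewrite iterS /dzw !IH [RHS]big_ord_recl.
have -> : \sum_(i < N.+1) ((-1) ^+ i *+ 'C(N, i) : C) *: F (m + 1 + N%:Z - i%:Z) (n + i%:Z)
  = F (m + N.+1%:Z) n +
  \sum_(i < N.+1) ((-1) ^+ i.+1 *+ 'C(N, i.+1) : C) *: F (m + N%:Z - i%:Z) (n + i.+1%:Z).
  rewrite [RHS]addrC [X in _ = X + _]big_ord_recr /= bin_small // mulr0n scale0r addr0.
  rewrite big_ord_recl addrC; congr (_ + _).
    apply: eq_bigr => i _; rewrite lift0; congr (_ *: F _ _); lia.
  by rewrite bin0 expr0 mulr1n scale1r /=; congr (F _ _); lia.
rewrite bin0 expr0 mulr1n scale1r -addrA; congr (_ + _); first by rewrite /=; congr (F _ _); lia.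
rewrite -sumrB; apply: eq_bigr => i _; rewrite lift0 binS mulrnDr scalerDl.
congr (_ + _); first by congr (_ *: F _ _); lia.
rewrite -scaleNr -mulNrn exprS mulN1r; congr (_ *: F _ _); lia.
Qed.

Lemma mutually_localP A B : local A B -> mutually_local A B.
Proof.
by case=> N AB; exists N => m n v; rewrite -(iter_dzwE N (comm A B v)) AB.
Qed.

Lemma comm_swap A B v : comm B A v = fun m n => (- comm A B v) n m.
Proof. by apply/funext => m; apply/funext => n; rewrite /comm !opprfctE opprB. Qed.

Lemma local_sym A B : local A B -> local B A.
Proof.
case=> N AB; exists N => v; rewrite comm_swap; apply: iter_dzw_swap.
by rewrite (iter_addfN (@dzwD V)) AB oppr0.
Qed.

Lemma local_commuting A B :
  (forall m n v, A m (B n v) = B n (A m v)) -> local A B.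
Proof.
move=> AB; exists 0%N => v /=; apply/funext => m; apply/funext => n.
by rewrite /comm AB subrr.
Qed.

Definition dz (F : int -> int -> V) : int -> int -> V :=
  fun m n => (- m)%:~R *: F (m - 1) n.

(** [dz] is d/dz, and (z - w) d/dz = d/dz (z - w) - 1; so one more factor z - w suffices, by
    induction on N. *)
Lemma iter_dzw_dz N F : iter N (@dzw V) F = 0 -> iter N.+1 (@dzw V) (dz F) = 0.
Proof.
have dz0 : dz 0 = 0.
  by apply/funext => m; apply/funext => n; rewrite /dz /= scaler0.
have dzwdz G : dzw (dz G) = dz (dzw G) - G.
  apply/funext => m; apply/funext => n; rewrite /dzw /dz !addrfctE !opprfctE.
  rewrite addrK scalerBr opprD rmorphD /= rmorphN1 scalerDl scaleN1r.
  have -> : m - 1 + 1 = m by lia.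
  by rewrite addrAC.
elim: N F => [|N IH] F F0.
  by rewrite (_ : F = 0)//; rewrite dz0 (iter_addf0 (@dzwD V)).
rewrite iterSr dzwdz (iter_addfD (@dzwD V)) (iter_addfN (@dzwD V)) F0 subr0.
by apply: IH; rewrite -iterSr.
Qed.

Lemma local_sderiv A B : linear_modes B -> local A B -> local (sderiv A) B.
Proof.
move=> BL [N AB]; exists N.+1 => v.
have -> : comm (sderiv A) B v = dz (comm A B v); last exact: iter_dzw_dz.
by apply/funext => m; apply/funext => n; rewrite /comm /sderiv /dz (linfZ (BL n)) scalerBr.
Qed.

Lemma local_sscale a A B : linear_modes B -> local A B -> local (sscale a A) B.
Proof.
move=> BL [N AB]; exists N => v.
have -> : comm (sscale a A) B v = fun m n => a *: comm A B v m n.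
  by apply/funext => m; apply/funext => n; rewrite /comm /sscale (linfZ (BL n)) scalerBr.
rewrite (@iter_dzw_map _ _ (GRing.scale a)) ?AB => [|x y]; last by rewrite scalerBr.
by apply/funext => m; apply/funext => n; rewrite scaler0.
Qed.

Lemma local_sadd A A' B : linear_modes B -> local A B -> local A' B -> local (sadd A A') B.
Proof.
move=> BL [N AB] [N' AB']; exists (maxn N N') => v.
have -> : comm (sadd A A') B v = comm A B v + comm A' B v.
  apply/funext => m; apply/funext => n; rewrite /comm /sadd (linfD (BL n)) !addrfctE.
  by rewrite opprD addrACA.
rewrite (iter_addfD (@dzwD V)).
by rewrite !(iter_eq0_le (@dzwD V) _ (AB v), iter_eq0_le (@dzwD V) _ (AB' v)) ?addr0 ?leq_maxl ?leq_maxr.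
Qed.

End Locality.

(** * Distributions in three variables z, w, u *)

Section Dong.
Context {C : numFieldType} {V : lmodType C}.
Implicit Types A B D : series V.
Local Notation array3 := (int -> int -> int -> V).

Definition dzu (F : array3) : array3 := fun m n l => F (m + 1) n l - F m n (l + 1).
Definition dwu (F : array3) : array3 := fun m n l => F m (n + 1) l - F m n (l + 1).
Local Notation dzw3 := (@dzw (int -> V)).

Let eq3 (F G : array3) : (forall m n l, F m n l = G m n l) -> F = G.
Proof. by move=> FG; do 3!apply/funext => ?; apply: FG. Qed.

Lemma dzuD : {morph dzu : F G / F + G}.
Proof. by move=> F G; apply: eq3 => m n l; rewrite /dzu !addrfctE opprD addrACA. Qed.
Lemma dwuD : {morph dwu : F G / F + G}.
Proof. by move=> F G; apply: eq3 => m n l; rewrite /dwu !addrfctE opprD addrACA. Qed.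

Let sub4 (a b c d : V) : a - b - (c - d) = a - c - (b - d).
Proof. by rewrite !opprB addrACA [RHS]addrACA; congr (_ + _); apply: addrC. Qed.

Lemma dzw_dzu F : dzw3 (dzu F) = dzu (dzw3 F).
Proof. by apply: eq3 => m n l; rewrite /dzw /dzu !addrfctE !opprfctE sub4. Qed.
Lemma dzw_dwu F : dzw3 (dwu F) = dwu (dzw3 F).
Proof. by apply: eq3 => m n l; rewrite /dzw /dwu !addrfctE !opprfctE sub4. Qed.
Lemma dzu_dwu F : dzu (dwu F) = dwu (dzu F).
Proof. by apply: eq3 => m n l; rewrite /dzu /dwu sub4. Qed.

(* [w - u] is the sum of the commuting [z - u] and [- (z - w)], each of which is *)
(* nilpotent on [(w - u)^c H].                                                   *)
Lemma dwu_nilpotent a b c H :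
  iter a dzw3 H = 0 -> iter b dzu (iter c dwu H) = 0 -> iter (a + b + c) dwu H = 0.
Proof.
move=> H1 H2; pose P := fun F => - dzw3 F.
have dwuE : dwu = fun F => P F + dzu F.
  apply/funext => F; apply: eq3 => m n l; rewrite /P /dwu /dzu /dzw !addrfctE !opprfctE.
  by rewrite opprB addrA subrK.
rewrite iterD {1}dwuE; apply: nilpotent_add => //.
- by move=> F G; rewrite /P dzwD opprD.
- exact: dzuD.
- move=> F; rewrite /P dzw_dzu.
  exact: esym (iter_addfN dzuD 1 (dzw F)).
- have Pn k F : iter k dzw3 F = 0 -> iter k P F = 0.
    elim: k F => [//|k IH] F; rewrite iterSr => dF; rewrite iterSr.
    by apply: IH; rewrite /P (iter_addfN (@dzwD _)) dF oppr0.
  apply: Pn; rewrite (iter_comm _ _ _ dzw_dwu) H1.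
  by rewrite (iter_addf0 dwuD).
Qed.

End Dong.

(** * Normally ordered products and Dong's lemma *)

Section Products.
Context {C : numFieldType} {V : lmodType C}.
Implicit Types A B D : series V.
Local Notation array3 := (int -> int -> int -> V).
Local Notation dzw3 := (@dzw (int -> V)).

Record is_field A : Prop := IsField {
  field_linear : linear_modes A;
  field_truncated : truncated A
}.

Lemma eq_array2 (F G : int -> int -> V) : (forall m n, F m n = G m n) -> F = G.
Proof. by move=> FG; do 2!apply/funext => ?; apply: FG. Qed.

Lemma eq_array3 (F G : array3) : (forall m n l, F m n l = G m n l) -> F = G.
Proof. by move=> FG; do 3!apply/funext => ?; apply: FG. Qed.

Lemma nsum_linear (F : nat -> V -> V) :
  (forall i, linear (F i)) ->
  (forall v, exists N, forall i, (N <= i)%N -> F i v = 0) ->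
  linear (fun v => nsum (fun i => F i v)).
Proof.
move=> FL F0 a u v; have [[N1 h1] [N2 h2]] := (F0 u, F0 v).
have Fu i : (N1 + N2 <= i)%N -> F i u = 0 by move=> Ni; apply: h1; lia.
have Fv i : (N1 + N2 <= i)%N -> F i v = 0 by move=> Ni; apply: h2; lia.
rewrite (nsumE Fu) (nsumE Fv) -(sum_linear _ FL); apply: nsumE => i Ni.
by rewrite FL Fu // Fv // scaler0 addr0.
Qed.

(* The coefficients of (z - w)^(-1) [A(z), B(w)], where (z - w)^(-1) is      *)
(* expanded for |z| > |w| in front of A(z) B(w) and for |w| > |z| in front   *)
(* of B(w) A(z); the residue in z, m = 0, is the normally ordered product.  *)
Definition nopl A B m n v := nsum (fun i => A (m - 1 - i%:Z) (B (n + i%:Z) v)).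
Definition nopr A B m n v := nsum (fun i => B (n - 1 - i%:Z) (A (m + i%:Z) v)).

Lemma nopE A B n v : nop A B n v = nopl A B 0 n v + nopr A B 0 n v.
Proof.
rewrite /nop fsum_int_neg fsum_int_nneg; congr (_ + _); apply: eq_nsum => i //.
by congr (A _ (B _ _)); lia.
Qed.

Lemma nopl_bound A B m n v : is_field A -> is_field B ->
  exists N, forall i, (N <= i)%N -> A (m - 1 - i%:Z) (B (n + i%:Z) v) = 0.
Proof.
move=> [AL _] [_ BT]; have [N h] := BT v; exists (absz (N - n)) => i Ni.
by rewrite h ?(linf0 (AL _)) //; lia.
Qed.

Lemma nopr_bound A B m n v : is_field A -> is_field B ->
  exists N, forall i, (N <= i)%N -> B (n - 1 - i%:Z) (A (m + i%:Z) v) = 0.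
Proof.
move=> [_ AT] [BL _]; have [N h] := AT v; exists (absz (N - m)) => i Ni.
by rewrite h ?(linf0 (BL _)) //; lia.
Qed.

Lemma nopl_eq0 A B v : is_field A -> is_field B ->
  exists n0 : int, forall m n, n0 <= n -> nopl A B m n v = 0.
Proof.
move=> [AL _] [_ BT]; have [N h] := BT v; exists N => m n Nn.
by apply: nsum0 => i; rewrite h ?(linf0 (AL _)) //; lia.
Qed.

Lemma nopr_eq0 A B v : is_field A -> is_field B ->
  exists m0 : int, forall m n, m0 <= m -> nopr A B m n v = 0.
Proof.
move=> [_ AT] [BL _]; have [N h] := AT v; exists N => m n Nm.
by apply: nsum0 => i; rewrite h ?(linf0 (BL _)) //; lia.
Qed.

Lemma dzw_nopl A B v : is_field A -> is_field B ->
  dzw (fun m n => nopl A B m n v) = fun m n => A m (B n v).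
Proof.
move=> Af Bf; apply: eq_array2 => m n; rewrite /dzw /nopl.
have [N h] := nopl_bound (m + 1) n v Af Bf; rewrite (nsum_recl h) /=.
rewrite [X in _ + X - _](_ : _ = nsum (fun i => A (m - 1 - i%:Z) (B (n + 1 + i%:Z) v))).
  by rewrite addrK; congr (A _ (B _ _)); lia.
by apply: eq_nsum => i; congr (A _ (B _ _)); lia.
Qed.

Lemma dzw_nopr A B v : is_field A -> is_field B ->
  dzw (fun m n => nopr A B m n v) = fun m n => - B n (A m v).
Proof.
move=> Af Bf; apply: eq_array2 => m n; rewrite /dzw /nopr.
have [N h] := nopr_bound m (n + 1) v Af Bf; rewrite (nsum_recl h) /=.
rewrite [X in _ - (_ + X)](_ : _ = nsum (fun i => B (n - 1 - i%:Z) (A (m + 1 + i%:Z) v))).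
  by rewrite opprD addrCA subrr addr0; congr (- B _ (A _ _)); lia.
by apply: eq_nsum => i; congr (B _ (A _ _)); lia.
Qed.

Lemma nop_linear A B : is_field A -> is_field B -> linear_modes (nop A B).
Proof.
move=> Af Bf n a u v; rewrite !nopE scalerDr addrACA; congr (_ + _).
  apply: (nsum_linear (F := fun i v => A (0 - 1 - i%:Z) (B (n + i%:Z) v))).
    by move=> i; apply: comp_linear; [apply: field_linear Af _ | apply: field_linear Bf _].
  by move=> w; exact: (nopl_bound 0 n w Af Bf).
apply: (nsum_linear (F := fun i v => B (n - 1 - i%:Z) (A (0 + i%:Z) v))).
  by move=> i; apply: comp_linear; [apply: field_linear Bf _ | apply: field_linear Af _].
by move=> w; exact: (nopr_bound 0 n w Af Bf).
Qed.

Lemma nop_field A B : is_field A -> is_field B -> is_field (nop A B).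
Proof.
move=> Af Bf; split; first exact: nop_linear.
move=> v; have [n0 h0] := nopl_eq0 v Af Bf; have [N hN] := field_truncated Af v.
(* In the second half of the product only the finitely many [i < absz N] contribute, so a single
   bound on n serves all of them. *)
have [n1 h1] : exists n1 : int, forall (i : nat) n, (i < absz N)%N -> n1 <= n ->
    B (n - 1 - i%:Z) (A (0 + i%:Z) v) = 0.
  elim: (absz N) => [|M [n1 h1]]; first by exists 0.
  have [n2 h2] := field_truncated Bf (A (0 + M%:Z) v).
  exists (Num.max n1 (n2 + 1 + M%:Z)) => i n iM; rewrite ge_max => /andP[n1n n2n].
  have [->|iM'] := eqVneq i M; first by apply: h2; lia.
  by apply: (h1 i n); lia.
exists (Num.max n0 n1) => n; rewrite ge_max => /andP[n0n n1n].
rewrite nopE h0 // add0r; apply: nsum0 => i.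
have [iN|iN] := ltnP i (absz N); first exact: h1.
by rewrite hN ?(linf0 (field_linear Bf (n - 1 - i%:Z))) //; lia.
Qed.

(* The residue in z of (z - w)^j [A(z), B(w)]. *)
Definition nprod (j : nat) A B : series V := fun n v => iter j (@dzw V) (comm A B v) 0 n.

End Products.

Section Dong.
Context {C : numFieldType} {V : lmodType C}.
Local Notation array3 := (int -> int -> int -> V).
Local Notation dzw3 := (@dzw (int -> V)).
Variables (A B D : series V) (b c : nat).
Let iter_dwu_map k (f : int -> V -> V) (F : array3) : (forall m, linear (f m)) ->
  iter k (@dwu C V) (fun m n l => f m (F m n l)) = fun m n l => f m (iter k (@dzw V) (F m) n l).
Proof.
move=> fL; elim: k => //= k ->; apply: eq_array3 => m n l.
by rewrite /dwu /dzw (linfB (fL m)).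
Qed.

Let iter_dzu_map k (g : int -> V -> V) (F : array3) : (forall n, linear (g n)) ->
  iter k (@dzu C V) (fun m n l => g n (F n m l)) = fun m n l => g n (iter k (@dzw V) (F n) m l).
Proof.
move=> gL; elim: k => //= k ->; apply: eq_array3 => m n l.
by rewrite /dzu /dzw (linfB (gL n)).
Qed.

Hypotheses (Af : is_field A) (Bf : is_field B) (Df : is_field D).
Hypothesis AD : forall v, iter b (@dzw V) (comm A D v) = 0.
Hypothesis BD : forall v, iter c (@dzw V) (comm B D v) = 0.

(** The condition (z - u)^b (w - u)^c F = 0, which is the second hypothesis of [dwu_nilpotent]. *)
Let kill (F : array3) := iter b (@dzu C V) (iter c (@dwu C V) F) = 0.

Let killD F G : kill F -> kill G -> kill (F + G).
Proof.
by rewrite /kill (iter_addfD (@dwuD C V)) (iter_addfD (@dzuD C V)) => -> ->; rewrite addr0.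
Qed.

Let killN F : kill F -> kill (- F).
Proof.
by rewrite /kill (iter_addfN (@dwuD C V)) (iter_addfN (@dzuD C V)) => ->; rewrite oppr0.
Qed.

Let kill_AD (g : int -> V -> V) (w : int -> V) : (forall n, linear (g n)) ->
  kill (fun m n l => g n (comm A D (w n) m l)).
Proof.
move=> gL; rewrite /kill (iter_comm _ _ _ (@dzu_dwu C V)).
rewrite (iter_dzu_map _ (fun n => comm A D (w n))) //.
rewrite [X in iter c _ X](_ : _ = 0) ?(iter_addf0 (@dwuD C V)) //.
by apply: eq_array3 => m n l; rewrite AD; apply: linf0 (gL n).
Qed.

Let kill_BD (f : int -> V -> V) (w : int -> V) : (forall m, linear (f m)) ->
  kill (fun m n l => f m (comm B D (w m) n l)).
Proof.
move=> fL; rewrite /kill (iter_dwu_map _ (fun m => comm B D (w m))) //.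
rewrite [X in iter b _ X](_ : _ = 0) ?(iter_addf0 (@dzuD C V)) //.
by apply: eq_array3 => m n l; rewrite BD; apply: linf0 (fL m).
Qed.

Let AB_D v : array3 := fun m n l => A m (B n (D l v)) - D l (A m (B n v)).
Let BA_D v : array3 := fun m n l => B n (A m (D l v)) - D l (B n (A m v)).

Let kill_AB_D v : kill (AB_D v).
Proof.
have -> : AB_D v = (fun m n l => A m (comm B D v n l)) + (fun m n l => comm A D (B n v) m l).
  apply: eq_array3 => m n l; rewrite !addrfctE /comm (linfB (field_linear Af m)).
  by rewrite addrA subrK.
by apply: killD; [apply: (kill_BD (fun=> v)); apply: field_linear
                 | apply: (kill_AD (g := fun=> id) (fun n => B n v))].
Qed.

Let kill_BA_D v : kill (BA_D v).
Proof.
have -> : BA_D v = (fun m n l => B n (comm A D v m l)) + (fun m n l => comm B D (A m v) n l).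
  apply: eq_array3 => m n l; rewrite !addrfctE /comm (linfB (field_linear Bf n)).
  by rewrite addrA subrK.
by apply: killD; [apply: (kill_AD (fun=> v)); apply: field_linear
                 | apply: (kill_BD (f := fun=> id) (fun m => A m v))].
Qed.

Let bracket (G : int -> int -> V -> V) v : array3 :=
  fun m n l => G m n (D l v) - D l (G m n v).

(** By [dwu_nilpotent] a power of w - u kills the bracket of G(z, w) with D(u). This factor does not
    involve z, so it also kills the residue in z, the slice m = 0. *)
Let local_residue (G : int -> int -> V -> V) a :
  (forall v, iter a (@dzw V) (fun m n => G m n v) = 0) ->
  (forall v, kill (bracket G v)) -> local (fun n => G 0 n) D.
Proof.
move=> Ga Gk; exists (a + b + c)%N => v.
have H0 : iter a (@dzw (int -> V)) (bracket G v) = 0.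
  apply: eq_array3 => m n l.
  have -> (k : nat) (F : array3) : iter k (@dzw (int -> V)) F m n l =
      iter k (@dzw V) (fun m n => F m n l) m n.
    by elim: k m n => //= k IH m' n'; rewrite /dzw -!IH.
  rewrite [fun m n => _](_ : _ = (fun m n => G m n (D l v)) - (fun m n => D l (G m n v))) //.
  rewrite (iter_addfD (@dzwD V)) (iter_addfN (@dzwD V)) Ga.
  rewrite (iter_dzw_map _ (fun m n => G m n v)) => [|x y]; last exact: linfB (field_linear Df l) x y.
  by rewrite Ga sub0r !opprfctE (linf0 (field_linear Df l)) oppr0.
have := dwu_nilpotent H0 (Gk v); set k := (a + b + c)%N => Hk.
apply: eq_array2 => n l; have := congr1 (fun F : array3 => F 0 n l) Hk.
have -> (j : nat) (F : array3) : iter j (@dwu C V) F 0 n l = iter j (@dzw V) (F 0) n l.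
  by elim: j n l => //= j IH n' l'; rewrite /dzw /dwu !IH.
by [].
Qed.

Let kill_dzw F : kill (dzw3 F) ->
  dzw3 (iter b (@dzu C V) (iter c (@dwu C V) F)) = 0.
Proof.
by rewrite /kill -(iter_comm 1 _ _ (@dzw_dwu C V)) -(iter_comm 1 _ _ (@dzw_dzu C V)).
Qed.

(** Multiplying by z - w turns the bracket into that of A(z)B(w) with D(u), which is killed. The
    factor z - w can then be cancelled by [dzw_eq0], because everything is truncated in w. *)
Let kill_nopl v : kill (bracket (nopl A B) v).
Proof.
pose vanish (F : array3) := forall l, exists n0 : int, forall m n, n0 <= n -> F m n l = 0.
have vanish_u j F : vanish F -> vanish (iter j (@dzu C V) F).
  move=> F0; elim: j => //= j IH l; have [[n1 h1] [n2 h2]] := (IH l, IH (l + 1)).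
  exists (Num.max n1 n2) => m n; rewrite ge_max => /andP[n1n n2n].
  by rewrite /dzu h1 ?h2 ?subr0.
have vanish_w j F : vanish F -> vanish (iter j (@dwu C V) F).
  move=> F0; elim: j => //= j IH l; have [[n1 h1] [n2 h2]] := (IH l, IH (l + 1)).
  exists (Num.max n1 n2) => m n; rewrite ge_max => /andP[n1n n2n].
  by rewrite /dwu h1 ?h2 ?subr0 //; lia.
have H0 : vanish (bracket (nopl A B) v).
  move=> l; have [[n1 h1] [n2 h2]] := (nopl_eq0 v Af Bf, nopl_eq0 (D l v) Af Bf).
  exists (Num.max n1 n2) => m n; rewrite ge_max => /andP[n1n n2n].
  by rewrite /bracket h1 // h2 // (linf0 (field_linear Df l)) subr0.
have dH : dzw3 (bracket (nopl A B) v) = AB_D v.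
  apply: eq_array3 => m n l; rewrite /dzw /bracket /AB_D !addrfctE !opprfctE.
  have E w m' n' := congr1 (fun F : int -> int -> V => F m' n') (dzw_nopl w Af Bf).
  rewrite -!E /dzw (linfB (field_linear Df l)) !opprB addrACA [RHS]addrACA.
  by congr (_ + _); apply: addrC.
have := @kill_dzw (bracket (nopl A B) v); rewrite dH => /(_ (kill_AB_D v)) X0.
apply: eq_array3 => m n l.
set X := iter b _ _ in X0 *.
have XV : vanish X by apply: vanish_u; apply: vanish_w.
have := @dzw_eq0 V (fun m n => X m n l); move=> H.
rewrite (congr1 (fun F => F m n) (H _ _)) //.
by apply: eq_array2 => m' n'; have := congr1 (fun F : array3 => F m' n' l) X0.
Qed.

(** As in [kill_nopl], but with the other expansion of (z - w)^(-1): the truncation is now in z. *)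
Let kill_nopr v : kill (bracket (nopr A B) v).
Proof.
pose vanish (F : array3) := forall l, exists m0 : int, forall m n, m0 <= m -> F m n l = 0.
have vanish_u j F : vanish F -> vanish (iter j (@dzu C V) F).
  move=> F0; elim: j => //= j IH l; have [[n1 h1] [n2 h2]] := (IH l, IH (l + 1)).
  exists (Num.max n1 n2) => m n; rewrite ge_max => /andP[n1n n2n].
  by rewrite /dzu h1 ?h2 ?subr0 //; lia.
have vanish_w j F : vanish F -> vanish (iter j (@dwu C V) F).
  move=> F0; elim: j => //= j IH l; have [[n1 h1] [n2 h2]] := (IH l, IH (l + 1)).
  exists (Num.max n1 n2) => m n; rewrite ge_max => /andP[n1n n2n].
  by rewrite /dwu h1 ?h2 ?subr0.
have H0 : vanish (bracket (nopr A B) v).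
  move=> l; have [[n1 h1] [n2 h2]] := (nopr_eq0 v Af Bf, nopr_eq0 (D l v) Af Bf).
  exists (Num.max n1 n2) => m n; rewrite ge_max => /andP[n1n n2n].
  by rewrite /bracket h1 // h2 // (linf0 (field_linear Df l)) subr0.
have dH : dzw3 (bracket (nopr A B) v) = - BA_D v.
  apply: eq_array3 => m n l; rewrite /dzw /bracket /BA_D !addrfctE !opprfctE.
  have E w m' n' := congr1 (fun F : int -> int -> V => - F m' n') (dzw_nopr w Af Bf).
  have {}E w m' n' : B n' (A m' w) = nopr A B m' (n' + 1) w - nopr A B (m' + 1) n' w.
    by have := E w m' n'; rewrite /dzw opprB opprK => ->.
  rewrite !E (linfB (field_linear Df l)).
  lmod_ring C V.
have := @kill_dzw (bracket (nopr A B) v); rewrite dH => /(_ (killN (kill_BA_D v))) X0.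
apply: eq_array3 => m n l.
set X := iter b _ _ in X0 *.
have XV : vanish X by apply: vanish_u; apply: vanish_w.
have := @dzw_eq0_sym V (fun m n => X m n l); move=> H.
rewrite (congr1 (fun F => F m n) (H _ _)) //.
by apply: eq_array2 => m' n'; have := congr1 (fun F : array3 => F m' n' l) X0.
Qed.

(** G is (z - w)^(-1) [A(z), B(w)] with both expansions combined; multiplying by z - w gives back
    the commutator, so N + 1 factors kill G. *)
Lemma dong_nop : local A B -> local (nop A B) D.
Proof.
case=> N AB; pose G m n v := nopl A B m n v + nopr A B m n v.
rewrite (_ : nop A B = fun n => G 0 n); last first.
  by apply/funext => n; apply/funext => v; apply: nopE.
apply: (@local_residue G N.+1) => v.
  rewrite iterSr (_ : dzw _ = comm A B v) //.
  rewrite (_ : (fun m n => _) = (fun m n => nopl A B m n v) + (fun m n => nopr A B m n v)) //.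
  by rewrite dzwD dzw_nopl // dzw_nopr.
have -> : bracket G v = bracket (nopl A B) v + bracket (nopr A B) v.
  apply: eq_array3 => m n l; rewrite /bracket /G !addrfctE (linfD (field_linear Df l)).
  by rewrite opprD addrACA.
by apply: killD.
Qed.

Lemma dong_nprod j : local A B -> local (nprod j A B) D.
Proof.
case=> N AB; pose G m n v := iter j (@dzw V) (comm A B v) m n.
apply: (@local_residue G N) => v.
  rewrite [X in iter N _ X](_ : _ = iter j (@dzw V) (comm A B v)) // -iterD.
  by apply: (iter_eq0_le (@dzwD V) _ (AB v)); apply: leq_addr.
have -> : bracket G v = iter j dzw3 (AB_D v - BA_D v).
  apply: eq_array3 => m n l; rewrite /bracket /G.
  have -> (k : nat) (F : array3) : iter k dzw3 F m n l =
      iter k (@dzw V) (fun m n => F m n l) m n.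
    by elim: k m n => //= k IH m' n'; rewrite /dzw -!IH.
  have DB : {morph D l : x y / x - y} by move=> x y; apply: linfB (field_linear Df l) x y.
  have /= <- := congr1 (fun F => F m n) (iter_dzw_map j (comm A B v) DB).
  have -> : (fun m n => (AB_D v - BA_D v) m n l) =
      comm A B (D l v) - (fun m n => D l (comm A B v m n)).
    apply: eq_array2 => m' n'; rewrite !addrfctE !opprfctE /AB_D /BA_D /comm DB.
    by lmod_ring C V.
  move: (comm A B (D l v)) (fun m n => D l (comm A B v m n)) => X Y.
  by rewrite (iter_addfD (@dzwD V)) (iter_addfN (@dzwD V)).
have : kill (AB_D v - BA_D v) by apply: killD => //; apply: killN.
rewrite /kill => h; rewrite -!(iter_comm _ _ _ (@dzw_dwu C V)) -!(iter_comm _ _ _ (@dzw_dzu C V)) h.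
exact: iter_addf0 (@dzwD _) _.
Qed.

End Dong.

(** * Stability of fields and locality under the operations *)

Section ProductClosure.
Context {C : numFieldType} {V : lmodType C}.
Implicit Types A B D : series V.

Lemma local_nop A B D : is_field A -> is_field B -> is_field D ->
  local A B -> local A D -> local B D -> local (nop A B) D.
Proof. by move=> Af Bf Df AB [b AD] [c BD]; apply: dong_nop BD _. Qed.

Lemma local_nprod j A B D : is_field A -> is_field B -> is_field D ->
  local A B -> local A D -> local B D -> local (nprod j A B) D.
Proof. by move=> Af Bf Df AB [b AD] [c BD]; apply: dong_nprod BD _ _. Qed.

Lemma nprod_field j A B : is_field A -> is_field B -> is_field (nprod j A B).
Proof.
move=> Af Bf; split=> [n a u v|v].
  rewrite /nprod !iter_dzwE scaler_sumr -big_split; apply: eq_bigr => i _.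
  rewrite /= scalerA mulrC -scalerA -scalerDr; congr (_ *: _); rewrite /comm.
  rewrite !(field_linear Af, field_linear Bf).
  by lmod_ring C V.
suff [n0 h0] : exists n0 : int, forall n, n0 <= n -> iter j (@dzw V) (comm A B v) 0 n = 0.
  by exists n0.
elim: j 0 => [|j IH] m.
  have [[n1 h1] [n2 h2]] := (field_truncated Bf v, field_truncated Bf (A m v)).
  exists (Num.max n1 n2) => n; rewrite ge_max => /andP[n1n n2n].
  by rewrite /= /comm h1 // h2 // (linf0 (field_linear Af m)) subr0.
have [[n1 h1] [n2 h2]] := (IH (m + 1), IH m).
exists (Num.max n1 n2) => n; rewrite ge_max => /andP[n1n n2n] /=.
by rewrite /dzw h1 // h2 ?subr0 //; lia.
Qed.

Lemma sderiv_field A : is_field A -> is_field (sderiv A).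
Proof.
move=> Af; split=> [n a u v|v].
  by rewrite /sderiv (field_linear Af) scalerDr !scalerA mulrC.
have [N h] := field_truncated Af v.
by exists (N + 1) => n Nn; rewrite /sderiv h ?scaler0 //; lia.
Qed.

Lemma sscale_field c A : is_field A -> is_field (sscale c A).
Proof.
move=> Af; split=> [n a u v|v].
  by rewrite /sscale (field_linear Af) scalerDr !scalerA mulrC.
have [N h] := field_truncated Af v.
by exists N => n Nn; rewrite /sscale h ?scaler0.
Qed.

Lemma sadd_field A B : is_field A -> is_field B -> is_field (sadd A B).
Proof.
move=> Af Bf; split=> [n a u v|v].
  by rewrite /sadd (field_linear Af) (field_linear Bf) scalerDr addrACA.
have [[N h] [M k]] := (field_truncated Af v, field_truncated Bf v).
exists (Num.max N M) => n; rewrite ge_max => /andP[Nn Mn].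
by rewrite /sadd h // k // addr0.
Qed.

Lemma sconst_id_field : is_field (sconst id : series V).
Proof.
split=> [n a u v|v]; rewrite /sconst; first by case: eqP => _; rewrite ?scaler0 ?addr0.
by exists 0 => n n0; case: eqP => // E; lia.
Qed.

(** When the modes commute, the plain product is locally finite and needs no reordering. This
    replaces the [sprod] of the currents by [nop], to which Dong's lemma applies. *)
Lemma sprod_nop A B : is_field A -> is_field B ->
  (forall m n v, A m (B n v) = B n (A m v)) -> sprod A B = nop A B.
Proof.
move=> Af Bf AB; apply/funext => n; apply/funext => v.
rewrite /sprod /nop fsum_int_neg fsum_int_nneg.
have [M hM] := field_truncated Bf v; have [N hN] := field_truncated Af v.
rewrite (@fsum_int _ _ (absz (M - n) + absz N)%N).
  by congr (_ + _); apply: eq_nsum => i; rewrite AB.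
move=> i iN; split; first by rewrite AB hN ?(linf0 (field_linear Bf _)) //; lia.
by rewrite hM ?(linf0 (field_linear Af _)) //; lia.
Qed.

End ProductClosure.

(** * The reconstruction theorem *)

Section GeneralizedBinomial.
Variable C : numFieldType.

Definition gbin (m : int) (j : nat) : C := (\prod_(i < j) (m - i%:Z)%:~R) / j`!%:R.

Lemma gbin0 m : gbin m 0 = 1.
Proof. by rewrite /gbin big_ord0 fact0 divr1. Qed.

Lemma gbin0S j : gbin 0 j.+1 = 0.
Proof. by rewrite /gbin big_ord_recl /= !mul0r. Qed.

Lemma gbinS m j : gbin (m + 1) j.+1 = gbin m j.+1 + gbin m j.
Proof.
rewrite /gbin big_ord_recl [in RHS]big_ord_recr /=.
have -> : \prod_(i < j) (m + 1 - (bump 0 i)%:Z)%:~R = \prod_(i < j) (m - i%:Z)%:~R :> C.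
  by apply: eq_bigr => i _; congr (_%:~R); rewrite /bump; lia.
rewrite factS natrM invfM.
have j1 : j.+1%:R != 0 :> C by rewrite pnatr_eq0.
have jf : (j`!%:R : C) != 0 by rewrite pnatr_eq0 -lt0n fact_gt0.
by field; rewrite jf /=; rewrite -natr1 in j1 *; rewrite addrC.
Qed.

(** The coefficient form of the expansion in derivatives of delta(z - w). By Pascal's rule [gbinS]
    both sides have the same product with z - w, by induction, and they agree on the row m = 0;
    [dzw_base_eq0] concludes. *)
Lemma dzw_taylor (V : lmodType C) N (F : int -> int -> V) m n :
  iter N (@dzw V) F = 0 ->
  F m n = \sum_(j < N) gbin m j *: iter j (@dzw V) F 0 (m + n - j%:Z).
Proof.
elim: N F m n => [|N IH] F m n FN; first by rewrite big_ord0 (_ : F = 0).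
pose H : int -> int -> V := fun m n => \sum_(j < N.+1) gbin m j *: iter j (@dzw V) F 0 (m + n - j%:Z).
suff FH : F - H = 0.
  by have := congr1 (fun G => G m n) FH; move=> /subr0_eq.
have dH : dzw H = dzw F.
  apply: eq_array2 => {}m {}n; rewrite (IH (dzw F)); last by rewrite -iterSr.
  rewrite /dzw /H -sumrB big_ord_recl !gbin0 (_ : m + 1 + n = m + (n + 1)); last by lia.
  rewrite subrr add0r; apply: eq_bigr => j _; rewrite lift0.
  rewrite (_ : m + (n + 1) - j.+1%:Z = m + n - j%:Z); last by lia.
  by rewrite -scalerBl gbinS addrAC subrr add0r -iterSr.
apply: dzw_base_eq0; first by rewrite dzwD (iter_addfN (@dzwD V) 1 H : dzw (- H) = - dzw H) dH subrr.
move=> {}n; rewrite !addrfctE !opprfctE /H big_ord_recl big1 => [|j _].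
  by rewrite gbin0 scale1r addr0 /= subr0 add0r subrr.
by rewrite lift0 gbin0S scale0r.
Qed.

End GeneralizedBinomial.

Section Reconstruction.
Context {C : numFieldType} {V : lmodType C}.
Variables (vac : V) (D : V -> V) (gen : series V -> Prop).
Implicit Types A B X : series V.

Definition covariant A := forall n v, D (A n v) - A n (D v) = sderiv A n v.

(** The input of the reconstruction theorem. [vg_span] says, as an induction principle, that the
    modes of the generators produce the whole space from the vacuum. *)
Record vertex_generators : Prop := VertexGenerators {
  vg_linear : linear D;
  vg_vac : D vac = 0;
  vg_field : forall X, gen X -> is_field X;
  vg_covariant : forall X, gen X -> covariant X;
  vg_local : forall X Y, gen X -> gen Y -> local X Y;
  vg_span : forall P : V -> Prop, P vac ->
    (forall a u v, P u -> P v -> P (a *: u + v)) ->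
    (forall X n v, gen X -> P v -> P (X n v)) -> forall v, P v
}.

Hypothesis vg : vertex_generators.

Let D_linear : linear D. Proof. exact: vg_linear vg. Qed.
Let D_vac : D vac = 0. Proof. exact: vg_vac vg. Qed.
Let gen_field X : gen X -> is_field X. Proof. exact: (vg_field vg). Qed.
Let gen_covariant X : gen X -> covariant X. Proof. exact: (vg_covariant vg). Qed.
Let gen_local X Y : gen X -> gen Y -> local X Y. Proof. exact: (vg_local vg). Qed.
Let gen_span := vg_span vg.

(* Locality with the generators only: that any two such series are mutually  *)
(* local is a consequence, see [good_mutually_local].                        *)
Record good A : Prop := Good {
  good_field : is_field A;
  good_covariant : covariant A;
  good_local : forall X, gen X -> local A X
}.

Lemma good_gen X : gen X -> good X.
Proof. by move=> gX; split; [exact: gen_field | exact: gen_covariant | move=> Z; exact: gen_local]. Qed.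

Let modeL A n : good A -> linear (A n).
Proof. by case=> -[]. Qed.

Let genL X : gen X -> linear_modes X.
Proof. by move=> /gen_field[]. Qed.

Lemma good_sadd A B : good A -> good B -> good (sadd A B).
Proof.
move=> Ag Bg; split; first by apply: sadd_field; apply: good_field.
  move=> n v; rewrite /sadd (linfD D_linear) opprD addrACA (good_covariant Ag) (good_covariant Bg).
  by rewrite /sderiv scalerDr.
by move=> X gX; apply: local_sadd; [exact: genL | exact: good_local | exact: good_local].
Qed.

Lemma good_sscale a A : good A -> good (sscale a A).
Proof.
move=> Ag; split; first by apply: sscale_field; apply: good_field.
  move=> n v; rewrite /sscale (linfZ D_linear) -scalerBr (good_covariant Ag).
  by rewrite /sderiv !scalerA mulrC.
by move=> X gX; apply: local_sscale; [exact: genL | exact: good_local].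
Qed.

Lemma good_sderiv A : good A -> good (sderiv A).
Proof.
move=> Ag; split; first by apply: sderiv_field; apply: good_field.
  move=> n v; rewrite [in LHS]/sderiv (linfZ D_linear) -scalerBr (good_covariant Ag).
  by rewrite /sderiv.
by move=> X gX; apply: local_sderiv; [exact: genL | exact: good_local].
Qed.

Lemma good_sconst : good (sconst id).
Proof.
split; first exact: sconst_id_field.
  move=> n v; rewrite /sderiv /sconst; have [->|n1] := eqVneq n (-1).
    by rewrite subrr (_ : (- 1 - 1 == - 1 :> int) = false) ?scaler0.
  rewrite (linf0 D_linear) subr0; have [n0|] := eqVneq (n - 1) (-1); last by rewrite scaler0.
  by rewrite (_ : n = 0) ?oppr0 ?scale0r //; lia.
move=> X gX; apply: local_commuting => m n v; rewrite /sconst; case: eqP => // _.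
by rewrite (linf0 (genL gX n)).
Qed.

Let covariantE A n v : covariant A -> D (A n v) = A n (D v) + (- n)%:~R *: A (n - 1) v.
Proof. by move=> Ac; have := Ac n v; rewrite /sderiv => <-; rewrite addrC subrK. Qed.

(** The Leibniz rule. In each half the derivative shifts the index of A as well as that of B, so the
    partial sums telescope up to a boundary term [k *: f k] or [k *: g k.-1], which vanishes beyond
    the bounds [N1] to [N6]. *)
Lemma nop_covariant A B : is_field A -> is_field B -> covariant A -> covariant B ->
  covariant (nop A B).
Proof.
move=> Af Bf Ac Bc n v; rewrite /sderiv !nopE.
have [[N1 h1] [N2 h2]] := (nopl_bound 0 n v Af Bf, nopl_bound 0 n (D v) Af Bf).
have [[N3 h3] [N4 h4]] := (nopr_bound 0 n v Af Bf, nopr_bound 0 n (D v) Af Bf).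
have [[N5 h5] [N6 h6]] := (nopl_bound 0 (n - 1) v Af Bf, nopr_bound 0 (n - 1) v Af Bf).
pose N := (N1 + N2 + N3 + N4 + N5 + N6)%N.
have w N' (f : nat -> V) : (forall i, (N' <= i)%N -> f i = 0) -> (N' <= N.+1)%N ->
    nsum f = \sum_(i < N.+1) f i.
  by move=> hf NN; apply: nsumE => i Ni; apply: hf; lia.
rewrite /nopl /nopr (w _ _ h1) ?(w _ _ h2) ?(w _ _ h3) ?(w _ _ h4) ?(w _ _ h5) ?(w _ _ h6);
  try by rewrite /N; lia.
rewrite (linfD D_linear) !(linf_sum D_linear) opprD addrACA -!sumrB scalerDr.
pose f i := A (0 - 1 - i%:Z) (B (n - 1 + i%:Z) v).
pose g i := B (n - 1 - 1 - i%:Z) (A (0 + i%:Z) v).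
have S (h : nat -> V) k : \sum_(i < k.+1) h i = \sum_(i < k) h i + h k.
  by rewrite big_ord_recr.
congr (_ + _).
  have -> k : \sum_(i < k) (D (A (0 - 1 - i%:Z) (B (n + i%:Z) v)) -
       A (0 - 1 - i%:Z) (B (n + i%:Z) (D v))) = k%:R *: f k - n%:~R *: \sum_(i < k) f i.
    elim: k => [|k IH]; first by rewrite !big_ord0 scale0r scaler0 subr0.
    rewrite [LHS]big_ord_recr /= IH (covariantE _ _ Ac) (covariantE _ _ Bc) (S f).
    rewrite (linfD (field_linear Af _)) (linfZ (field_linear Af _)).
    have -> : A (0 - 1 - k%:Z - 1) (B (n + k%:Z) v) = f k.+1 by congr (A _ (B _ _)); lia.
    have -> : A (0 - 1 - k%:Z) (B (n + k%:Z - 1) v) = f k by congr (A _ (B _ _)); lia.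
    lmod_coefs C V; ring.
  by rewrite /f h5 ?scaler0 ?sub0r ?rmorphN ?scaleNr //; lia.
have -> k : \sum_(i < k) (D (B (n - 1 - i%:Z) (A (0 + i%:Z) v)) -
     B (n - 1 - i%:Z) (A (0 + i%:Z) (D v))) = k%:R *: g k.-1 - n%:~R *: \sum_(i < k) g i.
  elim: k => [|k IH]; first by rewrite !big_ord0 scale0r scaler0 subr0.
  rewrite [LHS]big_ord_recr /= IH (covariantE _ _ Bc) (covariantE _ _ Ac) (S g).
  rewrite (linfD (field_linear Bf _)) (linfZ (field_linear Bf _)).
  have -> : B (n - 1 - k%:Z - 1) (A (0 + k%:Z) v) = g k by congr (B _ (A _ _)); lia.
  have -> : (- (0 + k%:Z))%:~R *: B (n - 1 - k%:Z) (A (0 + k%:Z - 1) v) = - k%:R *: g k.-1.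
    case: k {IH} => [|k]; first by rewrite (_ : - (0 + 0%:Z) = 0) // mulr0n oppr0 !scale0r.
    rewrite add0r rmorphN; congr (_ *: B _ (A _ _)); lia.
  lmod_coefs C V; ring.
by rewrite /g h6 ?scaler0 ?sub0r ?rmorphN ?scaleNr //; lia.
Qed.

Lemma nprod_covariant j A B : is_field A -> is_field B -> covariant A -> covariant B ->
  covariant (nprod j A B).
Proof.
move=> Af Bf Ac Bc n v; rewrite /nprod /sderiv.
(* d/dz + d/dw commutes with z - w, so the formula for general m passes through the induction on j;
   at m = 0 the first term disappears. *)
suff -> (m : int) : D (iter j (@dzw V) (comm A B v) m n) - iter j (@dzw V) (comm A B (D v)) m n
   = (- m)%:~R *: iter j (@dzw V) (comm A B v) (m - 1) n +
     (- n)%:~R *: iter j (@dzw V) (comm A B v) m (n - 1).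
  by rewrite oppr0 scale0r add0r.
elim: j m n => [|j IH] m n /=.
  rewrite /comm (linfB D_linear) !(covariantE _ _ Ac, covariantE _ _ Bc).
  rewrite !(linfD (field_linear Af _), linfD (field_linear Bf _)).
  rewrite !(linfZ (field_linear Af _), linfZ (field_linear Bf _)).
  lmod_coefs C V; ring.
rewrite {1 2 3 4}/dzw (linfB D_linear).
have -> (a b c d : V) : a - b - (c - d) = a - c - (b - d) by lmod_ring C V.
rewrite !IH; move: (iter j _ _) => G; rewrite /dzw.
have -> : m + 1 - 1 = m by lia.
have -> : n + 1 - 1 = n by lia.
have -> : m - 1 + 1 = m by lia.
have -> : n - 1 + 1 = n by lia.
lmod_coefs C V; ring.
Qed.

(** One factor is a generator because [good] supplies locality only against generators. [good_nop]
    removes this restriction once [good_mutually_local] is available. *)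
Lemma good_nop_gen X B : gen X -> good B -> good (nop X B).
Proof.
move=> gX Bg; have Xg := good_gen gX; have [[Xf Xc _] [Bf Bc Bl]] := (Xg, Bg).
split; [exact: nop_field | exact: nop_covariant | move=> Z gZ].
apply: local_nop => //; [exact: gen_field | | exact: gen_local | exact: Bl].
by apply: local_sym; apply: Bl.
Qed.

Lemma good_nprod_gen j X B : gen X -> good B -> good (nprod j X B).
Proof.
move=> gX Bg; have Xg := good_gen gX; have [[Xf Xc _] [Bf Bc Bl]] := (Xg, Bg).
split; [exact: nprod_field | exact: nprod_covariant | move=> Z gZ].
apply: local_nprod => //; [exact: gen_field | | exact: gen_local | exact: Bl].
by apply: local_sym; apply: Bl.
Qed.

(** Since D kills the vacuum, D (A_k 1) = - k A_(k-1) 1. Starting from the truncation bound this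
    propagates vanishing downwards as long as k is nonzero, hence down to index 0. *)
Lemma good_vac A n : good A -> 0 <= n -> A n vac = 0.
Proof.
move=> Ag; have [N h] := field_truncated (good_field Ag) vac.
have Dvac k : D (A k vac) = (- k)%:~R *: A (k - 1) vac.
  by rewrite (covariantE _ _ (good_covariant Ag)) D_vac (linf0 (modeL _ Ag)) add0r.
suff down k : N - k%:Z >= 0 -> A (N - k%:Z) vac = 0.
  move=> n0; have [Nn|nN] := lerP N n; first exact: h.
  have -> : n = N - (absz (N - n))%:Z by lia.
  by apply: down; lia.
elim: k => [|k IH] Nk; first by rewrite subr0 h.
have Nk' : 0 < N - k%:Z by lia.
have := Dvac (N - k%:Z); rewrite IH; last exact: ltW.
rewrite (linf0 D_linear) => /esym/eqP; rewrite scaler_eq0 intr_eq0 oppr_eq0.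
rewrite gt_eqF //= => /eqP; have -> : N - k%:Z - 1 = N - k.+1%:Z by lia.
by [].
Qed.

Lemma good_D_state A : good A -> A (- 2) vac = D (A (- 1) vac).
Proof.
move=> Ag; rewrite (covariantE _ _ (good_covariant Ag)) D_vac (linf0 (modeL _ Ag)) add0r.
by rewrite opprK scale1r.
Qed.

(* Goddard's uniqueness theorem. *)
Lemma good_eq0 A : good A -> A (- 1) vac = 0 -> forall n v, A n v = 0.
Proof.
move=> Ag A0.
(* The relation D (A_k 1) = - k A_(k-1) 1 carries the vanishing from index -1 to all lower
   indices. *)
have Avac n : A n vac = 0.
  have [n0|n0] := lerP 0 n; first exact: good_vac.
  have -> : n = - 1 - (absz (n + 1))%:Z by lia.
  elim: (absz _) => [|k IH]; first by rewrite subr0.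
  have := covariantE (- 1 - k%:Z) vac (good_covariant Ag).
  rewrite IH D_vac (linf0 D_linear) (linf0 (modeL _ Ag)) add0r => /esym/eqP.
  rewrite scaler_eq0 intr_eq0 oppr_eq0 (_ : (- 1 - k%:Z == 0) = false) /=; last by lia.
  by move=> /eqP <-; congr (A _ _); lia.
move=> n v; move: v n; apply: gen_span => [//|a u v Pu Pv n|X m v gX Pv n].
  by rewrite (modeL _ Ag) Pu Pv scaler0 addr0.
(* As A kills v, the commutator with X applied to v is A(z)X(w)v. It is killed by a power of z - w
   and truncated in w, so it vanishes. *)
have [N AX] := good_local Ag gX; have [M hM] := field_truncated (gen_field gX) v.
have cE : comm A X v = fun n m => A n (X m v).
  by apply: eq_array2 => n' m'; rewrite /comm Pv (linf0 (genL gX _)) subr0.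
have := AX v; rewrite cE => F0.
suff /(_ N _ F0) F'0 : forall N (F : int -> int -> V), iter N (@dzw V) F = 0 ->
    (exists n0 : int, forall m n, n0 <= n -> F m n = 0) -> F = 0.
  apply: (congr1 (fun F => F n m) (F'0 _)); exists M => m' n' Mn'.
  by rewrite hM ?(linf0 (modeL _ Ag)).
move=> {AX F0 cE N} N F; elim: N F => [//|N IH] F; rewrite iterSr => dF F0.
apply: dzw_eq0 => //; apply: IH => //; have [n0 h0] := F0; exists n0 => m' n' n0n.
by rewrite /dzw !h0 ?subr0 //; lia.
Qed.

Lemma good_unique A B : good A -> good B -> A (- 1) vac = B (- 1) vac -> A = B.
Proof.
move=> Ag Bg AB; apply/funext => n; apply/funext => v; apply/eqP; rewrite -subr_eq0; apply/eqP.
have := @good_eq0 (sadd A (sscale (-1) B)); rewrite /sadd /sscale => H.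
rewrite -scaleN1r H ?scaleN1r ?AB ?subrr //.
by apply: good_sadd => //; apply: good_sscale.
Qed.

Lemma nop_vac A B : good A -> good B -> nop A B (- 1) vac = A (- 1) (B (- 1) vac).
Proof.
move=> Ag Bg; rewrite nopE /nopl /nopr.
rewrite (nsum0 (f := fun i => B (- 1 - 1 - i%:Z) (A (0 + i%:Z) vac))); last first.
  by move=> i; rewrite (good_vac Ag) ?(linf0 (modeL _ Bg)).
rewrite addr0 (@nsumE _ 1) ?big_ord1 //.
by move=> i i1; rewrite (good_vac Bg) ?(linf0 (modeL _ Ag)) //; lia.
Qed.

Lemma nprod_vac j A B : good A -> good B -> nprod j A B (- 1) vac = A j%:Z (B (- 1) vac).
Proof.
move=> Ag Bg; rewrite /nprod.
have cE (m k : nat) : comm A B vac m k = 0.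
  by rewrite /comm !(good_vac Ag, good_vac Bg) ?(linf0 (modeL _ Ag)) ?(linf0 (modeL _ Bg)) ?subr0.
have cE0 i (m k : nat) : iter i (@dzw V) (comm A B vac) m k = 0.
  elim: i m k => [|i IH] m k /=; first exact: cE.
  rewrite /dzw (_ : m%:Z + 1 = m.+1%:Z); last by lia.
  by rewrite (_ : k%:Z + 1 = k.+1%:Z) ?IH ?subr0; last by lia.
have cE1 i (m : nat) : iter i (@dzw V) (comm A B vac) m (- 1) = A (m + i)%:Z (B (- 1) vac).
  elim: i m => [|i IH] m /=.
    by rewrite addn0 /comm (good_vac Ag) // (linf0 (modeL _ Bg)) subr0.
  rewrite /dzw (_ : m%:Z + 1 = m.+1%:Z); last by lia.
  by rewrite IH (_ : - 1 + 1 = 0%:Z) // cE0 subr0 addnS.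
exact: (cE1 _ 0%N).
Qed.

(** Every state comes from a good series, with an invariant Q carried along the construction. Q is
    taken trivial for existence, and equal to locality with a fixed good series for
    [good_mutually_local]. Nonnegative modes of a generator are realized by [nprod], the mode -1 by
    [nop], and lower modes by commutators with D. *)
Lemma good_generated (Q : series V -> Prop) :
  Q (sconst id) ->
  (forall a A B, good A -> good B -> Q A -> Q B -> Q (sadd (sscale a A) B)) ->
  (forall A, good A -> Q A -> Q (sderiv A)) ->
  (forall X B, gen X -> good B -> Q B -> Q (nop X B)) ->
  (forall j X B, gen X -> good B -> Q B -> Q (nprod j X B)) ->
  forall v, exists2 A, good A /\ Q A & A (- 1) vac = v.
Proof.
move=> Q1 Qlin Qd Qnop Qnprod.
pose P v := exists2 A, good A /\ Q A & A (- 1) vac = v.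
have Plin a u v : P u -> P v -> P (a *: u + v).
  move=> [A [Ag QA] <-] [B [Bg QB] <-]; exists (sadd (sscale a A) B) => //.
  by split; [apply: good_sadd => //; apply: good_sscale | apply: Qlin].
have P0 : P 0.
  have P1 : P vac by exists (sconst id); [split; [exact: good_sconst|] | ].
  by have := Plin (-1) _ _ P1 P1; rewrite scaleN1r addNr.
have Psc a u : P u -> P (a *: u) by move=> /(Plin a u 0)/(_ P0); rewrite addr0.
have PD v : P v -> P (D v).
  move=> [A [Ag QA] <-]; exists (sderiv A); first by split; [exact: good_sderiv | exact: Qd].
  by rewrite /sderiv -(good_D_state Ag) opprK scale1r.
apply: gen_span => //; first by exists (sconst id); [split; [exact: good_sconst|] | ].
move=> X n v gX Pv; have [n0|n0] := lerP 0 n.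
  have [A [Ag QA] <-] := Pv; exists (nprod (absz n) X A).
    by split; [exact: good_nprod_gen | exact: Qnprod].
  have -> : X n (A (- 1) vac) = X (absz n)%:Z (A (- 1) vac) by congr (X _ _); lia.
  by apply: nprod_vac => //; exact: good_gen.
have -> : n = - 1 - (absz (n + 1))%:Z by lia.
elim: (absz _) v Pv => [|k IH] v Pv.
  have [A [Ag QA] <-] := Pv; exists (nop X A); first by split; [exact: good_nop_gen | exact: Qnop].
  by rewrite nop_vac // ?subr0 //; exact: good_gen.
(* Covariance at index -1 - k, solved for the next lower mode; characteristic 0 allows the
   division. *)
have -> : X (- 1 - k.+1%:Z) v = (k.+1%:R)^-1 *: (D (X (- 1 - k%:Z) v) - X (- 1 - k%:Z) (D v)).
  rewrite (good_covariant (good_gen gX)) /sderiv scalerA (_ : - 1 - k.+1%:Z = - 1 - k%:Z - 1); last by lia.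
  rewrite (_ : - (- 1 - k%:Z) = k.+1%:Z); last by lia.
  by rewrite mulVf ?scale1r // pnatr_eq0.
rewrite -scaleN1r addrC; apply: Psc; apply: Plin; last by apply: PD; apply: IH.
by apply: IH; apply: PD.
Qed.

Lemma good_state v : exists A, good A /\ A (- 1) vac = v.
Proof.
by have [||||| A [Ag _] Av] := @good_generated (fun=> True) _ _ _ _ _ v => //; exists A.
Qed.

Definition state_field v : series V := projT1 (cid (good_state v)).
Local Notation Y := state_field.

Lemma good_Y v : good (Y v).
Proof. by rewrite /Y; case: cid => A []. Qed.

Lemma Y_state v : Y v (- 1) vac = v.
Proof. by rewrite /Y; case: cid => A []. Qed.

Lemma Y_unique A : good A -> Y (A (- 1) vac) = A.
Proof. by move=> Ag; apply: good_unique => //; [exact: good_Y | rewrite Y_state]. Qed.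

(** [good_generated] yields a series local with B and having the same state as A; by uniqueness it
    is A. *)
Lemma good_mutually_local A B : good A -> good B -> local A B.
Proof.
move=> Ag Bg.
suff [A' [A'g A'B] /(good_unique A'g Ag) <- //] :
  exists2 A', good A' /\ local A' B & A' (- 1) vac = A (- 1) vac.
apply: (@good_generated (fun A => local A B)).
- apply: local_commuting => m n v; rewrite /sconst; case: eqP => // _.
  by rewrite (linf0 (modeL _ Bg)).
- move=> a A1 A2 _ _ h1 h2; have BL n := modeL n Bg.
  by apply: local_sadd => //; apply: local_sscale.
- by move=> A1 _ h1; apply: local_sderiv => // n; apply: modeL.
- move=> X A1 gX A1g h; apply: local_nop => //; try exact: good_field.
  + exact: gen_field.
  + by apply: local_sym; apply: good_local.
  + by apply: local_sym; apply: good_local.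
- move=> j X A1 gX A1g h; apply: local_nprod => //; try exact: good_field.
  + exact: gen_field.
  + by apply: local_sym; apply: good_local.
  + by apply: local_sym; apply: good_local.
Qed.

Lemma good_nop A B : good A -> good B -> good (nop A B).
Proof.
move=> Ag Bg; have [[Af Ac Al] [Bf Bc Bl]] := (Ag, Bg).
split; [exact: nop_field | exact: nop_covariant | move=> Z gZ].
by apply: local_nop; [| | exact: gen_field | exact: good_mutually_local | exact: Al | exact: Bl].
Qed.

Lemma good_nprod j A B : good A -> good B -> good (nprod j A B).
Proof.
move=> Ag Bg; have [[Af Ac Al] [Bf Bc Bl]] := (Ag, Bg).
split; [exact: nprod_field | exact: nprod_covariant | move=> Z gZ].
by apply: local_nprod; [| | exact: gen_field | exact: good_mutually_local | exact: Al | exact: Bl].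
Qed.

(** Both sides are good series with the same value at the vacuum. *)
Lemma Y_nprod j u v : Y (Y u j%:Z v) = nprod j (Y u) (Y v).
Proof.
have g := good_nprod j (good_Y u) (good_Y v); rewrite -(Y_unique g).
by rewrite nprod_vac ?Y_state //; apply: good_Y.
Qed.

Lemma Y_linear : forall n v, linear (fun u => Y u n v).
Proof.
move=> n v a u w; have g : good (sadd (sscale a (Y u)) (Y w)).
  by apply: good_sadd; [apply: good_sscale|]; apply: good_Y.
by have := Y_unique g; rewrite {1}/sadd {1}/sscale !Y_state => ->.
Qed.

Lemma Y_mode_linear u n : linear (Y u n).
Proof. exact: modeL (good_Y u). Qed.

Lemma Y_vac n v : Y vac n v = sconst id n v.
Proof. by have := Y_unique good_sconst; rewrite {1}/sconst eqxx => ->. Qed.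

Lemma Y_creation u n : 0 <= n -> Y u n vac = 0.
Proof. exact: good_vac (good_Y u). Qed.

Theorem state_field_vertex_algebra : is_vertex_algebra Y vac D.
Proof.
split=> //.
- exact: Y_linear.
- exact: Y_mode_linear.
- by move=> u v; apply: field_truncated (good_field (good_Y u)) v.
- by move=> u v; apply: mutually_localP; apply: good_mutually_local; apply: good_Y.
- exact: Y_vac.
- exact: Y_creation.
- exact: Y_state.
- by move=> u n v; apply: good_covariant (good_Y u) n v.
Qed.

(** [dzw_taylor] applied to the commutator, whose coefficients are the products [nprod j], that is,
    the fields of u_(j) v. *)
Lemma Y_commutator u v J : (forall j : nat, (J <= j)%N -> Y u j%:Z v = 0) ->
  forall m n w, Y u m (Y v n w) - Y v n (Y u m w) =
    \sum_(j < J) gbin C m j *: Y (Y u j%:Z v) (m + n - j%:Z) w.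
Proof.
move=> uv0 m n w; have [N /(_ w) uvN] := good_mutually_local (good_Y u) (good_Y v).
rewrite -[LHS]/(comm (Y u) (Y v) w m n).
rewrite (@dzw_taylor _ _ (J + N)); last by apply: (iter_eq0_le (@dzwD V) _ uvN); apply: leq_addl.
rewrite big_split_ord /= addrC big1 ?add0r => [|j _].
  by apply: eq_bigr => j _; rewrite Y_nprod.
rewrite -[iter _ _ _ _ _]/(nprod (J + j) (Y u) (Y v) (m + n - (J + j)%:Z) w) -Y_nprod uv0 ?leq_addr //.
by rewrite (linf0 (Y_linear _ _)) scaler0.
Qed.

(** The form in which all brackets are obtained: the vectors A_(j) B_(-1) 1 with j >= 0 determine
    every commutator of modes, and each only has to be recognized as the state of a known series. *)
Lemma good_commutator A B (P : nat -> series V) J : good A -> good B ->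
  (forall j, (j < J)%N -> good (P j) /\ A j%:Z (B (- 1) vac) = P j (- 1) vac) ->
  (forall j, (J <= j)%N -> A j%:Z (B (- 1) vac) = 0) ->
  forall m n w, A m (B n w) =
    B n (A m w) + \sum_(j < J) gbin C m j *: P j (m + n - j%:Z) w.
Proof.
move=> Ag Bg PJ AB0 m n w.
have := @Y_commutator (A (- 1) vac) (B (- 1) vac) J; rewrite !Y_unique // => /(_ AB0 m n w) E.
rewrite -[LHS](subrK (B n (A m w))) addrC E; congr (_ + _); apply: eq_bigr => j _.
by have [Pg ->] := PJ j (ltn_ord j); rewrite Y_unique.
Qed.

End Reconstruction.

(** * Creation and annihilation operators *)

Section FockOperators.
Variable C : numFieldType.
Local Notation F := (Fock C).
Implicit Types (x y : creator) (v : F).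

Lemma linear_extension_ket (g : fock_basis -> F) b : linear_extension g (ket C b) = g b.
Proof.
by rewrite /linear_extension /ket msuppU oner_eq0 big_seq_fset1 mcoeffUU scale1r.
Qed.

Lemma linear_extensionEw (g : fock_basis -> F) v (d : {fset fock_basis}) :
  (msupp v `<=` d)%fset -> linear_extension g v = \sum_(b <- d) v@_b *: g b.
Proof.
move=> vd; apply: big_fset_incl => // b _ bv.
by rewrite mcoeff_outdom // scale0r.
Qed.

Lemma linear_extension_linear g : linear (linear_extension g : F -> F).
Proof.
move=> a u v; pose d := (msupp u `|` msupp v `|` msupp (a *: u + v))%fset.
rewrite !(@linear_extensionEw _ _ d) /d ?fsubsetUr //; first last.
- by rewrite -fsetUA fsubsetUl.
- by rewrite fsetUAC fsubsetUr.
rewrite scaler_sumr -big_split; apply: eq_bigr => b _.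
by rewrite mcoeffD mcoeffZ scalerDl scalerA.
Qed.

Lemma create_linear x : linear (@create C x). Proof. exact: linear_extension_linear. Qed.
Lemma annihilate_linear x : linear (@annihilate C x).
Proof. exact: linear_extension_linear. Qed.
Lemma momentum_linear : linear (@momentum C). Proof. exact: linear_extension_linear. Qed.
Lemma shift_linear mu : linear (@shift C mu). Proof. exact: linear_extension_linear. Qed.

Lemma fock_ket_ind (P : F -> Prop) :
  (forall a u v, P u -> P v -> P (a *: u + v)) ->
  (forall b, P (ket C b)) -> forall v, P v.
Proof.
move=> Plin Pket.
have Pzero : P 0 by have := Plin (-1) _ _ (Pket (mset0, 0)) (Pket (mset0, 0)); rewrite scaleN1r addNr.
move=> v; rewrite [v]monalgE; elim: (msupp v : seq _) => [|b s IH]; first by rewrite big_nil.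
rewrite big_cons (_ : << v@_b *g b >> = v@_b *: ket C b); first exact: Plin.
by apply/malgP => k; rewrite mcoeffZ !mcoeffU; case: eqP; rewrite ?mulr1 ?mulr0.
Qed.

Lemma fock_ind (P : F -> Prop) :
  (forall a u v, P u -> P v -> P (a *: u + v)) ->
  (forall l, P (ket C (mset0, l))) ->
  (forall x v, P v -> P (create x v)) -> forall v, P v.
Proof.
move=> Plin P0 Pc; apply: fock_ket_ind => // -[m l].
have [s ->] : exists s : seq creator, m = seq_mset s.
  by exists (m : multiset creator); rewrite seq_mset_id.
elim: s => [|x s IH].
  by rewrite (_ : seq_mset [::] = mset0) //; apply/msetP => a; rewrite mset_seqE mset0E.
have -> : ket C (seq_mset (x :: s), l) = create x (ket C (seq_mset s, l)).
  rewrite /create linear_extension_ket /=.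
  suff -> : seq_mset (x :: s) = (x +` seq_mset s)%mset by [].
  by apply/msetP => a; rewrite mset1DE !mset_seqE /= eq_sym.
exact: Pc.
Qed.

Lemma linear_ext (f g : F -> F) : linear f -> linear g ->
  (forall b, f (ket C b) = g (ket C b)) -> f =1 g.
Proof.
move=> fL gL fg; apply: fock_ket_ind => [a u v fu fv|//].
by rewrite fL gL fu fv.
Qed.

Lemma add_linear (f g : F -> F) : linear f -> linear g -> linear (fun v => f v + g v).
Proof. by move=> fL gL a u v; rewrite fL gL scalerDr addrACA. Qed.

Lemma scale_linear c (f : F -> F) : linear f -> linear (fun v => c *: f v).
Proof. by move=> fL a u v; rewrite fL scalerDr !scalerA mulrC. Qed.

Lemma createE x b : create x (ket C b) = ket C ((x +` b.1)%mset, b.2).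
Proof. exact: linear_extension_ket. Qed.
Lemma annihilateE x b :
  annihilate x (ket C b) = (b.1 x)%:R *: ket C ((b.1 `\ x)%mset, b.2).
Proof. exact: linear_extension_ket. Qed.
Lemma momentumE b : momentum (ket C b) = b.2%:~R *: ket C b.
Proof. exact: linear_extension_ket. Qed.
Lemma shiftE mu b : shift mu (ket C b) = ket C (b.1, b.2 + mu).
Proof. exact: linear_extension_ket. Qed.

Definition opE := (createE, annihilateE, momentumE, shiftE).

Lemma create_create x y v : create x (create y v) = create y (create x v).
Proof.
move: v; apply: linear_ext; try by apply: comp_linear; apply: create_linear.
by move=> b; rewrite !opE /= msetDCA.
Qed.

Lemma annihilate_create x y v :
  annihilate x (create y v) = create y (annihilate x v) + (x == y)%:R *: v.
Proof.
move: v; apply: linear_ext.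
- exact: comp_linear (annihilate_linear _) (create_linear _).
- apply: add_linear; first exact: comp_linear (create_linear _) (annihilate_linear _).
  by apply: (@scale_linear _ id).
move=> [m l]; rewrite !opE /= (linfZ (create_linear y)) createE /= mset1DE.
have [<-|xy] := eqVneq x y.
  rewrite msetD1K add1n -natr1 scalerDl.
  have [mx|mx] := posnP (m x); first by rewrite mx !scale0r.
  by rewrite msetB1K // in_mset.
rewrite scale0r addr0 add0n.
suff -> : ((y +` m) `\ x = y +` (m `\ x))%mset by [].
apply/msetP => a; rewrite msetB1E !mset1DE msetB1E.
by have [->|ax] := eqVneq a x; rewrite /= ?(negbTE xy) ?subn0.
Qed.

Lemma annihilate_annihilate x y v :
  annihilate x (annihilate y v) = annihilate y (annihilate x v).
Proof.
have [->//|xy] := eqVneq x y.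
move: v; apply: linear_ext; try by apply: comp_linear; apply: annihilate_linear.
move=> [m l]; rewrite !opE !(linfZ (annihilate_linear _)) !opE /= !scalerA !msetB1E.
rewrite (negbTE xy) eq_sym (negbTE xy) !subn0 mulrC.
suff -> : ((m `\ y) `\ x = (m `\ x) `\ y)%mset by [].
by apply/msetP => a; rewrite !msetE2 subnAC.
Qed.

Lemma momentum_create x v : momentum (create x v) = create x (momentum v).
Proof.
move: v; apply: linear_ext; try by apply: comp_linear; apply: linear_extension_linear.
by move=> b; rewrite !opE (linfZ (create_linear _)) createE.
Qed.

Lemma momentum_annihilate x v : momentum (annihilate x v) = annihilate x (momentum v).
Proof.
move: v; apply: linear_ext; try by apply: comp_linear; apply: linear_extension_linear.
move=> b; rewrite !opE (linfZ (annihilate_linear _)) (linfZ momentum_linear) !opE /=.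
by rewrite !scalerA mulrC.
Qed.

Lemma shift_create mu x v : shift mu (create x v) = create x (shift mu v).
Proof.
move: v; apply: linear_ext; try by apply: comp_linear; apply: linear_extension_linear.
by move=> b; rewrite !opE.
Qed.

Lemma shift_annihilate mu x v : shift mu (annihilate x v) = annihilate x (shift mu v).
Proof.
move: v; apply: linear_ext; try by apply: comp_linear; apply: linear_extension_linear.
by move=> b; rewrite !opE (linfZ (shift_linear _)) !opE.
Qed.

Lemma momentum_shift mu v :
  momentum (shift mu v) = shift mu (momentum v) + mu%:~R *: shift mu v.
Proof.
move: v; apply: linear_ext.
- by apply: comp_linear; apply: linear_extension_linear.
- apply: add_linear; first by apply: comp_linear; apply: linear_extension_linear.
  by apply: scale_linear; apply: shift_linear.
by move=> b; rewrite !opE (linfZ (shift_linear _)) !opE /= rmorphD scalerDl.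
Qed.

End FockOperators.

Section Modes.
Variables (C : numFieldType) (kappa : C).
Local Notation F := (Fock C).
Implicit Types (i j : boson * bool) (v : F).

Definition mode i : series F :=
  match i.1 with
  | Beta => @beta C i.2
  | Gamma => @gamma C i.2
  | Heis => afield kappa i.2
  end.

(** The scalar commutators of the modes. As beta(z) is the sum of beta_n z^(-n), its mode of index m
    is beta_(m+1), whence m + n = -1 in place of 0 for beta and gamma. *)
Definition pairing i j (m n : int) : C :=
  if i.2 != j.2 then 0 else
  match i.1, j.1 with
  | Beta, Gamma => (m + n == - 1)%:R
  | Gamma, Beta => - (m + n == - 1)%:R
  | Heis, Heis => if m + n == 0 then 2 * hkappa kappa i.2 * m%:~R else 0
  | _, _ => 0
  end.

Lemma modeBeta s : mode (Beta, s) = @beta C s. Proof. by []. Qed.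
Lemma modeGamma s : mode (Gamma, s) = @gamma C s. Proof. by []. Qed.
Lemma modeHeis s : mode (Heis, s) = afield kappa s. Proof. by []. Qed.

Lemma mode_neg i p v : mode i (Negz p) v = create (i, p) v.
Proof.
case: i => -[] s //; rewrite /mode /= /beta.
case: p => [|p]; first by rewrite (_ : Negz 0 + 1 = 0).
by rewrite (_ : Negz p.+1 + 1 = Negz p) //; lia.
Qed.

Lemma beta_nneg s p v : @beta C s (Posz p) v = annihilate (Gamma, s, p) v.
Proof. by rewrite /beta (_ : p%:Z + 1 = p.+1%:Z) //; lia. Qed.

Lemma mode_linear i : linear_modes (mode i).
Proof.
case: i => -[] s n; rewrite /mode /=.
- rewrite /beta; case: (n + 1) => [[|p]|p] /=; try exact: create_linear; exact: annihilate_linear.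
- rewrite /gamma; case: n => [p|p] /=; last exact: create_linear.
  by move=> a u v; rewrite annihilate_linear opprD scalerN.
- rewrite /afield; case: n => [[|p]|p] /=; [exact: momentum_linear| |exact: create_linear].
  exact/scale_linear/annihilate_linear.
Qed.

Lemma mode_create i p j q v :
  mode i (Posz p) (create (j, q) v) =
  create (j, q) (mode i (Posz p) v) + pairing i j p (Negz q) *: v.
Proof.
have E (b b' : boson) (s s' : bool) (k : nat) : ((b, s, k) == (b', s', q)) = (b == b') && (s == s') && (k == q).
  by rewrite !xpair_eqE.
have K : (p%:Z + Negz q == - 1) = (p == q) by lia.
case: i j => -[] s [b' s'].
- have -> : pairing (Beta, s) (b', s') p (Negz q) = ((Gamma, s, p) == (b', s', q))%:R.
    by rewrite E /pairing /= K; case: b' => //; case: (s == s').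
  by rewrite modeBeta !beta_nneg annihilate_create.
- have -> : pairing (Gamma, s) (b', s') p (Negz q) = - ((Beta, s, p) == (b', s', q))%:R.
    by rewrite E /pairing /= K; case: b'; case: (s == s') => //=; rewrite oppr0.
  by rewrite modeGamma /gamma [LHS]/= annihilate_create opprD scaleNr -(linfN (create_linear _)).
- case: p K => [|p] K.
    have -> : pairing (Heis, s) (b', s') 0%N (Negz q) = 0.
      by rewrite /pairing /=; case: b'; case: (s == s').
    by rewrite scale0r addr0 modeHeis /afield [LHS]/= momentum_create.
  have -> : pairing (Heis, s) (b', s') p.+1 (Negz q) =
      2 * hkappa kappa s * p.+1%:R * ((Heis, s, p) == (b', s', q))%:R.
    rewrite E /pairing /= (_ : p.+1%:Z + Negz q == 0 = (p == q)); last by lia.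
    by case: b' {E}; case: (s == s'); case: (p == q); rewrite /= ?mulr1 ?mulr0.
  by rewrite modeHeis /afield [LHS]/= annihilate_create scalerDr scalerA -(linfZ (create_linear _)).
Qed.

Lemma mode_nnegE i p :
  (exists c x, mode i (Posz p) =1 fun v => c *: annihilate x v) \/
  mode i (Posz p) =1 @momentum C.
Proof.
case: i => -[] s; rewrite /mode /=.
- by left; exists 1, (Gamma, s, p) => v; rewrite beta_nneg scale1r.
- by left; exists (-1), (Beta, s, p) => v; rewrite /gamma /= scaleN1r.
- case: p => [|p]; first by right.
  by left; exists (2 * hkappa kappa s * p.+1%:R), (Heis, s, p).
Qed.

Lemma mode_mode_nneg i p j q v :
  mode i (Posz p) (mode j (Posz q) v) = mode j (Posz q) (mode i (Posz p) v).
Proof.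
have aZ x := linfZ (@annihilate_linear C x); have mZ := linfZ (@momentum_linear C).
have [[c [x h]]|h] := mode_nnegE i p; have [[d [y k]]|k] := mode_nnegE j q; rewrite !h !k.
- by rewrite !aZ !scalerA mulrC annihilate_annihilate.
- by rewrite mZ momentum_annihilate.
- by rewrite mZ momentum_annihilate.
- by [].
Qed.

Lemma pairing_sym i j m n : pairing i j m n = - pairing j i n m.
Proof.
rewrite /pairing eq_sym (addrC n m); have [ss|] := eqVneq; last by rewrite oppr0.
case: i j ss => -[] s [[] t] /= ss; rewrite ?oppr0 ?opprK // ss.
case: eqP => mn; last by rewrite oppr0.
by rewrite (_ : n = - m) ?rmorphN ?mulrN ?opprK //; lia.
Qed.

Lemma pairing_eq0 i j m n : m + n != - 1 -> m + n != 0 -> pairing i j m n = 0.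
Proof.
rewrite /pairing => /negbTE -> /negbTE ->; case: eqP => // _.
by case: i j => -[] s [[] t] //=; rewrite oppr0.
Qed.

Lemma mode_comm i j m n v :
  mode i m (mode j n v) = mode j n (mode i m v) + pairing i j m n *: v.
Proof.
case: m n => [p|p] [q|q].
- rewrite mode_mode_nneg /pairing (_ : p%:Z + q%:Z == - 1 = false); last by lia.
  case: eqP => // ij; case: i j ij => -[] s [[] t] /= st; rewrite ?oppr0 ?scale0r ?addr0 //.
  case: eqP => pq; last by rewrite scale0r addr0.
  by rewrite (_ : p%:Z = 0) ?mulr0 ?scale0r ?addr0 //; lia.
- by rewrite !mode_neg mode_create.
- by rewrite pairing_sym !mode_neg mode_create -addrA scaleNr subrr addr0.
- by rewrite !mode_neg create_create pairing_eq0 ?scale0r ?addr0 //; lia.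
Qed.

Lemma mode_ket0 i p l : mode i (Posz p) (ket C (mset0, l)) =
  if (p == 0%N) && (nat_of_boson i.1 == 2%N) then l%:~R *: ket C (mset0, l) else 0.
Proof.
case: i => -[] s; rewrite /mode /= ?andbF.
- by rewrite beta_nneg !opE /= mset0E scale0r.
- by rewrite /gamma /= !opE mset0E scale0r oppr0.
- case: p => [|p] /=; first by rewrite /afield /= !opE.
  by rewrite /afield /= !opE mset0E scale0r scaler0.
Qed.

Lemma mode_truncated i : truncated (mode i).
Proof.
apply: fock_ind => [a u v [N hu] [M hv]|l|[j q] v [N hv]].
- exists (Num.max N M) => n; rewrite ge_max => /andP[Nn Mn].
  by rewrite mode_linear hu // hv // scaler0 addr0.
- exists 1 => -[p|p] // p1; rewrite mode_ket0.
  by case: eqP p1 => // ->.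
- exists (Num.max N (q.+2)%:Z) => n; rewrite ge_max => /andP[Nn Mn].
  rewrite -mode_neg mode_comm hv // (linf0 (mode_linear _ _)) add0r.
  by rewrite pairing_eq0 ?scale0r //; lia.
Qed.

Lemma mode_field i : is_field (mode i).
Proof. by split; [exact: mode_linear | exact: mode_truncated]. Qed.

End Modes.

(** * The conformal vector of the free fields *)

Section Contraction.
Context {C : numFieldType} {V : lmodType C}.

Lemma sum_int_support (g : int -> V) (j0 : int) N : (forall j : int, j != j0 -> g j = 0) ->
  (absz j0 < N)%N -> \sum_(i < N) g (- 1 - i%:Z) + \sum_(i < N) g i%:Z = g j0.
Proof.
move=> g0 jN; have [j0_ge0|j0_lt0] := lerP 0 j0.
  rewrite big1 ?add0r => [|i _]; last by apply: g0; apply/eqP; lia.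
  rewrite (bigD1 (Ordinal jN)) //= big1 ?addr0 => [|i ij].
    by congr g; lia.
  by apply: g0; apply: contraNneq ij => ij; apply/eqP/val_inj; rewrite /= -ij.
have kN : (absz (j0 + 1)%R < N)%N by lia.
rewrite addrC big1 ?add0r => [|i _]; last by apply: g0; apply/eqP; lia.
rewrite (bigD1 (Ordinal kN)) //= big1 ?addr0 => [|i ij].
  by congr g; lia.
by apply: g0; apply: contraNneq ij => ij; apply/eqP/val_inj => /=; lia.
Qed.

(** Wick's theorem with one contraction. The scalars picked up in the two halves of the product
    together run over all integers j, and each of a and b is supported at a single index. *)
Lemma nop_contract (A B : series V) (x : V -> V) (a b : int -> C) (ja jb n : int) v :
  is_field A -> is_field B -> linear x ->
  (forall j w, x (A j w) = A j (x w) + a j *: w) -> (forall j, j != ja -> a j = 0) ->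
  (forall j w, x (B j w) = B j (x w) + b j *: w) -> (forall j, j != jb -> b j = 0) ->
  x (nop A B n v) =
  nop A B n (x v) + a ja *: B (n - 1 - ja) v + b jb *: A (n - 1 - jb) v.
Proof.
move=> Af Bf xL xA a0 xB b0; rewrite !nopE.
have [[N1 h1] [N2 h2]] := (nopl_bound 0 n v Af Bf, nopl_bound 0 n (x v) Af Bf).
have [[N3 h3] [N4 h4]] := (nopr_bound 0 n v Af Bf, nopr_bound 0 n (x v) Af Bf).
pose N := (N1 + N2 + N3 + N4 + absz ja + absz (n - 1 - jb)%R + 1)%N.
have w N' (f : nat -> V) : (forall i, (N' <= i)%N -> f i = 0) -> (N' <= N)%N ->
    nsum f = \sum_(i < N) f i.
  by move=> hf NN; apply: nsumE => i Ni; apply: hf; lia.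
rewrite /nopl /nopr (w _ _ h1) ?(w _ _ h2) ?(w _ _ h3) ?(w _ _ h4); try by rewrite /N; lia.
rewrite (linfD xL) !(linf_sum xL).
have Ea := @sum_int_support (fun j => a j *: B (n - 1 - j) v) ja N.
have Eb := @sum_int_support (fun j => b (n - 1 - j) *: A j v) (n - 1 - jb) N.
rewrite -Ea; [|by move=> j /a0 ->; rewrite scale0r|by rewrite /N; lia].
have -> : b jb = b (n - 1 - (n - 1 - jb)) by congr b; lia.
rewrite -Eb; first last.
- by rewrite /N; lia.
- by move=> j jn; rewrite b0 ?scale0r //; apply: contraNneq jn => <-; apply/eqP; lia.
have -> (p q r s t u : V) : p + q + (r + s) + (t + u) = (p + r + t) + (q + s + u).
  by lmod_ring C V.
congr (_ + _); rewrite -!big_split; apply: eq_bigr => i _.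
  rewrite xA xB (linfD (field_linear Af _)) (linfZ (field_linear Af _)) addrAC.
  rewrite (_ : n - 1 - (0 - 1 - i%:Z) = n + i%:Z); last by lia.
  by rewrite (_ : 0 - 1 - i%:Z = - 1 - i%:Z) //; lia.
rewrite xB xA (linfD (field_linear Bf _)) (linfZ (field_linear Bf _)).
by rewrite (_ : 0 + i%:Z = i%:Z) //; lia.
Qed.

End Contraction.

Section Translation.
Variables (C : numFieldType) (V : lmodType C) (kappa : C).
Hypothesis kappa_neq0 : kappa != 0.
Variable mode : boson * bool -> series V.
Hypothesis mode_field : forall i, is_field (mode i).
Hypothesis mode_comm : forall i j m n v,
  mode i m (mode j n v) = mode j n (mode i m v) + pairing kappa i j m n *: v.
Implicit Types (i j : boson * bool) (v : V).

Lemma hkappa_neq0 s : hkappa kappa s != 0.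
Proof. by case: s; rewrite /hkappa ?oppr_eq0. Qed.

(* The conformal vector is taken without background charge: its central      *)
(* charge is still 2 + 2 + 1 + 1, and its mode L_(-1) is the translation.    *)
Definition stress_part s : series V :=
  sadd (sscale (- 1) (nop (sderiv (mode (Beta, s))) (mode (Gamma, s))))
       (sscale (4 * hkappa kappa s)^-1 (nop (mode (Heis, s)) (mode (Heis, s)))).

Definition stress : series V := sadd (stress_part false) (stress_part true).

(** The Virasoro mode L_n has index n + 1, so this is L_(-1). *)
Definition translation : V -> V := stress 0.

Let modeL i n : linear (mode i n).
Proof. exact: field_linear. Qed.

Lemma stress_part_field s : is_field (stress_part s).
Proof.
have dM i := sderiv_field (mode_field i).
by apply: sadd_field; apply: sscale_field; exact: nop_field.
Qed.

Lemma translation_linear : linear translation.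
Proof. by apply: field_linear; apply: sadd_field; apply: stress_part_field. Qed.

Lemma mode_stress_part i s n v :
  mode i n (stress_part s 0 v) = stress_part s 0 (mode i n v) +
  (if i.2 == s then n%:~R *: mode i (n - 1) v else 0).
Proof.
rewrite {1}/stress_part /sadd /sscale (linfD (modeL _ _)) !(linfZ (modeL _ _)).
have dBf := sderiv_field (mode_field (Beta, s)).
(* The support of [pairing] places the contraction with the derivative of beta at index - n and the
   one with gamma at -1 - n. *)
rewrite (@nop_contract _ _ _ _ (mode i n)
  (fun k => (- k)%:~R * pairing kappa i (Beta, s) n (k - 1)) (fun k => pairing kappa i (Gamma, s) n k)
  (- n) (- 1 - n) 0 v dBf (mode_field _) (modeL _ _)); first last.
- move=> j; rewrite /pairing [_.2]/=; case: (i.2 =P s) => //= _; case: i.1 => //= jn.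
  by rewrite (_ : n + j == - 1 = false) //; lia.
- by move=> j w; apply: mode_comm.
- move=> j; rewrite /pairing [_.2]/=; case: (i.2 =P s) => /=; rewrite ?mulr0 // => _; case: i.1; rewrite ?mulr0 //= => jn.
  by rewrite (_ : n + (j - 1) == - 1 = false) ?oppr0 ?mulr0 //; lia.
- by move=> j w; rewrite /sderiv (linfZ (modeL _ _)) mode_comm scalerDr scalerA.
rewrite (@nop_contract _ _ _ _ (mode i n) (fun k => pairing kappa i (Heis, s) n k)
  (fun k => pairing kappa i (Heis, s) n k)
  (- n) (- n) 0 v (mode_field _) (mode_field _) (modeL _ _)); first last.
- move=> j; rewrite /pairing [_.2]/=; case: (i.2 =P s) => //= _; case: i.1 => //= jn.
  by rewrite (_ : n + j == 0 = false) //; lia.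
- by move=> j w; apply: mode_comm.
- move=> j; rewrite /pairing [_.2]/=; case: (i.2 =P s) => //= _; case: i.1 => //= jn.
  by rewrite (_ : n + j == 0 = false) //; lia.
- by move=> j w; apply: mode_comm.
rewrite /stress_part /sadd /sscale /sderiv (_ : 0 - 1 - - n = n - 1); last by lia.
rewrite (_ : 0 - 1 - (- 1 - n) = n); last by lia.
have k0 := hkappa_neq0 s; rewrite /pairing.
have -> : n + (- n - 1) = - 1 by lia.
have -> : n + (- 1 - n) = - 1 by lia.
rewrite subrr; case: i => b t; rewrite ![_.1]/= ![_.2]/=.
case: (t =P s) => [ts|_] /=; last by lmod_ring C V.
case: b; rewrite /= ?ts ?eqxx; lmod_coefs C V; rewrite ?opprK; try ring.
by field.
Qed.

Lemma mode_translation i n v :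
  translation (mode i n v) - mode i n (translation v) = sderiv (mode i) n v.
Proof.
rewrite /translation /stress {2}/sadd (linfD (modeL _ _)) !mode_stress_part /sadd /sderiv.
by case: i => b [] /=; lmod_ring C V.
Qed.

(** Only a_(-1) a_0 survives, once in each half of the normally ordered square. The opposite sign
    for abar comes from [hkappa true = - kappa]. *)
Lemma translation_vacuum v (l : int) :
  (forall i (p : nat), mode i p v = if (p == 0%N) && (nat_of_boson i.1 == 2%N) then l%:~R *: v else 0) ->
  translation v = (l%:~R / (2 * kappa)) *: (mode (Heis, false) (- 1) v - mode (Heis, true) (- 1) v).
Proof.
move=> hv.
have E s : stress_part s 0 v = (l%:~R / (2 * hkappa kappa s)) *: mode (Heis, s) (- 1) v.
  rewrite /stress_part /sadd /sscale; have v0 (b : boson) (p : nat) : b != Heis -> mode (b, s) p v = 0.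
    by rewrite hv; case: b => //= _; rewrite andbF.
  have vS (p : nat) : mode (Heis, s) p.+1 v = 0 by rewrite hv.
  have -> : nop (sderiv (mode (Beta, s))) (mode (Gamma, s)) 0 v = 0.
    rewrite nopE /nopl /nopr nsum0 => [|p]; last first.
      by rewrite (_ : 0 + p%:Z = p) ?v0 ?(linf0 (field_linear (sderiv_field (mode_field _)) _)) //; lia.
    rewrite add0r nsum0 // => -[|p]; rewrite /sderiv.
      by rewrite (_ : - (0 + 0%:Z) = 0) // scale0r (linf0 (modeL _ _)).
    by rewrite (_ : 0 + p.+1%:Z - 1 = p) ?v0 ?scaler0 ?(linf0 (modeL _ _)) //; lia.
  have -> : nop (mode (Heis, s)) (mode (Heis, s)) 0 v = (2 * l%:~R) *: mode (Heis, s) (- 1) v.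
    rewrite nopE /nopl /nopr.
    have -> : nsum (fun i : nat => mode (Heis, s) (0 - 1 - i%:Z) (mode (Heis, s) (0 + i%:Z) v)) =
        l%:~R *: mode (Heis, s) (- 1) v.
      rewrite (@nsumE _ 1) => [|[|p] // _]; first by rewrite big_ord1 (hv _ 0%N) (linfZ (modeL _ _)).
      by rewrite (_ : 0 + p.+1%:Z = p.+1) ?vS ?(linf0 (modeL _ _)) //; lia.
    by rewrite -scalerDl mulrDl mul1r.
  have k0 := hkappa_neq0 s.
  by lmod_coefs C V; field.
rewrite /translation /stress /sadd !E /hkappa.
by lmod_coefs C V; field.
Qed.

End Translation.

(** * Exponentials of series *)

Section TriangularSums.
Variable V : nmodType.

Lemma tri_diag (f : nat -> nat -> V) N :
  \sum_(i < N.+1) \sum_(j < i.+1) f j (i - j)%N = \sum_(j < N.+1) \sum_(k < (N - j).+1) f j k.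
Proof.
elim: N => [|N IH]; first by rewrite !big_ord1.
rewrite [LHS]big_ord_recr /= IH [RHS]big_ord_recr /= subnn big_ord1.
rewrite [X in _ + X = _]big_ord_recr /= subnn addrA.
congr (_ + _); rewrite -big_split; apply: eq_bigr => j _ /=.
have jN : (j <= N)%N by rewrite -ltnS.
by rewrite subSn // [RHS]big_ord_recr.
Qed.

Lemma tri_exchange (f : nat -> nat -> V) N :
  \sum_(i < N.+1) \sum_(j < (N - i).+1) f i j = \sum_(j < N.+1) \sum_(i < (N - j).+1) f i j.
Proof.
rewrite -!tri_diag -[RHS](tri_diag (fun j i => f i j)); apply: eq_bigr => i _.
rewrite (reindex_inj rev_ord_inj) /=; apply: eq_bigr => j _.
by rewrite subSS subKn // -ltnS.
Qed.

End TriangularSums.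

Section SchurSequences.
Context {C : numFieldType} {V : lmodType C}.
Implicit Types (b X Y : nat -> V -> V) (v : V).

(* [X] is the sequence of coefficients of exp(\sum_(i > 0) b_i z^i / i), *)
(* characterized by its logarithmic derivative.                          *)
Definition is_schur b X :=
  X 0%N =1 id /\ forall N v, N%:R *: X N v = \sum_(i < N.+1) b i (X (N - i)%N v).

Definition conv X Y : nat -> V -> V := fun N v => \sum_(i < N.+1) X i (Y (N - i)%N v).

Lemma scaleS_inj N (u w : V) : N.+1%:R *: u = N.+1%:R *: w -> u = w.
Proof. by apply: scalerI; rewrite pnatr_eq0. Qed.

Lemma schur_linear b X : (forall i, linear (b i)) -> (forall v, b 0%N v = 0) ->
  is_schur b X -> forall N, linear (X N).
Proof.
move=> bL b0 [X0 XS] N; elim/ltn_ind: N => -[|N] IH a u v; first by rewrite !X0.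
apply: (@scaleS_inj N); rewrite scalerDr scalerA mulrC -scalerA !XS scaler_sumr -big_split.
apply: eq_bigr => -[[|i] iN] _ /=; first by rewrite !b0 scaler0 addr0.
by rewrite IH ?bL // subSS ltnS leq_subr.
Qed.

(** If T has a scalar bracket with the single exponent term of degree i0, then [T, X(z)] = c z^i0
    X(z). Induction through the recursion for N X_N; at the end the coefficients N + 1 - i0 and i0
    add up to N + 1. *)
Lemma schur_bracket b X (T : V -> V) c i0 : (forall i, linear (b i)) -> (forall v, b 0%N v = 0) ->
  is_schur b X -> linear T -> (0 < i0)%N ->
  (forall i v, T (b i v) = b i (T v) + (if i == i0 then (i0%:R * c) *: v else 0)) ->
  forall N v, T (X N v) = X N (T v) + (if (i0 <= N)%N then c *: X (N - i0)%N v else 0).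
Proof.
move=> bL b0 [X0 XS] TL i0_gt0 Tb N; elim/ltn_ind: N => -[|N] IH v.
  by rewrite !X0 leqNgt i0_gt0 addr0.
apply: (@scaleS_inj N); rewrite scalerDr -(linfZ TL) !XS (linf_sum TL).
have -> : \sum_(i < N.+2) T (b i (X (N.+1 - i)%N v)) =
   \sum_(i < N.+2) b i (X (N.+1 - i)%N (T v)) +
   (\sum_(i < N.+2) (if (i0 + i <= N.+1)%N then c *: b i (X (N.+1 - i0 - i)%N v) else 0) +
   \sum_(i < N.+2) (if i == i0 :> nat then (i0%:R * c) *: X (N.+1 - i)%N v else 0)).
  rewrite -!big_split; apply: eq_bigr => -[[|i] iN] _ /=.
    by rewrite Tb !b0 (ltn_eqF i0_gt0) !addr0 scaler0 if_same !addr0.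
  rewrite Tb IH; last by rewrite subSS ltnS leq_subr.
  rewrite (linfD (bL _)) -addrA; congr (_ + (_ + _)).
  rewrite leq_subRL; last by [].
  rewrite addnC; case: ifP => _; last by rewrite (linf0 (bL _)).
  by rewrite (linfZ (bL _)) subnAC.
congr (_ + _); case: leqP => [i0N|Ni0]; last first.
  by rewrite scaler0 !big1 ?addr0 // => i _; case: ifP => // h; have := ltn_ord i; lia.
have i0N' : (i0 < N.+2)%N by [].
rewrite [X in _ + X](bigD1 (Ordinal i0N')) //= eqxx [X in _ + (_ + X)]big1; last first.
  by move=> i /eqP ij; case: eqP => // E; case: ij; apply: val_inj.
have -> : \sum_(i < N.+2) (if (i0 + i <= N.+1)%N then c *: b i (X (N.+1 - i0 - i)%N v) else 0) =
    c *: ((N.+1 - i0)%N%:R *: X (N.+1 - i0)%N v).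
  rewrite XS scaler_sumr -big_mkcond /=.
  rewrite (big_ord_widen_cond N.+2 xpredT (fun i => c *: b i (X (N.+1 - i0 - i)%N v))); last by lia.
  by apply: eq_bigl => i; rewrite /= ltnS; lia.
rewrite addr0 scalerA -scalerDl scalerA; congr (_ *: _).
by rewrite natrB //; ring.
Qed.

Lemma schur_commute b X (T : V -> V) : (forall i, linear (b i)) -> (forall v, b 0%N v = 0) ->
  is_schur b X -> linear T -> (forall i v, T (b i v) = b i (T v)) ->
  forall N v, T (X N v) = X N (T v).
Proof.
move=> bL b0 XS TL Tb N v; rewrite (@schur_bracket b X T 0 1) //.
  by case: ifP => _; rewrite ?scale0r addr0.
by move=> i u; rewrite mulr0 scale0r if_same addr0.
Qed.

(** For b(z) = \sum_i b_i z^i / i the hypothesis reads [T, b(z)] = b'(z) - b_1, so that [T, X(z)] =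
    X'(z) - b_1 X(z). *)
Lemma schur_derivation b X (T : V -> V) : (forall i, linear (b i)) -> (forall v, b 0%N v = 0) ->
  is_schur b X -> linear T ->
  (forall i v, (0 < i)%N -> T (b i v) = b i (T v) + i%:R *: b i.+1 v) ->
  (forall i j v, b i (b j v) = b j (b i v)) ->
  forall N v, T (X N v) = X N (T v) + N.+1%:R *: X N.+1 v - b 1%N (X N v).
Proof.
move=> bL b0 XS TL Tb bb N v; have [X0 XE] := XS.
elim/ltn_ind: N => -[|N] IH.
  by rewrite XE big_ord_recl b0 add0r big_ord1 !X0 addrK.
apply: (@scaleS_inj N); rewrite -(linfZ TL) XE (linf_sum TL).
rewrite big_ord_recl b0 (linf0 TL) add0r.
have -> : \sum_(i < N.+1) T (b (lift ord0 i) (X (N.+1 - lift ord0 i)%N v)) =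
   \sum_(i < N.+1) b i.+1 (X (N - i)%N (T v)) +
   \sum_(i < N.+1) (i.+1%:R *: b i.+2 (X (N - i)%N v)) +
   \sum_(i < N.+1) ((N - i).+1%:R *: b i.+1 (X (N - i).+1 v)) -
   \sum_(i < N.+1) b 1%N (b i.+1 (X (N - i)%N v)).
  rewrite -!big_split -sumrB; apply: eq_bigr => i _; rewrite lift0 subSS Tb //=.
  rewrite IH ?ltnS ?leq_subr // (linfB (bL _)) (linfD (bL _)) (linfZ (bL _)) (bb 1%N).
  by lmod_ring C V.
have E1 w : \sum_(i < N.+1) b i.+1 (X (N - i)%N w) = N.+1%:R *: X N.+1 w.
  rewrite XE [RHS]big_ord_recl b0 add0r; apply: eq_bigr => i _.
  by rewrite lift0 subSS.
rewrite E1 -(linf_sum (bL 1%N)) E1 scalerBr scalerDr (linfZ (bL 1%N)).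
congr (_ - _); rewrite -addrA; congr (_ + _).
pose h i := b i.+1 (X (N.+1 - i)%N v).
have -> : \sum_(i < N.+1) i.+1%:R *: b i.+2 (X (N - i)%N v) = \sum_(i < N.+2) i%:R *: h i.
  by rewrite [RHS]big_ord_recl scale0r add0r; apply: eq_bigr => i _; rewrite lift0.
have -> : \sum_(i < N.+1) (N - i).+1%:R *: b i.+1 (X (N - i).+1 v) =
    \sum_(i < N.+2) (N.+1 - i)%N%:R *: h i.
  rewrite [RHS]big_ord_recr /= subnn scale0r addr0; apply: eq_bigr => i _.
  by rewrite /h subSn // -ltnS.
rewrite -big_split XE [in RHS]big_ord_recl b0 add0r scaler_sumr; apply: eq_bigr => i _.
by rewrite lift0 /= -scalerDl -natrD subnKC // -ltnS.
Qed.

(** The logarithmic derivative of a product of commuting exponentials is the sum of the logarithmic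
    derivatives. *)
Lemma conv_schur b b' X Y : (forall i, linear (b i)) -> (forall i, linear (b' i)) ->
  (forall i, linear (X i)) -> (forall i j v, X i (b' j v) = b' j (X i v)) ->
  is_schur b X -> is_schur b' Y -> is_schur (fun i v => b i v + b' i v) (conv X Y).
Proof.
move=> bL b'L XL Xb' [X0 XE] [Y0 YE]; split=> [v|N v].
  by rewrite /conv big_ord1 X0 Y0.
have -> : N%:R *: conv X Y N v =
    \sum_(i < N.+1) (i%:R *: X i (Y (N - i)%N v)) +
    \sum_(i < N.+1) X i ((N - i)%N%:R *: Y (N - i)%N v).
  rewrite /conv scaler_sumr -big_split; apply: eq_bigr => i _ /=.
  by rewrite (linfZ (XL i)) -scalerDl -natrD subnKC // -ltnS.
rewrite big_split; congr (_ + _).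
  rewrite (eq_bigr (fun i : 'I_N.+1 => \sum_(j < i.+1) b j (X (i - j)%N (Y (N - j - (i - j))%N v)))); last first.
    move=> i _; rewrite XE; apply: eq_bigr => j _; have := ltn_ord j; rewrite ltnS => ji.
    by rewrite -subnDA subnKC.
  rewrite (tri_diag (fun j k => b j (X k (Y (N - j - k)%N v)))); apply: eq_bigr => j _.
  by rewrite (linf_sum (bL j)).
rewrite (eq_bigr (fun i : 'I_N.+1 => \sum_(j < (N - i).+1) b' j (X i (Y (N - j - i)%N v)))); last first.
  move=> i _; rewrite YE (linf_sum (XL i)); apply: eq_bigr => j _.
  by rewrite Xb' subnAC.
rewrite (tri_exchange (fun i j => b' j (X i (Y (N - j - i)%N v)))); apply: eq_bigr => j _.
by rewrite (linf_sum (b'L j)).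
Qed.

Definition pw (a : nat -> V -> V) r : nat -> V -> V :=
  iter r (conv a) (fun N v => if N == 0%N then v else 0).

(** Cutting the exponential at [r <= N] loses nothing when [a 0] vanishes, because the r-th power
    then starts in degree r ([pw_small]). *)
Definition nexp (a : nat -> V -> V) : nat -> V -> V :=
  fun N v => \sum_(r < N.+1) (r`!%:R)^-1 *: pw a r N v.

Section Exponential.
Variable a : nat -> V -> V.
Hypotheses (aL : forall i, linear (a i)) (a0 : forall v, a 0%N v = 0).
Hypothesis aa : forall i j v, a i (a j v) = a j (a i v).

Lemma pw_small r N v : (N < r)%N -> pw a r N v = 0.
Proof.
elim: r N => // r IH N Nr; rewrite /pw iterS -/(pw a r) /conv big1 // => -[[|i] iN] _ /=.
  exact: a0.
by rewrite IH ?(linf0 (aL _)) //; lia.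
Qed.

(** The chain rule for z d/dz applied to the power a(z)^(r+1), the coefficients being commuting
    operators. *)
Lemma pw_euler r N v :
  N%:R *: pw a r.+1 N v = r.+1%:R *: \sum_(i < N.+1) i%:R *: a i (pw a r (N - i)%N v).
Proof.
elim: r N => [|r IH] N.
  rewrite /pw /= /conv scale1r scaler_sumr; apply: eq_bigr => i _.
  have [->//|iN] := eqVneq (i : nat) N.
  have iN' : (i < N)%N by rewrite ltn_neqAle iN -ltnS ltn_ord.
  by rewrite subn_eq0 leqNgt iN' (linf0 (aL _)) !scaler0.
rewrite {1}/pw iterS -/(pw a r.+1) /conv scaler_sumr.
have -> : \sum_(i < N.+1) N%:R *: a i (pw a r.+1 (N - i)%N v) =
   \sum_(i < N.+1) i%:R *: a i (pw a r.+1 (N - i)%N v) +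
   \sum_(i < N.+1) a i ((N - i)%N%:R *: pw a r.+1 (N - i)%N v).
  rewrite -big_split; apply: eq_bigr => i _ /=.
  by rewrite (linfZ (aL i)) -scalerDl -natrD subnKC // -ltnS.
rewrite -[r.+2]add1n natrD scalerDl scale1r; congr (_ + _).
rewrite (eq_bigr (fun i : 'I_N.+1 => \sum_(j < (N - i).+1)
   r.+1%:R *: (j%:R *: a j (a i (pw a r (N - j - i)%N v))))); last first.
  move=> i _; rewrite IH (linfZ (aL i)) (linf_sum (aL i)) scaler_sumr; apply: eq_bigr => j _.
  by rewrite (linfZ (aL i)) aa subnAC.
rewrite (tri_exchange (fun i j => r.+1%:R *: (j%:R *: a j (a i (pw a r (N - j - i)%N v))))).
rewrite scaler_sumr; apply: eq_bigr => j _.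
rewrite -!scaler_sumr /pw iterS -/(pw a r) /conv (linf_sum (aL j)).
by [].
Qed.

Lemma nexp_schur : is_schur (fun i v => i%:R *: a i v) (nexp a).
Proof.
split=> [v|N v]; first by rewrite /nexp big_ord1 fact0 invr1 scale1r.
have nexpE M r : (M <= r)%N -> nexp a M v = \sum_(r' < r.+1) (r'`!%:R)^-1 *: pw a r' M v.
  move=> Mr; rewrite /nexp (big_ord_widen r.+1 (fun r' => (r'`!%:R)^-1 *: pw a r' M v)) //.
  rewrite big_mkcond; apply: eq_bigr => i _; case: ifP => // /negbT; rewrite -leqNgt => Mi.
  by rewrite pw_small ?scaler0.
rewrite (nexpE N N.+1) // big_ord_recl scalerDr.
rewrite (_ : N%:R *: _ = 0) ?add0r; last first.
  by rewrite /pw /=; case: eqP => [->|]; rewrite ?scale0r ?scaler0.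
rewrite scaler_sumr.
rewrite (eq_bigr (fun r : 'I_N.+1 => \sum_(i < N.+1) (r`!%:R)^-1 *: (i%:R *: a i (pw a r (N - i)%N v)))).
  rewrite exchange_big; apply: eq_bigr => i _ /=.
  rewrite (nexpE _ N) ?leq_subr // (linf_sum (aL i)) scaler_sumr; apply: eq_bigr => r _.
  by rewrite (linfZ (aL i)) !scalerA mulrC.
move=> r _; rewrite lift0 scalerA mulrC -scalerA pw_euler scalerA -scaler_sumr; congr (_ *: _).
have rf : (r`!%:R : C) != 0 by rewrite pnatr_eq0 -lt0n fact_gt0.
have r1 : r.+1%:R != 0 :> C by rewrite pnatr_eq0.
by rewrite factS natrM invfM mulrAC mulVf ?mul1r.
Qed.

End Exponential.

End SchurSequences.

(** * Products and exponentials of operator series *)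

Section SeriesProducts.
Context {C : numFieldType} {V : lmodType C}.
Implicit Types (A B : series V) (X Y : nat -> V -> V) (v : V).

Lemma fsum_inj (f : int -> V) (h : nat -> int) N : injective h ->
  (forall j, (forall i, (i < N)%N -> j != h i) -> f j = 0) ->
  \sum_(j \in [set: int]) f j = \sum_(i < N) f (h i).
Proof.
move=> hI f0; rewrite (fsbigE (map h (iota 0 N))) ?map_inj_uniq ?iota_uniq //; last first.
  move=> j _ jN; apply: f0 => i iN; apply: contra jN => /eqP ->.
  by apply: map_f; rewrite mem_iota.
under eq_bigl do rewrite in_setT.
by rewrite big_map -(big_mkord xpredT (fun i => f (h i))) /index_iota subn0.
Qed.

(** Each coefficient of the product is a finite sum, so the default value 0 of an infinite sum never
    enters. *)
Definition summable A B :=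
  forall n v, exists L : nat, forall j : int, (L <= absz j)%N -> A j (B (n - 1 - j) v) = 0.

Lemma fsum_window (f : int -> V) (L : nat) : (forall j : int, (L <= absz j)%N -> f j = 0) ->
  \sum_(j \in [set: int]) f j = \sum_(i < (L + L)%N) f (i%:Z - L%:Z).
Proof.
move=> f0; apply: fsum_inj (fun i : nat => i%:Z - L%:Z) _ _ _; first by move=> i j; lia.
move=> j hj; apply: f0; rewrite leqNgt; apply/negP => jL.
have h : (absz (j + L%:Z)%R < L + L)%N by lia.
by have /eqP := hj _ h; lia.
Qed.

Lemma sprod_linear A B : linear_modes A -> linear_modes B -> summable A B ->
  linear_modes (sprod A B).
Proof.
move=> AL BL AB n a u v; rewrite /sprod.
have [[L hL] [M hM]] := (AB n u, AB n v).
rewrite !(@fsum_window _ (L + M)%N).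
- rewrite scaler_sumr -big_split; apply: eq_bigr => i _ /=.
  by rewrite BL AL.
- by move=> j jL; apply: hM; lia.
- by move=> j jL; apply: hL; lia.
- by move=> j jL; rewrite BL AL hL ?hM ?scaler0 ?addr0 //; lia.
Qed.

(** In generating form, [T, A(z)] = c z^m A(z). *)
Definition shift_bracket (T : V -> V) A (c : C) (m : int) :=
  forall j v, T (A j v) = A j (T v) + c *: A (j + m) v.

Lemma sprod_bracket A B T ca cb m : linear_modes A -> linear_modes B -> linear T ->
  summable A B -> shift_bracket T A ca m -> shift_bracket T B cb m ->
  shift_bracket T (sprod A B) (ca + cb) m.
Proof.
move=> AL BL TL AB TA TB n v.
have [[L1 h1] [[L2 h2] [L3 h3]]] := (AB n v, (AB n (T v), AB (n + m) v)).
pose L := (L1 + L2 + L3 + absz m)%N.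
have E3 : sprod A B (n + m) v = \sum_(i < (L + L)%N) A (i%:Z - L%:Z) (B (n - 1 - (i%:Z - L%:Z) + m) v).
  rewrite /sprod (@fsum_window _ L) => [|j jL]; last by apply: h3; rewrite /L in jL; lia.
  by apply: eq_bigr => i _; congr (A _ (B _ _)); lia.
have E4 : sprod A B (n + m) v = \sum_(i < (L + L)%N) A (i%:Z - L%:Z + m) (B (n - 1 - (i%:Z - L%:Z)) v).
  rewrite /sprod (reindex_fsbigT (fun j : int => j + m)); last first.
    by exists (fun j => j - m) => j; lia.
  rewrite (@fsum_window _ L) => [|j jL]; last by apply: h3; rewrite /L in jL; lia.
  by apply: eq_bigr => i _; congr (A _ (B _ _)); lia.
rewrite scalerDl {1}E4 E3 /sprod !(@fsum_window _ L).
- rewrite (linf_sum TL) !scaler_sumr -!big_split; apply: eq_bigr => i _ /=.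
  by rewrite TA TB (linfD (AL _)) (linfZ (AL _)) -!addrA; congr (_ + _); rewrite addrC.
- by move=> j jL; apply: h2; rewrite /L in jL; lia.
- by move=> j jL; apply: h1; rewrite /L in jL; lia.
Qed.

Lemma sprod_field_neg A B : linear_modes A -> (forall j v, 0 <= j -> A j v = 0) ->
  is_field B -> summable A B /\ is_field (sprod A B).
Proof.
move=> AL A0 [BL BT].
have AB : summable A B.
  move=> n v; have [N hN] := BT v; exists (absz n + absz N + 2)%N => j jL.
  have [j0|j0] := lerP 0 j; first exact: A0.
  by rewrite hN ?(linf0 (AL _)) //; lia.
split=> //; split; first exact: sprod_linear.
move=> v; have [N hN] := BT v; exists N => n Nn; apply: fsbig1 => j _.
have [j0|j0] := lerP 0 j; first exact: A0.
by rewrite hN ?(linf0 (AL _)) //; lia.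
Qed.

Lemma sprod_field_comm A B : is_field A -> is_field B ->
  (forall j k v, A j (B k v) = B k (A j v)) -> summable A B /\ is_field (sprod A B).
Proof.
move=> [AL AT] [BL BT] ABC.
have AB : summable A B.
  move=> n v; have [[N hN] [M hM]] := (BT v, AT v).
  exists (absz n + absz N + absz M + 2)%N => j jL.
  have [j0|j0] := lerP M j; first by rewrite ABC hM ?(linf0 (BL _)).
  by rewrite hN ?(linf0 (AL _)) //; lia.
split=> //; split; first exact: sprod_linear.
move=> v; have [[N hN] [M hM]] := (BT v, AT v); exists (N + M + 1) => n Nn.
apply: fsbig1 => j _; have [j0|j0] := lerP M j; first by rewrite ABC hM ?(linf0 (BL _)).
by rewrite hN ?(linf0 (AL _)) //; lia.
Qed.

(* The series \sum_N X_N z^(-N) if [pos], and \sum_N X_N z^N otherwise. *)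
Definition reflect_series (pos : bool) X : series V :=
  fun n v => if (if pos then - 1 <= n else n <= - 1) then X (absz (n + 1)) v else 0.

Definition reflect_index (pos : bool) (N : nat) : int := if pos then N%:Z - 1 else - 1 - N%:Z.

Lemma reflect_seriesE pos X N v : reflect_series pos X (reflect_index pos N) v = X N v.
Proof.
rewrite /reflect_series /reflect_index; case: pos; rewrite (_ : (_ <= _)%R = true); try by lia.
  by congr (X _ v); lia.
by congr (X _ v); lia.
Qed.

Lemma reflect_series_eq0 pos X n v : (forall N, n != reflect_index pos N) ->
  reflect_series pos X n v = 0.
Proof.
move=> h; rewrite /reflect_series; have := h (absz (n + 1)).
by rewrite /reflect_index; case: pos {h}; case: ifP => //; lia.
Qed.

Lemma reflect_indexP pos n : (exists N, n = reflect_index pos N) \/ forall N, n != reflect_index pos N.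
Proof.
have [E|E] := eqVneq n (reflect_index pos (absz (n + 1))); first by left; exists (absz (n + 1)).
by right=> N; apply: contraNneq E => ->; rewrite /reflect_index; case: pos; lia.
Qed.

Lemma eq_reflect_series pos A X : (forall N v, A (reflect_index pos N) v = X N v) ->
  (forall n v, (forall N, n != reflect_index pos N) -> A n v = 0) ->
  A = reflect_series pos X.
Proof.
move=> h h0; apply/funext => n; apply/funext => v.
have [[N ->]|nN] := reflect_indexP pos n; first by rewrite reflect_seriesE h.
by rewrite h0 // reflect_series_eq0.
Qed.

Lemma sprod_reflect pos X Y : (forall i, X i 0 = 0) ->
  sprod (reflect_series pos X) (reflect_series pos Y) = reflect_series pos (conv X Y).
Proof.
move=> X0; apply: eq_reflect_series => [N v|n v nN]; last first.
  apply: fsbig1 => j _; have [[M jM]|jM] := reflect_indexP pos j; last exact: reflect_series_eq0.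
  rewrite [X in reflect_series _ _ _ X]reflect_series_eq0.
    by rewrite /reflect_series X0 if_same.
  by move=> K; have := nN (M + K)%N; rewrite jM /reflect_index; case: pos {nN jM}; lia.
rewrite /sprod (@fsum_inj _ (reflect_index pos) N.+1).
- rewrite /conv; apply: eq_bigr => i _; rewrite reflect_seriesE.
  rewrite (_ : _ - 1 - _ = reflect_index pos (N - i)) ?reflect_seriesE //.
  by have := ltn_ord i; rewrite /reflect_index; case: pos; lia.
- by rewrite /reflect_index; case: pos => i j; lia.
- move=> j jN; have [[M jM]|jM] := reflect_indexP pos j; last exact: reflect_series_eq0.
  rewrite [X in reflect_series _ _ _ X]reflect_series_eq0.
    by rewrite /reflect_series X0 if_same.
  move=> K; have := jN M; rewrite jM eqxx => h.
  have {}h : (N < M)%N by rewrite ltnNge; apply/negP => MN; have := h MN.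
  by rewrite /reflect_index; case: pos {jM jN}; lia.
Qed.

Lemma sexp_reflect pos (a : nat -> V -> V) : (forall i, linear (a i)) -> (forall v, a 0%N v = 0) ->
  sexp (reflect_series pos a) = reflect_series pos (nexp a).
Proof.
move=> aL a0.
have spowE r : spow (reflect_series pos a) r = reflect_series pos (pw a r).
  elim: r => [|r IH].
    apply: eq_reflect_series => [N v|n v nN]; rewrite /spow /pw /= /sconst.
      by rewrite (_ : (_ == _ :> int) = (N == 0%N)) // /reflect_index; case: pos; lia.
    have := nN 0%N; rewrite /reflect_index => nN0.
    by rewrite (_ : (n == - 1) = false) //; case: pos nN0 {nN}; lia.
  rewrite /spow iterS -/(spow _ r) IH sprod_reflect // => i.
  by rewrite (linf0 (aL i)).
apply: eq_reflect_series => [N v|n v nN].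
  rewrite /sexp -/(nsum _) (@nsumE _ N.+1).
    by rewrite /nexp; apply: eq_bigr => r _; rewrite spowE reflect_seriesE.
  by move=> r Nr; rewrite spowE reflect_seriesE pw_small ?scaler0.
by apply: fsbig1 => r _; rewrite spowE reflect_series_eq0 ?scaler0.
Qed.

Lemma sprod_sconst A (T : V -> V) n v : (forall j, A j 0 = 0) -> sprod A (sconst T) n v = A n (T v).
Proof.
move=> A0; rewrite /sprod (@fsum_inj _ (fun i => n + i%:Z) 1).
- by rewrite big_ord1 /sconst addr0 (_ : n - 1 - n = - 1) //; lia.
- by move=> i j; lia.
- by move=> j /(_ 0%N isT) jn; rewrite /sconst (_ : (_ == _ :> int) = false) //; lia.
Qed.

End SeriesProducts.

(** * Vertex operators *)

Section VertexOperators.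
Context {C : numFieldType} {V : lmodType C}.
Variables (kappa : C) (mode : boson * bool -> series V).
Variables (kt : int -> V) (sh : int -> V -> V).
Implicit Types (i j : boson * bool) (v : V) (s : bool).

Definition is_heis i := nat_of_boson i.1 == 2%N.

(** All that is used of the Fock space from here on: [kt l] plays the vector 1_l, and [sh] the
    translation of momenta. The concrete space enters only through [fock_free_fields]. *)
Record free_fields : Prop := FreeFields {
  ff_kappa : kappa != 0;
  ff_field : forall i, is_field (mode i);
  ff_comm : forall i j m n v,
    mode i m (mode j n v) = mode j n (mode i m v) + pairing kappa i j m n *: v;
  ff_kt : forall i (p : nat) l,
    mode i p (kt l) = if (p == 0%N) && is_heis i then l%:~R *: kt l else 0;
  ff_sh_linear : forall mu, linear (sh mu);
  ff_sh_kt : forall mu l, sh mu (kt l) = kt (l + mu);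
  ff_sh_mode : forall mu i n v, mode i n (sh mu v) =
    sh mu (mode i n v) + (if (n == 0) && is_heis i then mu%:~R *: sh mu v else 0);
  ff_ind : forall P : V -> Prop, (forall a u v, P u -> P v -> P (a *: u + v)) ->
    (forall l, P (kt l)) -> (forall i p v, P v -> P (mode i (Negz p) v)) -> forall v, P v
}.

Hypothesis ff : free_fields.

Let modeL i n : linear (mode i n).
Proof. exact: field_linear (ff_field ff i) n. Qed.

Let modeC := ff_comm ff.

Definition signed (pos : bool) (N : nat) : int := if pos then N%:Z else - N%:Z.

(** At N = 0 the inverse of 0 is 0, which drops the zero mode, as the integrals in [YY] require. *)
Definition vexp_coef pos s (mu : int) (N : nat) v : V :=
  (mu%:~R / (2 * hkappa kappa s) / (- signed pos N)%:~R) *: mode (Heis, s) (signed pos N) v.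

Definition vexp_series pos s mu : series V := reflect_series pos (nexp (vexp_coef pos s mu)).

Let coefL pos s mu N : linear (vexp_coef pos s mu N).
Proof. by move=> a u v; rewrite /vexp_coef modeL; lmod_ring C V. Qed.

Let coef0 pos s mu v : vexp_coef pos s mu 0 v = 0.
Proof.
by rewrite /vexp_coef /signed (_ : - (if pos then _ else _) = 0) ?invr0 ?mulr0 ?scale0r //; case: pos.
Qed.

Let heis_same_sign pos s s' N M v :
  mode (Heis, s) (signed pos N) (mode (Heis, s') (signed pos M) v) =
  mode (Heis, s') (signed pos M) (mode (Heis, s) (signed pos N) v).
Proof.
rewrite modeC (_ : pairing _ _ _ _ _ = 0) ?scale0r ?addr0 // /pairing [_.2]/= [_.1]/=.
case: ifP => // _; rewrite [X in if X then _ else _](_ : _ = (N + M == 0)%N); last first.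
  by rewrite /signed; case: pos; lia.
by case: eqP => // NM; rewrite (_ : signed pos N = 0) ?mulr0 // /signed; case: pos; lia.
Qed.

Let coefC pos s mu N M v :
  vexp_coef pos s mu N (vexp_coef pos s mu M v) = vexp_coef pos s mu M (vexp_coef pos s mu N v).
Proof. by rewrite /vexp_coef !(linfZ (modeL _ _)) heis_same_sign !scalerA mulrC. Qed.

Let bcoef pos s mu (N : nat) v := N%:R *: vexp_coef pos s mu N v.

Let bcoefL pos s mu N : linear (bcoef pos s mu N).
Proof. by move=> a u v; rewrite /bcoef coefL; lmod_ring C V. Qed.

Let bcoef0 pos s mu v : bcoef pos s mu 0 v = 0.
Proof. by rewrite /bcoef scale0r. Qed.

Let bcoefE pos s mu N v : bcoef pos s mu N v =
  ((if pos then - 1 else 1) * (mu%:~R / (2 * hkappa kappa s)) * (N != 0)%N%:R) *: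
  mode (Heis, s) (signed pos N) v.
Proof.
rewrite /bcoef /vexp_coef scalerA; congr (_ *: _); case: N => [|N]; first by rewrite mul0r mulr0.
have N0 : N.+1%:R != 0 :> C by rewrite pnatr_eq0.
have -> : (- signed pos N.+1)%:~R = (if pos then - 1 else 1) * N.+1%:R :> C.
  by rewrite /signed; case: pos; rewrite ?opprK ?rmorphN /= ?mulN1r ?mul1r.
move: (mu%:~R / _) (N.+1%:R : C) N0 => c M M0.
by case: pos; rewrite /= ?mul1r ?mulN1r; field.
Qed.

Lemma vexp_schur pos s mu : is_schur (bcoef pos s mu) (nexp (vexp_coef pos s mu)).
Proof. by apply: nexp_schur. Qed.

Let nexpL pos s mu N : linear (nexp (vexp_coef pos s mu) N).
Proof. exact: schur_linear (bcoefL pos s mu) (@bcoef0 pos s mu) (vexp_schur pos s mu) N. Qed.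

Lemma vexp_linear pos s mu : linear_modes (vexp_series pos s mu).
Proof.
move=> n a u v; rewrite /vexp_series /reflect_series.
by case: ifP => _; rewrite ?nexpL // scaler0 addr0.
Qed.

Lemma vexp_commute pos s mu (T : V -> V) : linear T ->
  (forall N v, (0 < N)%N -> T (mode (Heis, s) (signed pos N) v) = mode (Heis, s) (signed pos N) (T v)) ->
  forall n v, T (vexp_series pos s mu n v) = vexp_series pos s mu n (T v).
Proof.
move=> TL TC n v; rewrite /vexp_series /reflect_series; case: ifP => _; last by rewrite (linf0 TL).
apply: (schur_commute (bcoefL pos s mu) (@bcoef0 pos s mu) (vexp_schur pos s mu) TL).
by move=> [|N] w; rewrite ?bcoef0 ?(linf0 TL) // !bcoefE (linfZ TL) TC.
Qed.

(** The only nonzero bracket pairs a_m with the term of a_(-m) in the exponent: 2 [hkappa] m times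
    mu / (2 [hkappa] m) is mu. [schur_bracket] lifts this to the exponential. *)
Lemma mode_vexp pos s mu i (m : int) :
  shift_bracket (mode i m) (vexp_series pos s mu)
    (if (i == (Heis, s)) && (if pos then m < 0 else 0 < m) then mu%:~R else 0) m.
Proof.
move=> n v; case: ifP => [/andP[/eqP -> mpos]|ism]; last first.
  rewrite scale0r addr0; apply: vexp_commute; first exact: modeL.
  move=> N w N0; rewrite modeC (_ : pairing _ _ _ _ _ = 0) ?scale0r ?addr0 // /pairing.
  case: i ism => -[] t; rewrite /= ?if_same //; case: (t =P s) => //= ->; rewrite eqxx /= => mpos.
  case: eqP => // mN; exfalso; move: mpos mN; rewrite /signed; case: (pos); lia.
have [[N ->]|nN] := reflect_indexP pos n; last first.
  rewrite /vexp_series !reflect_series_eq0 ?(linf0 (modeL _ _)) ?scaler0 ?addr0 //.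
  move=> N; apply/eqP => E; have /eqP := nN (N + absz m)%N; apply.
  by move: E mpos; rewrite /reflect_index; case: pos {nN}; lia.
have m0 : (0 < absz m)%N by case: (pos) mpos; lia.
have k0 : hkappa kappa s != 0 by apply: hkappa_neq0 (ff_kappa ff) s.
rewrite /vexp_series !reflect_seriesE.
rewrite (schur_bracket (c := mu%:~R) (bcoefL pos s mu) (@bcoef0 pos s mu) (vexp_schur pos s mu) (modeL _ m) m0).
  congr (_ + _); case: leqP => Nm.
    rewrite (_ : reflect_index pos N + m = reflect_index pos (N - absz m)%N) ?reflect_seriesE //.
    by move: mpos; rewrite /reflect_index; case: (pos); lia.
  rewrite reflect_series_eq0 ?scaler0 // => K; move: mpos.
  by rewrite /reflect_index; case: (pos); lia.
move=> N' w; rewrite !bcoefE (linfZ (modeL _ _)) modeC scalerDr; congr (_ + _).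
rewrite scalerA /pairing eqxx /=.
have -> : (m + signed pos N' == 0) = (N' == absz m) by move: mpos; rewrite /signed; case: (pos); lia.
case: (N' =P absz m) => [->|_]; last by rewrite mulr0 scale0r.
congr (_ *: _); rewrite -lt0n m0 mulr1.
have -> : (absz m)%:R = (if pos then - 1 else 1) * m%:~R :> C.
  rewrite -[(absz m)%:R]/((absz m)%:Z%:~R).
  have -> : (absz m)%:Z = (if pos then - 1 else 1) * m by move: mpos; case: (pos); lia.
  by rewrite rmorphM; case: (pos); rewrite ?rmorphN.
by case: (pos); field.
Qed.

Lemma vexp_kt s mu n l :
  vexp_series true s mu n (kt l) = if n == - 1 then kt l else 0.
Proof.
have S := vexp_schur true s mu; have [X0 XE] := S.
have E N : nexp (vexp_coef true s mu) N.+1 (kt l) = 0.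
  elim/ltn_ind: N => N IH; apply: (@scaleS_inj _ _ N); rewrite scaler0 XE big1 // => -[[|k] kN] _ /=.
    exact: bcoef0.
  rewrite subSS; have [kN'|kN'] := ltnP k N.
    have -> : (N - k)%N = (N - k.+1).+1 by lia.
    by rewrite IH ?(linf0 (bcoefL _ _ _ _)) //; lia.
  have -> : (N - k)%N = 0%N by lia.
  by rewrite X0 bcoefE (ff_kt ff) /= scaler0.
have [[N ->]|nN] := reflect_indexP true n.
  rewrite /vexp_series reflect_seriesE; case: N => [|N]; first by rewrite X0.
  by rewrite E (_ : (_ == _) = false) // /reflect_index; lia.
rewrite /vexp_series reflect_series_eq0 //; have := nN 0%N; rewrite /reflect_index sub0r.
by case: eqP.
Qed.

Lemma vexp_neg_eq0 s mu n v : 0 <= n -> vexp_series false s mu n v = 0.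
Proof. by move=> n0; rewrite /vexp_series /reflect_series; case: ifP => //; lia. Qed.

Lemma vexp_pos_field s mu : is_field (vexp_series true s mu).
Proof.
split; first exact: vexp_linear.
apply: (ff_ind ff) => [a u v [N hN] [M hM]|l|i p v [N hN]].
- exists (Num.max N M) => n; rewrite ge_max => /andP[Nn Mn].
  by rewrite vexp_linear hN // hM // scaler0 addr0.
- by exists 0 => n n0; rewrite vexp_kt // (_ : (n == - 1) = false) //; lia.
- exists (N + p.+1%:Z) => n Nn; have := mode_vexp true s mu i (Negz p) n v.
  rewrite (hN n) ?(linf0 (modeL _ _)); last by lia.
  by rewrite (hN (n + _)) ?scaler0 ?addr0 => [<-//|]; lia.
Qed.

Definition vertex_op (mu : int) : series V :=
  sprod (vexp_series false false mu)
 (sprod (vexp_series true false mu)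
 (sprod (vexp_series false true mu)
 (sprod (vexp_series true true mu) (sconst (sh mu))))).

Section Factors.
Variable mu : int.

Let B4 : series V := sprod (vexp_series true true mu) (sconst (sh mu)).
Let B3 : series V := sprod (vexp_series false true mu) B4.
Let B2 : series V := sprod (vexp_series true false mu) B3.

Let vexp0 pos s n : vexp_series pos s mu n 0 = 0.
Proof. exact: linf0 (vexp_linear pos s mu n). Qed.

Let B4E n v : B4 n v = vexp_series true true mu n (sh mu v).
Proof. exact: sprod_sconst. Qed.

Let B4f : is_field B4.
Proof.
have [EL ET] := vexp_pos_field true mu; split=> [n a u v|v].
  by rewrite !B4E (ff_sh_linear ff) EL.
by have [N hN] := ET (sh mu v); exists N => n Nn; rewrite B4E hN.
Qed.

Let B4br i m : shift_bracket (mode i m) B4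
  (if (i == (Heis, true)) && (m < 0) then mu%:~R else if (m == 0) && is_heis i then mu%:~R else 0) m.
Proof.
move=> n v; rewrite !B4E (mode_vexp true true mu i m) (ff_sh_mode ff).
case: (m =P 0) => [->|m0].
  rewrite andbF scale0r addr0 addr0 /= (linfD (vexp_linear _ _ _ _)).
  by case: (is_heis i); rewrite ?scale0r ?vexp0 // (linfZ (vexp_linear _ _ _ _)).
by rewrite /= addr0; case: ifP.
Qed.

Let B3s : summable (vexp_series false true mu) B4 /\ is_field B3.
Proof. by apply: sprod_field_neg => //; [exact: vexp_linear | move=> j v; exact: vexp_neg_eq0]. Qed.

Let B3br i m : shift_bracket (mode i m) B3
  ((if (i == (Heis, true)) && (0 < m) then mu%:~R else 0) +
   (if (i == (Heis, true)) && (m < 0) then mu%:~R else if (m == 0) && is_heis i then mu%:~R else 0)) m.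
Proof.
apply: sprod_bracket; [exact: vexp_linear | exact: field_linear B4f | exact: modeL | by case: B3s
  | exact: mode_vexp | exact: B4br].
Qed.

(** The inner factors involve only abar and the momentum shift, both of which commute with a_N for N
    > 0. *)
Let B3C n k v : vexp_series true false mu n (B3 k v) = B3 k (vexp_series true false mu n v).
Proof.
symmetry; apply: vexp_commute; first exact: field_linear B3s.2 k.
move=> N w N0; rewrite (B3br (Heis, false) (signed true N)) /=.
by rewrite (_ : (_ == 0) = false) /= ?addr0 ?scale0r ?addr0 // /signed; lia.
Qed.

Let B2s : summable (vexp_series true false mu) B3 /\ is_field B2.
Proof. by apply: sprod_field_comm; [exact: vexp_pos_field | by case: B3s | exact: B3C]. Qed.

Let B1s : summable (vexp_series false false mu) B2 /\ is_field (vertex_op mu).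
Proof.
apply: sprod_field_neg; [exact: vexp_linear | by move=> j v; exact: vexp_neg_eq0 | by case: B2s].
Qed.

Lemma vertex_op_field : is_field (vertex_op mu).
Proof. by case: B1s. Qed.

(** For a Heisenberg mode exactly one factor contributes mu: the creation exponential if m > 0, the
    annihilation exponential if m < 0, the shift if m = 0. *)
Lemma mode_vertex_op i m :
  shift_bracket (mode i m) (vertex_op mu) (if is_heis i then mu%:~R else 0) m.
Proof.
have [S2 F2] := B2s; have [S1 F1] := B1s; have [S3 F3] := B3s.
have h2 := sprod_bracket (vexp_linear true false mu) (field_linear F3) (modeL i m) S2
  (mode_vexp true false mu i m) (B3br i m).
have h1 := sprod_bracket (vexp_linear false false mu) (field_linear F2) (modeL i m) S1
  (mode_vexp false false mu i m) h2.
move=> n v; rewrite h1; congr (_ + _ *: _).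
have E s : (i == (Heis, s)) = is_heis i && (i.2 == s) by case: i {h1 h2} => -[] t.
rewrite !E; case: (is_heis i); rewrite ?andbF /= ?addr0 //.
by have [m0|m0|m0] := ltrgtP m 0; case: (i.2); rewrite /= ?addr0 ?add0r.
Qed.

Definition vertex_schur := conv (nexp (vexp_coef false false mu)) (nexp (vexp_coef false true mu)).

Lemma vertex_op_kt n l : vertex_op mu n (kt l) = reflect_series false vertex_schur n (kt (l + mu)).
Proof.
have [S2 F2] := B2s; have [S1 F1] := B1s; have [S3 F3] := B3s.
have h4 k : B4 k (kt l) = if k == - 1 then kt (l + mu) else 0.
  by rewrite B4E (ff_sh_kt ff) vexp_kt.
have single (A B : series V) w : (forall k, A k 0 = 0) ->
    (forall k, B k (kt l) = if k == - 1 then w else 0) ->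
    forall k, sprod A B k (kt l) = A k w.
  move=> A0 hB k; rewrite /sprod (@fsum_inj _ _ _ (fun p : nat => k + p%:Z) 1).
  - by rewrite big_ord1 hB addr0 (_ : k - 1 - k = - 1) //; lia.
  - by move=> i j; lia.
  - by move=> j /(_ 0%N isT) jn; rewrite hB (_ : (_ == _ :> int) = false) //; lia.
have h3 k : B3 k (kt l) = vexp_series false true mu k (kt (l + mu)).
  by rewrite /B3 (single _ _ _ (vexp0 false true) h4).
have h2 k : B2 k (kt l) = vexp_series false true mu k (kt (l + mu)).
  rewrite -h3 /B2 /sprod (@fsum_inj _ _ _ (fun p : nat => - 1 + p%:Z) 1).
  - by rewrite big_ord1 B3C vexp_kt eqxx (_ : k - 1 - _ = k); [ | rewrite [nat_of_ord _]/=; lia].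
  - by move=> i j; lia.
  - move=> j /(_ 0%N isT) jn; rewrite B3C vexp_kt // (_ : (_ == _ :> int) = false) //; last by lia.
    exact: linf0 (field_linear F3 _).
have -> : vertex_op mu = sprod (vexp_series false false mu) B2 by [].
rewrite -sprod_reflect; last by move=> i; apply: linf0 (nexpL _ _ _ _).
by apply: eq_fsbigr => j _; rewrite h2.
Qed.

End Factors.

Let kappa0 := ff_kappa ff.

(* The vertex operators are exponentials of the isotropic field a - abar,    *)
(* whose modes commute with each other and with all vertex operators.        *)
Definition isotropic (m : int) v := mode (Heis, false) m v - mode (Heis, true) m v.

Definition isotropic_coef (mu : int) (N : nat) v :=
  ((N != 0)%N%:R * (mu%:~R / (2 * kappa))) *: isotropic (- N%:Z) v.

Lemma isotropic_linear m : linear (isotropic m).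
Proof. by move=> a u v; rewrite /isotropic !modeL; lmod_ring C V. Qed.

Lemma isotropicC m n v : isotropic m (isotropic n v) = isotropic n (isotropic m v).
Proof.
rewrite /isotropic !(linfB (modeL _ _)) !(modeC (Heis, _) (Heis, _) m n).
rewrite /pairing /=; case: eqP => _; rewrite /hkappa; last by lmod_ring C V.
by lmod_ring C V.
Qed.

Lemma isotropic_coef_linear mu N : linear (isotropic_coef mu N).
Proof. by move=> a u v; rewrite /isotropic_coef isotropic_linear; lmod_ring C V. Qed.

Lemma isotropic_coef0 mu v : isotropic_coef mu 0 v = 0.
Proof. by rewrite /isotropic_coef mul0r scale0r. Qed.

Lemma vertex_schurP mu : is_schur (isotropic_coef mu) (vertex_schur mu).
Proof.
have -> : isotropic_coef mu = fun N v => bcoef false false mu N v + bcoef false true mu N v.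
  apply/funext => N; apply/funext => v; rewrite !bcoefE /isotropic_coef /isotropic /hkappa /signed.
  by have k0 := kappa0; lmod_coefs C V; field.
apply: conv_schur; [exact: bcoefL | exact: bcoefL | exact: nexpL | | exact: vexp_schur | exact: vexp_schur].
move=> i j v; symmetry.
apply: (schur_commute (bcoefL false false mu) (@bcoef0 false false mu) (vexp_schur false false mu) (bcoefL _ _ _ j)).
move=> k w; rewrite !bcoefE !(linfZ (modeL _ _)) heis_same_sign.
by lmod_ring C V.
Qed.

Lemma vertex_schur_linear mu N : linear (vertex_schur mu N).
Proof.
exact: schur_linear (isotropic_coef_linear mu) (@isotropic_coef0 mu) (vertex_schurP mu) N.
Qed.

Lemma vertex_schur_commute mu (T : V -> V) : linear T ->
  (forall m v, T (isotropic m v) = isotropic m (T v)) ->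
  forall N v, T (vertex_schur mu N v) = vertex_schur mu N (T v).
Proof.
move=> TL TC; apply: (schur_commute (isotropic_coef_linear mu) (@isotropic_coef0 mu)) => //.
  exact: vertex_schurP.
by move=> i v; rewrite /isotropic_coef (linfZ TL) TC.
Qed.

Lemma vertex_op_linear mu n : linear (vertex_op mu n).
Proof. exact: field_linear (vertex_op_field mu) n. Qed.

Lemma vertex_op_mode mu n i m v : vertex_op mu n (mode i m v) =
  mode i m (vertex_op mu n v) - (if is_heis i then mu%:~R else 0) *: vertex_op mu (n + m) v.
Proof. by rewrite mode_vertex_op addrK. Qed.

Lemma vertex_op_isotropic mu n m v : vertex_op mu n (isotropic m v) = isotropic m (vertex_op mu n v).
Proof. by rewrite /isotropic (linfB (vertex_op_linear _ _)) !vertex_op_mode /=; lmod_ring C V. Qed.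

(** On [kt l] the annihilation exponentials act trivially, and both orders give the same product of
    commuting exponentials of a - abar. The bracket [vertex_op_mode] with creation operators extends
    the equality to the whole space. *)
Lemma vertex_opC mu nu m n v :
  vertex_op mu m (vertex_op nu n v) = vertex_op nu n (vertex_op mu m v).
Proof.
move: v m n; apply: (ff_ind ff) => [a u v Pu Pv m n|l m n|i p v Pv m n].
- by rewrite !vertex_op_linear Pu Pv.
- have E a b k k' : vertex_op a k (vertex_op b k' (kt l)) =
      reflect_series false (vertex_schur b) k'
        (reflect_series false (vertex_schur a) k (kt (l + b + a))).
    rewrite vertex_op_kt [in LHS]/reflect_series; case: ifP => h; last first.
      by rewrite (linf0 (vertex_op_linear _ _)) /reflect_series h.
    rewrite (vertex_schur_commute b (vertex_op_linear _ _)); last exact: vertex_op_isotropic.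
    by rewrite vertex_op_kt {2}/reflect_series h.
  rewrite !E (_ : l + nu + mu = l + mu + nu); last by lia.
  rewrite /reflect_series; case: ifP => h; case: ifP => h' //; last by rewrite (linf0 (vertex_schur_linear _ _)).
    apply: (vertex_schur_commute mu (vertex_schur_linear _ _)) => k w.
    by rewrite (vertex_schur_commute nu (isotropic_linear k)) // => k' w'; apply: isotropicC.
  by rewrite (linf0 (vertex_schur_linear _ _)).
- rewrite !vertex_op_mode !(linfB (vertex_op_linear _ _)) !(linfZ (vertex_op_linear _ _)).
  by rewrite !vertex_op_mode !Pv; lmod_ring C V.
Qed.

(** * Covariance and locality of the generating fields *)

Local Notation D := (translation kappa mode).

Let DL : linear D.
Proof. exact: (translation_linear kappa (ff_field ff)). Qed.

Let D_mode i m v : D (mode i m v) = mode i m (D v) + (- m)%:~R *: mode i (m - 1) v.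
Proof.
rewrite -[_ *: _]/(sderiv (mode i) m v) -(mode_translation kappa0 (ff_field ff) modeC).
by rewrite addrC subrK.
Qed.

Lemma translation_kt l : D (kt l) = (l%:~R / (2 * kappa)) *: isotropic (- 1) (kt l).
Proof.
apply: (translation_vacuum kappa0 (ff_field ff)) => i p.
exact: ff_kt.
Qed.

(** On [kt l], D produces (l + mu) / (2 kappa) times the mode -1 of a - abar after the shift of
    momentum, and l / (2 kappa) before it. The difference is the term b_1 in [schur_derivation].
    Brackets with creation operators do the rest. *)
Lemma vertex_op_covariant mu : covariant D (vertex_op mu).
Proof.
move=> n v; rewrite /sderiv; move: v n.
have VL := vertex_op_linear mu.
apply: (ff_ind ff) => [a u v Pu Pv n|l n|i p v Pv n].
- have {}Pu := Pu n; have {}Pv := Pv n; move: Pu Pv => /(canRL (subrK _)) Pu /(canRL (subrK _)) Pv.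
  by rewrite !VL !DL VL Pu Pv; lmod_ring C V.
- rewrite translation_kt (linfZ (VL n)) vertex_op_isotropic !vertex_op_kt.
  have [[N ->]|nN] := reflect_indexP false n; last first.
    rewrite reflect_series_eq0 // (linf0 DL) (linf0 (isotropic_linear _)) scaler0 subrr.
    have [->|n0] := eqVneq n 0; first by rewrite oppr0 scale0r.
    rewrite reflect_series_eq0 ?scaler0 // => N; have := nN (absz (N%:Z - 1)).
    by rewrite /reflect_index; lia.
  rewrite (_ : reflect_index false N - 1 = reflect_index false N.+1); last by rewrite /reflect_index; lia.
  rewrite !reflect_seriesE.
  rewrite (schur_derivation (isotropic_coef_linear mu) (@isotropic_coef0 mu) (vertex_schurP mu) DL); first last.
  + by move=> i j w; rewrite /isotropic_coef !(linfZ (isotropic_linear _)) isotropicC; lmod_ring C V.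
  + move=> i w i0; rewrite /isotropic_coef (linfZ DL) /isotropic (linfB DL) !D_mode opprK.
    have -> : - i%:Z - 1 = - i.+1%:Z by lia.
    by rewrite -lt0n i0 /= -[i%:Z%:~R]/(i%:R); lmod_ring C V.
  rewrite translation_kt (linfZ (vertex_schur_linear _ _)).
  rewrite -(vertex_schur_commute mu (isotropic_linear _)); last by move=> m w; apply: isotropicC.
  rewrite /isotropic_coef [(- 1%:Z)]/=.
  have -> : (- reflect_index false N)%:~R = N.+1%:R :> C.
    by rewrite (_ : - reflect_index false N = N.+1%:Z) // /reflect_index; lia.
  by have k0 := kappa0; lmod_coefs C V; rewrite ?rmorphD /=; field.
- rewrite vertex_op_mode (linfB DL) (linfZ DL) !D_mode (linfD (VL n)) (linfZ (VL n)) !vertex_op_mode.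
  have {}Pv k : D (vertex_op mu k v) = vertex_op mu k (D v) + (- k)%:~R *: vertex_op mu (k - 1) v.
    by rewrite -Pv addrC subrK.
  rewrite !Pv (linfD (modeL _ _)) (linfZ (modeL _ _)) (_ : n + (Negz p - 1) = n + Negz p - 1); last by lia.
  rewrite (_ : n - 1 + Negz p = n + Negz p - 1); last by lia.
  by lmod_coefs C V; ring.
Qed.

(** The commutator is a multiple of the delta function or of its first derivative, so two factors
    suffice. *)
Lemma mode_local i j : local (mode i) (mode j).
Proof.
exists 2%N => v; apply: eq_array2 => m n.
have cE k l : comm (mode i) (mode j) v k l = pairing kappa i j k l *: v.
  by rewrite /comm modeC addrC addKr.
rewrite /= /dzw !cE -!scalerBl [X in X *: _](_ : _ = 0) ?scale0r //.
rewrite /pairing (_ : m + 1 + 1 + n = m + n + 2); last by lia.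
rewrite (_ : m + 1 + (n + 1) = m + n + 2); last by lia.
rewrite (_ : m + (n + 1 + 1) = m + n + 2); last by lia.
case: eqP => // _; last by rewrite !subrr.
case: i j {cE} => -[] s [[] t] /=; rewrite ?subrr //.
case: eqP => _; last by rewrite !subrr.
by rewrite !rmorphD /=; ring.
Qed.

Lemma mode_vertex_op_local i mu : local (mode i) (vertex_op mu).
Proof.
exists 1%N => v; apply: eq_array2 => m n /=; rewrite /dzw /comm !mode_vertex_op.
rewrite (_ : n + (m + 1) = n + 1 + m); last by lia.
by transitivity (0 : V) => //; lmod_ring C V.
Qed.

Definition generator (X : series V) := (exists i, X = mode i) \/ (exists mu, X = vertex_op mu).

Lemma generator_field X : generator X -> is_field X.
Proof. by case=> -[i ->]; [exact: ff_field | exact: vertex_op_field]. Qed.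

Lemma generator_covariant X : generator X -> covariant D X.
Proof.
case=> -[i ->]; last exact: vertex_op_covariant.
exact: (mode_translation kappa0 (ff_field ff) modeC).
Qed.

Lemma generator_local X Y : generator X -> generator Y -> local X Y.
Proof.
case=> -[i ->] [] [j ->].
- exact: mode_local.
- exact: mode_vertex_op_local.
- by apply: local_sym; apply: mode_vertex_op_local.
- by apply: local_commuting => m n v; apply: vertex_opC.
Qed.

Lemma vertex_op_state mu l : vertex_op mu (- 1) (kt l) = kt (l + mu).
Proof.
rewrite vertex_op_kt (_ : - 1 = reflect_index false 0) // reflect_seriesE.
by case: (vertex_schurP mu) => ->.
Qed.

Lemma generator_span (P : V -> Prop) : P (kt 0) ->
  (forall a u v, P u -> P v -> P (a *: u + v)) ->
  (forall X n v, generator X -> P v -> P (X n v)) -> forall v, P v.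
Proof.
move=> P0 PL PX; apply: (ff_ind ff) => // [l|i p v Pv]; last by apply: PX => //; left; exists i.
by rewrite -[l]add0r -vertex_op_state; apply: PX => //; right; exists l.
Qed.

Lemma free_field_generators : vertex_generators (kt 0) D generator.
Proof.
split; [exact: DL | by rewrite translation_kt mul0r scale0r | exact: generator_field
  | exact: generator_covariant | exact: generator_local | exact: generator_span].
Qed.

End VertexOperators.

(** * Brackets of the currents *)

Section Brackets.
Context {C : numFieldType} {V : lmodType C}.
Variables (kappa : C) (mode : boson * bool -> series V).
Variables (kt : int -> V) (sh : int -> V -> V).
Hypothesis ff : free_fields kappa mode kt sh.
Local Notation D := (translation kappa mode).
Local Notation good := (good D (generator kappa mode sh)).
Local Notation v := (kt 0).
Implicit Types (s : bool) (w : V) (A B P : series V).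

Let vg := free_field_generators ff.

Let goodL A n : good A -> linear (A n).
Proof. by case=> -[]. Qed.

Definition scalar_series (c : C) : series V := sscale c (sconst id).

Lemma good_scalar c : good (scalar_series c).
Proof. exact (good_sscale vg c (good_sconst vg)). Qed.

Lemma scalar_seriesE c (n : int) w : scalar_series c n w = (if n == - 1 then c else 0) *: w.
Proof. by rewrite /scalar_series /sscale /sconst; case: eqP; rewrite ?scaler0 ?scale0r. Qed.

Lemma scalar_series0 (n : int) w : scalar_series 0 n w = 0.
Proof. by rewrite scalar_seriesE; case: eqP; rewrite scale0r. Qed.

Lemma gbin1 (m : int) : gbin C m 1 = m%:~R.
Proof. by rewrite /gbin big_ord1 subr0 divr1. Qed.

(** The commutator formula for poles of order at most two, with P0 and P1 the coefficients of the
    first- and second-order poles. *)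
Lemma bracketE A B P0 P1 : good A -> good B -> good P0 -> good P1 ->
  A 0%N%:Z (B (- 1) v) = P0 (- 1) v -> A 1%N%:Z (B (- 1) v) = P1 (- 1) v ->
  (forall j : nat, A j.+2%:Z (B (- 1) v) = 0) ->
  forall (m n : int) w,
    A m (B n w) = B n (A m w) + (P0 (m + n) w + m%:~R *: P1 (m + n - 1) w).
Proof.
move=> Ag Bg P0g P1g h0 h1 h2 m n w.
rewrite (good_commutator vg (P := fun j => if j is 0%N then P0 else P1) (J := 2) Ag Bg).
- by rewrite big_ord_recl big_ord1 /= gbin0 gbin1 scale1r subr0.
- by move=> [|[|j]].
- by move=> [|[|j]].
Qed.

Lemma bracket1E A B P0 : good A -> good B -> good P0 ->
  A 0%N%:Z (B (- 1) v) = P0 (- 1) v -> (forall j : nat, A j.+1%:Z (B (- 1) v) = 0) ->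
  forall (m n : int) w, A m (B n w) = B n (A m w) + P0 (m + n) w.
Proof.
move=> Ag Bg P0g h0 h1 m n w; rewrite (bracketE Ag Bg P0g (good_scalar 0)) //.
  by rewrite scalar_series0 scaler0 addr0.
by rewrite scalar_series0 h1.
Qed.

Lemma bracket0E A B : good A -> good B -> (forall j : nat, A j%:Z (B (- 1) v) = 0) ->
  forall (m n : int) w, A m (B n w) = B n (A m w).
Proof.
move=> Ag Bg h m n w; rewrite (bracket1E Ag Bg (good_scalar 0)) //.
  by rewrite scalar_series0 addr0.
by rewrite scalar_series0 h.
Qed.

Local Notation b s := (mode (Beta, s)).
Local Notation c s := (mode (Gamma, s)).
Local Notation a s := (mode (Heis, s)).
Local Notation X := (vertex_op kappa mode sh (- 2)).
Local Notation hk s := (hkappa kappa s).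

Lemma good_mode i : good (mode i).
Proof. by apply: (good_gen vg); left; exists i. Qed.

Lemma good_X : good X.
Proof. by apply: (good_gen vg); right; exists (- 2). Qed.

Let modeL i n : linear (mode i n). Proof. exact: goodL (good_mode i). Qed.
Let modeD i n u w : mode i n (u + w) = mode i n u + mode i n w. Proof. exact: linfD (modeL i n) u w. Qed.
Let modeZ i n k w : mode i n (k *: w) = k *: mode i n w. Proof. exact: linfZ (modeL i n) k w. Qed.
Let modeN i n w : mode i n (- w) = - mode i n w. Proof. exact: linfN (modeL i n) w. Qed.
Let mode0 i n : mode i n 0 = 0. Proof. exact: linf0 (modeL i n). Qed.

(** [pairing] of a mode p >= 0 with the creation mode -q - 1, written with [eqn] so that it computes
    on numerals. *)
Let pr (q : nat) (i j : boson * bool) (p : nat) : C :=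
  if i.2 == j.2 then
    match i.1, j.1 with
    | Beta, Gamma => if eqn p q then 1 else 0
    | Gamma, Beta => if eqn p q then - 1 else 0
    | Heis, Heis => if eqn p q.+1 then 2 * hk i.2 * q.+1%:R else 0
    | _, _ => 0
    end
  else 0.

Let ann q i j p w : mode i p%:Z (mode j (- q.+1%:Z) w) =
  mode j (- q.+1%:Z) (mode i p%:Z w) + pr q i j p *: w.
Proof.
rewrite (ff_comm ff); congr (_ + _ *: _); rewrite /pairing /pr -if_neg negbK.
case: (i.2 == j.2) => //; case: i j => -[] t [[] t'] //=.
- by rewrite (_ : (_ == - 1) = eqn p q); [case: eqn | rewrite -[eqn p q]/(p == q); lia].
- by rewrite (_ : (_ == - 1) = eqn p q); [case: eqn; rewrite ?oppr0 | rewrite -[eqn p q]/(p == q); lia].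
- rewrite (_ : (_ == 0) = (p == q.+1)); last by lia.
  by rewrite -[eqn p q.+1]/(p == q.+1); case: eqP => // ->.
Qed.

Let ann1 i j p w : mode i p%:Z (mode j (- 1) w) = mode j (- 1) (mode i p%:Z w) + pr 0 i j p *: w.
Proof. exact: ann 0 i j p w. Qed.
Let ann2 i j p w : mode i p%:Z (mode j (- 2) w) = mode j (- 2) (mode i p%:Z w) + pr 1 i j p *: w.
Proof. exact: ann 1 i j p w. Qed.

Let annv i p : mode i p%:Z v = 0.
Proof. by rewrite (ff_kt ff); case: ifP => _; rewrite ?scale0r. Qed.

Let annX i p (m : int) : mode i p%:Z (X m v) = (if is_heis i then - 2 else 0) *: X (m + p%:Z) v.
Proof. by rewrite (mode_vertex_op ff) annv (linf0 (goodL _ good_X)) add0r; case: ifP. Qed.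

Let Xv p : X p%:Z v = 0. Proof. exact: (good_vac vg good_X). Qed.
Let Xb m s k w : X m (b s k w) = b s k (X m w).
Proof. by rewrite (vertex_op_mode ff) /= scale0r subr0. Qed.
Let Xc m s k w : X m (c s k w) = c s k (X m w).
Proof. by rewrite (vertex_op_mode ff) /= scale0r subr0. Qed.
Let Xa m s w : X m (a s (- 1) w) = a s (- 1) (X m w) + 2 *: X (m - 1) w.
Proof. by rewrite (vertex_op_mode ff) /= rmorphN scaleNr opprK. Qed.
Let XD m u w : X m (u + w) = X m u + X m w. Proof. exact: linfD (goodL m good_X) u w. Qed.
Let XZ m k w : X m (k *: w) = k *: X m w. Proof. exact: linfZ (goodL m good_X) k w. Qed.
Let XN m w : X m (- w) = - X m w. Proof. exact: linfN (goodL m good_X) w. Qed.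
Let X0 m : X m 0 = 0. Proof. exact: linf0 (goodL m good_X). Qed.

Let XXv p m : X p%:Z (X m v) = 0. Proof. by rewrite (vertex_opC ff) Xv X0. Qed.

Let idx0 : (- 1 + 0%N%:Z)%R = (- 1)%R :> int. Proof. by []. Qed.
Let idx1 (j : nat) : (- 1 + j.+1%:Z)%R = (j%:Z)%R :> int. Proof. by lia. Qed.
Let idx2 : (- 2 + 0%N%:Z)%R = (- 2)%R :> int. Proof. by []. Qed.
Let idx3 : (- 2 + 1%N%:Z)%R = (- 1)%R :> int. Proof. by []. Qed.
Let idx4 (j : nat) : (- 2 + j.+2%:Z)%R = (j%:Z)%R :> int. Proof. by lia. Qed.
Let idx5 : (0%N%:Z - 1)%R = (- 1)%R :> int. Proof. by []. Qed.
Let idx6 (j : nat) : (j.+1%:Z - 1)%R = (j%:Z)%R :> int. Proof. by lia. Qed.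
Let idx7 : (0%N%:Z - 2)%R = (- 2)%R :> int. Proof. by []. Qed.
Let idx8 : (1%N%:Z - 2)%R = (- 1)%R :> int. Proof. by []. Qed.
Let idx9 (j : nat) : (j.+2%:Z - 2)%R = (j%:Z)%R :> int. Proof. by lia. Qed.
Let idx10 : (- 1 - 1)%R = (- 2)%R :> int. Proof. by []. Qed.
Let idx := (idx0, idx1, idx2, idx3, idx4, idx5, idx6, idx7, idx8, idx9, idx10).

Let modeneg i j (m n : int) w : m < 0 -> n < 0 -> mode i m (mode j n w) = mode j n (mode i m w).
Proof.
by move=> m0 n0; rewrite (ff_comm ff) pairing_eq0 ?scale0r ?addr0 //; lia.
Qed.

(** Moves nonnegative modes to the right until they reach the vacuum; what remains is a combination
    of creation monomials, to be compared by [lmod_ring]. *)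
Ltac annihilate_rules :=
  rewrite ?(modeD, modeZ, modeN, mode0, ann1, ann2, annv, annX, Xb, Xc, Xa, Xv, XXv, XD, XZ, XN, X0);
  rewrite ?idx ?(modeD, modeZ, modeN, mode0, ann1, ann2, annv, annX, Xb, Xc, Xa, Xv, XXv, XD, XZ, XN, X0);
  rewrite /pr /is_heis /=.

Ltac bracket_by st := rewrite st /sscale ?scalar_seriesE ?eqxx; annihilate_rules; lmod_ring C V.

Let scalar_state k : scalar_series k (- 1)%R v = k *: v.
Proof. by rewrite scalar_seriesE. Qed.

(** * The Virasoro relations with central charge 6 *)

Section Virasoro.
Variable W : series V.
Hypotheses (Wg : good W) (W_translation : W 0 = D).
Hypothesis Wst : W (- 1) v =
  - 1 *: b false (- 2) (c false (- 1) v) + (4 * hk false)^-1 *: a false (- 1) (a false (- 1) v) +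
  (- 1 *: b true (- 2) (c true (- 1) v) + (4 * hk true)^-1 *: a true (- 1) (a true (- 1) v)).

Let WD n u w : W n (u + w) = W n u + W n w. Proof. exact: linfD (goodL n Wg) u w. Qed.
Let WZ n k w : W n (k *: w) = k *: W n w. Proof. exact: linfZ (goodL n Wg) k w. Qed.
Let W0 n : W n 0 = 0. Proof. exact: linf0 (goodL n Wg). Qed.
Let Wv (p : nat) : W p v = 0. Proof. exact: (good_vac vg Wg). Qed.

(** With W_n = L_(n-1), this says that beta is primary of weight 0; [W_c] and [W_a] say that gamma
    and a are primary of weight 1. The bracket is computed with the free mode acting on the explicit
    state of W, then read backwards. *)
Let W_b s n m w : W n (b s m w) = b s m (W n w) + (- (m + n))%:~R *: b s (m + n - 1) w.
Proof.
rewrite (bracket1E (good_mode (Beta, s)) Wg (good_sscale vg (- 1) (good_sderiv vg (good_mode (Beta, s))))).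
- by rewrite /sscale /sderiv; lmod_ring C V.
- by rewrite /sscale /sderiv; case: s; bracket_by Wst.
- by move=> j; case: s; bracket_by Wst.
Qed.

Let W_c s n m w : W n (c s m w) = c s m (W n w) - m%:~R *: c s (m + n - 1) w.
Proof.
rewrite (bracketE (good_mode (Gamma, s)) Wg (good_scalar 0) (good_mode (Gamma, s))).
- by rewrite scalar_series0; lmod_ring C V.
- by rewrite scalar_series0; case: s; bracket_by Wst.
- by case: s; bracket_by Wst.
- by move=> j; case: s; bracket_by Wst.
Qed.

Let W_a s n m w : W n (a s m w) = a s m (W n w) - m%:~R *: a s (m + n - 1) w.
Proof.
have k0 := ff_kappa ff.
rewrite (bracketE (good_mode (Heis, s)) Wg (good_scalar 0) (good_mode (Heis, s))).
- by rewrite scalar_series0; lmod_ring C V.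
- by rewrite scalar_series0; case: s; bracket_by Wst.
- by rewrite Wst /hkappa; case: s; annihilate_rules; lmod_coefs C V; field.
- by move=> j; case: s; bracket_by Wst.
Qed.

Ltac conformal_by :=
  do 3!(rewrite ?(WD, WZ, W0, W_b, W_c, W_a, Wv) ?idx;
  rewrite ?(modeD, modeZ, modeN, mode0, ann1, ann2, annv) ?idx); rewrite /pr /=.

Let W1 : W 1%N%:Z (W (- 1) v) = 2 *: W (- 1) v.
Proof. rewrite Wst; conformal_by; lmod_ring C V. Qed.
Let W2 : W 2%N%:Z (W (- 1) v) = 0.
Proof. rewrite Wst; conformal_by; lmod_ring C V. Qed.
(** L_2 omega is half the central charge: each beta-gamma pair contributes 1 and each Heisenberg
    field 1/2. *)
Let W3 : W 3%N%:Z (W (- 1) v) = 3 *: v.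
Proof.
have k0 := ff_kappa ff.
by rewrite Wst /hkappa; conformal_by; lmod_coefs C V; field.
Qed.
Let W4 (j : nat) : W j.+4%:Z (W (- 1) v) = 0.
Proof. rewrite Wst; conformal_by; lmod_ring C V. Qed.

Lemma conformal_voa : is_voa_of_rank (state_field vg) v D (W (- 1) v) 6.
Proof.
have YW : state_field vg (W (- 1)%R v) = W by apply: Y_unique.
split; first exact: state_field_vertex_algebra.
  by move=> w; rewrite /virasoro_mode YW -W_translation.
move=> m n w; rewrite /virasoro_mode !YW.
(* The products W_(j) W have states D omega, 2 omega, 0 and 3 times the vacuum for j = 0, 1, 2,
   3. *)
pose P (j : nat) := match j with 0 => sderiv W | 1 => sscale 2 W | 2 => scalar_series 0 | _ => scalar_series 3 end.
rewrite (good_commutator vg (P := P) (J := 4) Wg Wg); first last.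
- by move=> [|[|[|[|j]]]] // _; apply: W4.
- move=> [|[|[|[|j]]]] // _.
  + split; first exact: (good_sderiv vg Wg).
    by rewrite -[W 0%N]/(W 0) W_translation -(good_D_state vg Wg) /P /sderiv opprK scale1r.
  + by split; [exact: (good_sscale vg 2 Wg) | rewrite W1].
  + by split; [exact: good_scalar | rewrite W2 /P scalar_series0].
  + by split; [exact: good_scalar | rewrite W3 /P scalar_state].
rewrite !big_ord_recr big_ord0 /= gbin0 gbin1 scalar_series0 scalar_seriesE /sderiv /sscale.
rewrite subr0 (_ : m + 1 + (n + 1) - 1 = m + n + 1); last by lia.
rewrite (_ : (m + 1 + (n + 1) - 3 == - 1) = (m + n == 0)); last by lia.
(* The index m + 1 of L_m gives the cubic term: 3 (m^3 - m) / 6 = 6 (m^3 - m) / 12. *)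
have -> : gbin C (m + 1) 3 = (m ^+ 3 - m)%:~R / 6%:R.
  rewrite /gbin !big_ord_recr big_ord0 /= (_ : 3`! = 6%N) //.
  by congr (_ / _); ring.
by case: eqP => _; lmod_coefs C V; rewrite ?rmorphD ?rmorphN ?rmorphB /=; field.
Qed.

End Virasoro.

(* These stand for h, f, beta^2, YY(-2) gammabar and beta YY(-2); all their   *)
(* brackets follow from their states.                                        *)
Variables H F BB G BX : bool -> series V.
Hypotheses (Hg : forall s, good (H s)) (Fg : forall s, good (F s)) (BBg : forall s, good (BB s)).
Hypotheses (Gg : forall s, good (G s)) (BXg : forall s, good (BX s)).
Hypothesis Hst : forall s, H s (- 1) v = 2 *: b s (- 1) (c s (- 1) v) + a s (- 1) v.
Hypothesis Fst : forall s, F s (- 1) v = - 1 *: b s (- 1) (b s (- 1) (c s (- 1) v)) +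
  (- 1 *: b s (- 1) (a s (- 1) v) + ((2 - hk s) *: b s (- 2) v + c (~~ s) (- 1) (X (- 1) v))).
Hypothesis BBst : forall s, BB s (- 1) v = b s (- 1) (b s (- 1) v).
Hypothesis Gst : forall s, G s (- 1) v = c (~~ s) (- 1) (X (- 1) v).
Hypothesis BXst : forall s, BX s (- 1) v = b s (- 1) (X (- 1) v).

(** Here and below a free mode acts on the state of a composite field, and the result is read
    backwards. Composite modes can then be moved through creation monomials, as the products of
    currents require. *)
Let F_b s n m w : F s n (b s m w) = b s m (F s n w) + BB s (m + n) w.
Proof.
rewrite (bracket1E (good_mode (Beta, s)) (Fg s) (good_sscale vg (-1) (BBg s))).
- by rewrite /sscale scaleN1r subrK.
- by rewrite /sscale BBst; case: s; bracket_by Fst.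
- by move=> j; case: s; bracket_by Fst.
Qed.

Let F_c s n m w : F s n (c s m w) =
  c s m (F s n w) - H s (m + n) w - m%:~R *: scalar_series (hk s - 2) (m + n - 1) w.
Proof.
rewrite (bracketE (good_mode (Gamma, s)) (Fg s) (Hg s) (good_scalar (hk s - 2))).
- by lmod_ring C V.
- by rewrite Hst; case: s; bracket_by Fst.
- by case: s; bracket_by Fst.
- by move=> j; case: s; bracket_by Fst.
Qed.

Let F_a s n m w : F s n (a s m w) =
  a s m (F s n w) + 2 *: G s (m + n) w + (m%:~R * (2 * hk s)) *: b s (m + n - 1) w.
Proof.
rewrite (bracketE (good_mode (Heis, s)) (Fg s) (good_sscale vg (- 2) (Gg s))
  (good_sscale vg (- 2 * hk s) (good_mode (Beta, s)))).
- by rewrite /sscale; lmod_ring C V.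
- by rewrite /sscale Gst; case: s; bracket_by Fst.
- by case: s; bracket_by Fst.
- by move=> j; case: s; bracket_by Fst.
Qed.

Let F_b' s n m w : F s n (b (~~ s) m w) = b (~~ s) m (F s n w) - X (m + n) w.
Proof.
rewrite (bracket1E (good_mode (Beta, ~~ s)) (Fg s) good_X).
- by rewrite addrK.
- by case: s; bracket_by Fst.
- by move=> j; case: s; bracket_by Fst.
Qed.

Let F_c' s n m w : F s n (c (~~ s) m w) = c (~~ s) m (F s n w).
Proof.
by rewrite (bracket0E (good_mode (Gamma, ~~ s)) (Fg s)) // => j; case: s; bracket_by Fst.
Qed.

Let F_a' s n m w : F s n (a (~~ s) m w) = a (~~ s) m (F s n w) + 2 *: G s (m + n) w.
Proof.
rewrite (bracket1E (good_mode (Heis, ~~ s)) (Fg s) (good_sscale vg (- 2) (Gg s))).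
- by rewrite /sscale; lmod_ring C V.
- by rewrite /sscale Gst; case: s; bracket_by Fst.
- by move=> j; case: s; bracket_by Fst.
Qed.

Let F_X s n m w : F s n (X m w) = X m (F s n w) + 2 *: BX s (m + n) w.
Proof.
rewrite (bracket1E good_X (Fg s) (good_sscale vg (- 2) (BXg s))).
- by rewrite /sscale; lmod_ring C V.
- by rewrite /sscale BXst; case: s; bracket_by Fst.
- by move=> j; case: s; bracket_by Fst.
Qed.

Let BB_b s n m w : BB s n (b s m w) = b s m (BB s n w).
Proof.
by rewrite (bracket0E (good_mode (Beta, s)) (BBg s)) // => j; case: s; bracket_by BBst.
Qed.

Let BB_c s n m w : BB s n (c s m w) = c s m (BB s n w) + 2 *: b s (m + n) w.
Proof.
rewrite (bracket1E (good_mode (Gamma, s)) (BBg s) (good_sscale vg (- 2) (good_mode (Beta, s)))).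
- by rewrite /sscale; lmod_ring C V.
- by rewrite /sscale; case: s; bracket_by BBst.
- by move=> j; case: s; bracket_by BBst.
Qed.

Let BB_a s n m w : BB s n (a s m w) = a s m (BB s n w).
Proof.
by rewrite (bracket0E (good_mode (Heis, s)) (BBg s)) // => j; case: s; bracket_by BBst.
Qed.

Let H_b s n m w : H s n (b s m w) = b s m (H s n w) - 2 *: b s (m + n) w.
Proof.
rewrite (bracket1E (good_mode (Beta, s)) (Hg s) (good_sscale vg 2 (good_mode (Beta, s)))).
- by rewrite /sscale; lmod_ring C V.
- by rewrite /sscale; case: s; bracket_by Hst.
- by move=> j; case: s; bracket_by Hst.
Qed.

Let H_c s n m w : H s n (c s m w) = c s m (H s n w) + 2 *: c s (m + n) w.
Proof.
rewrite (bracket1E (good_mode (Gamma, s)) (Hg s) (good_sscale vg (- 2) (good_mode (Gamma, s)))).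
- by rewrite /sscale; lmod_ring C V.
- by rewrite /sscale; case: s; bracket_by Hst.
- by move=> j; case: s; bracket_by Hst.
Qed.

Let H_a s n m w : H s n (a s m w) =
  a s m (H s n w) - m%:~R *: scalar_series (2 * hk s) (m + n - 1) w.
Proof.
rewrite (bracketE (good_mode (Heis, s)) (Hg s) (good_scalar 0) (good_scalar (2 * hk s))).
- by rewrite scalar_series0; lmod_ring C V.
- by case: s; bracket_by Hst.
- by case: s; bracket_by Hst.
- by move=> j; case: s; bracket_by Hst.
Qed.

Let H_mode' (i : boson) s n m w : H s n (mode (i, ~~ s) m w) = mode (i, ~~ s) m (H s n w).
Proof.
by rewrite (bracket0E (good_mode (i, ~~ s)) (Hg s)) // => j; case: s; case: i; bracket_by Hst.
Qed.

Let H_X s n m w : H s n (X m w) = X m (H s n w) - 2 *: X (m + n) w.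
Proof.
rewrite (bracket1E good_X (Hg s) (good_sscale vg 2 good_X)).
- by rewrite /sscale; lmod_ring C V.
- by rewrite /sscale; case: s; bracket_by Hst.
- by move=> j; case: s; bracket_by Hst.
Qed.

Let FD s n u w : F s n (u + w) = F s n u + F s n w. Proof. exact: linfD (goodL n (Fg s)) u w. Qed.
Let FZ s n k w : F s n (k *: w) = k *: F s n w. Proof. exact: linfZ (goodL n (Fg s)) k w. Qed.
Let FN s n w : F s n (- w) = - F s n w. Proof. exact: linfN (goodL n (Fg s)) w. Qed.
Let F0 s n : F s n 0 = 0. Proof. exact: linf0 (goodL n (Fg s)). Qed.
Let HD s n u w : H s n (u + w) = H s n u + H s n w. Proof. exact: linfD (goodL n (Hg s)) u w. Qed.
Let HZ s n k w : H s n (k *: w) = k *: H s n w. Proof. exact: linfZ (goodL n (Hg s)) k w. Qed.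
Let HN s n w : H s n (- w) = - H s n w. Proof. exact: linfN (goodL n (Hg s)) w. Qed.
Let H0 s n : H s n 0 = 0. Proof. exact: linf0 (goodL n (Hg s)). Qed.
Let Fv s (p : nat) : F s p v = 0. Proof. exact: (good_vac vg (Fg s)). Qed.
Let Hv s (p : nat) : H s p v = 0. Proof. exact: (good_vac vg (Hg s)). Qed.
Let BBv s (p : nat) : BB s p v = 0. Proof. exact: (good_vac vg (BBg s)). Qed.
Let Gv s (p : nat) : G s p v = 0. Proof. exact: (good_vac vg (Gg s)). Qed.
Let BXv s (p : nat) : BX s p v = 0. Proof. exact: (good_vac vg (BXg s)). Qed.

Let D_mode i m w : D (mode i m w) = mode i m (D w) + (- m)%:~R *: mode i (m - 1) w.
Proof.
rewrite -[_ *: _]/(sderiv (mode i) m w) -(generator_covariant ff (X := mode i)).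
  by rewrite addrC subrK.
by left; exists i.
Qed.

Let BBst2 s : BB s (- 2) v = 2 *: b s (- 2) (b s (- 1) v).
Proof.
rewrite (good_D_state vg (BBg s)) BBst !D_mode (vg_vac vg) mode0 idx10 modeD modeZ mode0 opprK.
by rewrite (modeneg _ _ (m := - 1) (n := - 2)) //; lmod_ring C V.
Qed.

(** The state form of the derivative of [YY (-2)]: D applied to the vector of momentum -2. *)
Let X2 : X (- 2) v = - kappa^-1 *: (a false (- 1) (X (- 1) v) - a true (- 1) (X (- 1) v)).
Proof.
have k0 := ff_kappa ff.
rewrite (good_D_state vg good_X) (vertex_op_state ff) (translation_kt ff) /isotropic.
by lmod_coefs C V; field.
Qed.

Let scal1 k w : scalar_series k (- 1) w = k *: w.
Proof. by rewrite scalar_seriesE eqxx. Qed.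
Let scal2 k w : scalar_series k (- 2) w = 0.
Proof. by rewrite scalar_seriesE scale0r. Qed.
Let scal3 k (p : nat) w : scalar_series k p w = 0.
Proof. by rewrite scalar_seriesE scale0r. Qed.

(** These rules give creation monomials a fixed order, so that equal monomials become the same atom
    for [lmod_ring]. *)
Let ord_cb s s' w : c s (- 1) (b s' (- 1) w) = b s' (- 1) (c s (- 1) w). Proof. exact: modeneg. Qed.
Let ord_cb2 s s' w : c s (- 1) (b s' (- 2) w) = b s' (- 2) (c s (- 1) w). Proof. exact: modeneg. Qed.
Let ord_ab s s' w : a s (- 1) (b s' (- 1) w) = b s' (- 1) (a s (- 1) w). Proof. exact: modeneg. Qed.
Let ord_ab2 s s' w : a s (- 1) (b s' (- 2) w) = b s' (- 2) (a s (- 1) w). Proof. exact: modeneg. Qed.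
Let ord_ac s s' w : a s (- 1) (c s' (- 1) w) = c s' (- 1) (a s (- 1) w). Proof. exact: modeneg. Qed.
Let ord_bb2 s s' w : b s (- 1) (b s' (- 2) w) = b s' (- 2) (b s (- 1) w). Proof. exact: modeneg. Qed.
Let ord_mm (i : boson) w :
  mode (i, true) (- 1) (mode (i, false) (- 1) w) = mode (i, false) (- 1) (mode (i, true) (- 1) w).
Proof. exact: modeneg. Qed.

Ltac product_step :=
  rewrite ?(FD, FZ, FN, F0, HD, HZ, HN, H0, F_b, F_c, F_a, F_X, H_b, H_c, H_a, H_X);
  rewrite ?(F_b', F_c', F_a', H_mode');
  rewrite ?(BB_b, BB_c, BB_a) ?idx ?(scal1, scal2, scal3);
  rewrite ?(Fv, Hv, BBv, Gv, BXv, Hst, BBst, BBst2, Gst, BXst);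
  rewrite ?(modeD, modeZ, modeN, mode0, ann1, ann2, annv, annX, Xb, Xc, Xa, Xv, XXv, XD, XZ, XN, X0) ?idx.

Ltac product_by :=
  do 4!product_step; rewrite ?X2; product_step; rewrite /pr /is_heis /=;
  rewrite ?(ord_cb, ord_cb2, ord_ab, ord_ab2, ord_ac, ord_bb2, ord_mm).

(** * Operator products of the currents *)

Lemma cartan_cartan s : [/\ H s 0%N%:Z (H s (- 1) v) = 0,
  H s 1%N%:Z (H s (- 1) v) = (2 * (hk s - 2)) *: v & forall j : nat, H s j.+2 (H s (- 1) v) = 0].
Proof.
split=> [||j]; rewrite [in LHS]Hst; case: s; product_by; lmod_ring C V.
Qed.

(** The second-order pole is beta times 4 - 2 [hk s] + 2 k, from the cubic term, from beta a and
    from the derivative term; it vanishes for k = [hk s] - 2. *)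
Lemma cartan_lowering s : [/\ H s 0%N%:Z (F s (- 1) v) = - 2 *: F s (- 1) v,
  H s 1%N%:Z (F s (- 1) v) = 0 & forall j : nat, H s j.+2 (F s (- 1) v) = 0].
Proof.
split=> [||j]; rewrite !Fst; case: s; product_by; lmod_ring C V.
Qed.

(** Besides the Wakimoto terms there are only the products of beta a with [YY (-2)] gammabar in the
    two orders, whose first-order poles are opposite. *)
Lemma lowering_lowering s (j : nat) : F s j (F s (- 1) v) = 0.
Proof.
rewrite Fst; case: j => [|[|j]]; case: s; product_by; lmod_ring C V.
Qed.

Lemma cartan_cartan_bar s (j : nat) : H s j (H (~~ s) (- 1) v) = 0.
Proof. by rewrite Hst; case: j => [|[|j]]; case: s; product_by; lmod_ring C V. Qed.

(** The factors gamma and [YY (-2)] of the mixed term have opposite weights 2 and -2. *)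
Lemma cartan_lowering_bar s (j : nat) : H s j (F (~~ s) (- 1) v) = 0.
Proof. by rewrite Fst; case: j => [|[|j]]; case: s; product_by; lmod_ring C V. Qed.

(** The second-order poles contribute 2 + k and 2 + kbar times [YY (-2)], that is, kappa and - kappa
    up to exchange. Re-expanding one of them at the other point leaves a derivative of [YY (-2)] in
    the first-order pole, which [X2] cancels against the terms in a and abar. *)
Lemma lowering_lowering_bar s (j : nat) : F s j (F (~~ s) (- 1) v) = 0.
Proof.
have k0 := ff_kappa ff.
by rewrite Fst; case: j => [|[|j]]; case: s; product_by; lmod_coefs C V; field.
Qed.

Definition affine_fields s (x : sl2_basis) : series V :=
  match x with sl2e => c s | sl2h => H s | sl2f => F s end.

Lemma affine_fields_good s x : good (affine_fields s x).
Proof. by case: x; [exact: good_mode | exact: Hg | exact: Fg]. Qed.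

Lemma affine_fields_module s : is_affine_sl2_module (hk s - 2) (affine_fields s).
Proof.
split=> /=.
- by move=> x n; apply: goodL; apply: affine_fields_good.
- by move=> m n w; rewrite H_c addrAC subrr add0r addrC.
- have [h0 h1 h2] := cartan_lowering s => m n w.
  rewrite (bracketE (Hg s) (Fg s) (good_sscale vg (- 2) (Fg s)) (good_scalar 0)) //.
    by rewrite scalar_series0 /sscale; lmod_ring C V.
  by rewrite scalar_series0.
- have [h0 h1 h2] := cartan_cartan s => m n w.
  have e0 : H s 0%N%:Z (H s (- 1) v) = scalar_series 0 (- 1)%R v by rewrite scalar_series0.
  have e1 : H s 1%N%:Z (H s (- 1) v) = scalar_series (2 * (hk s - 2)) (- 1)%R v.
    by rewrite scalar_seriesE.
  rewrite (bracketE (Hg s) (Hg s) (good_scalar _) (good_scalar _) e0 e1 h2).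
  rewrite scalar_series0 scalar_seriesE (_ : (m + n - 1 == - 1) = (m + n == 0)); last by lia.
  by case: ifP => _; lmod_coefs C V; rewrite ?rmorphM /=; ring.
- move=> m n w; rewrite F_c scalar_seriesE (_ : (m + n - 1 == - 1) = (m + n == 0)); last by lia.
  rewrite (addrC m n) (addrC n m).
  by case: ifP => _; lmod_ring C V.
- by move=> m n w; rewrite (bracket0E (good_mode (Gamma, s)) (good_mode (Gamma, s))) ?subrr // => j; case: s; annihilate_rules; lmod_ring C V.
- by move=> m n w; rewrite (bracket0E (Fg s) (Fg s)) ?subrr //; apply: lowering_lowering.
Qed.

Lemma affine_fields_commute s x y m n w :
  affine_fields s x m (affine_fields (~~ s) y n w) =
  affine_fields (~~ s) y n (affine_fields s x m w).
Proof.
apply: (bracket0E (affine_fields_good _ _) (affine_fields_good _ _)) => j.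
case: x; case: y => /=.
- by case: s; annihilate_rules; lmod_ring C V.
- by rewrite Hst; case: s; annihilate_rules; lmod_ring C V.
- by rewrite Fst; case: s; annihilate_rules; lmod_ring C V.
- by rewrite H_mode' Hv mode0.
- exact: cartan_cartan_bar.
- exact: cartan_lowering_bar.
- by rewrite F_c' Fv mode0.
- by rewrite Hst; case: j => [|[|j]]; case: s; product_by; lmod_ring C V.
- exact: lowering_lowering_bar.
Qed.

End Brackets.

(** * The realization on the Fock space *)

Section Realization.
Context {C : numFieldType} {V : lmodType C}.
Variables (kappa : C) (mode : boson * bool -> series V).
Variables (kt : int -> V) (sh : int -> V -> V).
Hypothesis ff : free_fields kappa mode kt sh.
Local Notation D := (translation kappa mode).
Local Notation good := (good D (generator kappa mode sh)).
Local Notation v := (kt 0).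
Local Notation b s := (mode (Beta, s)).
Local Notation c s := (mode (Gamma, s)).
Local Notation a s := (mode (Heis, s)).
Local Notation X := (vertex_op kappa mode sh (- 2)).

Let vg := free_field_generators ff.
Let gm i : good (mode i). Proof. exact: (good_mode ff i). Qed.
Let gX : good X. Proof. exact: (good_X ff). Qed.
Let gn A B : good A -> good B -> good (nop A B).
Proof. exact: (good_nop vg). Qed.

Definition cartan_field s : series V := sadd (sscale 2 (nop (b s) (c s))) (a s).

Definition lowering_field s : series V :=
  sadd (sscale (- 1) (nop (b s) (nop (b s) (c s))))
 (sadd (sscale (- 1) (sprod (b s) (a s)))
 (sadd (sscale (- level kappa s) (sderiv (b s)))
       (sprod X (c (~~ s))))).

Let sprod_ba s : sprod (b s) (a s) = nop (b s) (a s).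
Proof.
apply: sprod_nop; [exact: ff_field ff _ | exact: ff_field ff _ | move=> m n w].
by rewrite (ff_comm ff) /pairing /= if_same scale0r addr0.
Qed.

Let sprod_Xc s : sprod X (c s) = nop X (c s).
Proof.
apply: sprod_nop; [exact: vertex_op_field ff _ | exact: ff_field ff _ | move=> m n w].
by rewrite (vertex_op_mode ff) /= scale0r subr0.
Qed.

Lemma cartan_field_good s : good (cartan_field s).
Proof. by apply: (good_sadd vg) => //; apply: (good_sscale vg); apply: gn. Qed.

Lemma lowering_field_good s : good (lowering_field s).
Proof.
rewrite /lowering_field sprod_ba sprod_Xc.
apply: (good_sadd vg); first by apply: (good_sscale vg); apply: gn => //; apply: gn.
apply: (good_sadd vg); first by apply: (good_sscale vg); apply: gn.
by apply: (good_sadd vg); [apply: (good_sscale vg); apply: (good_sderiv vg) | apply: gn].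
Qed.

Let nopv A B : good A -> good B -> nop A B (- 1) v = A (- 1) (B (- 1) v).
Proof. exact: (nop_vac vg). Qed.

Let cartan_state s : cartan_field s (- 1) v = 2 *: b s (- 1) (c s (- 1) v) + a s (- 1) v.
Proof. by rewrite /cartan_field /sadd /sscale nopv. Qed.

Let lowering_state s : lowering_field s (- 1) v =
  - 1 *: b s (- 1) (b s (- 1) (c s (- 1) v)) +
  (- 1 *: b s (- 1) (a s (- 1) v) +
  ((2 - hkappa kappa s) *: b s (- 2) v + c (~~ s) (- 1) (X (- 1) v))).
Proof.
rewrite /lowering_field sprod_ba sprod_Xc /sadd /sscale !nopv //; last exact: gn.
rewrite /sderiv opprK scale1r /level /dual_coxeter opprB.
by rewrite [X (- 1) (c _ _ _)](vertex_op_mode ff) /= scale0r subr0.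
Qed.

Let stress_good : good (stress kappa mode).
Proof.
have part s : good (stress_part kappa mode s).
  apply: (good_sadd vg); apply: (good_sscale vg); apply: gn => //.
  exact: (good_sderiv vg).
exact: (good_sadd vg).
Qed.

Theorem affine_sl2_voa (Z : bool -> sl2_basis -> series V) :
  (forall s, Z s sl2e = c s) -> (forall s, Z s sl2h = cartan_field s) ->
  (forall s, Z s sl2f = lowering_field s) ->
  ((forall s, is_affine_sl2_module (hkappa kappa s - 2) (Z s)) /\
   (forall s x y m n w, Z s x m (Z (~~ s) y n w) = Z (~~ s) y n (Z s x m w))) /\
  (exists (Y : V -> series V) (vac : V) (T : V -> V) (omega : V),
     is_voa_of_rank Y vac T omega 6 /\ forall s x, exists u, Y u = Z s x).
Proof.
move=> Ze Zh Zf.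
have ZE s : Z s = affine_fields mode cartan_field lowering_field s.
  by apply/funext => -[]; rewrite ?Ze ?Zh ?Zf.
have gBB s : good (nop (b s) (b s)) by apply: gn.
have gG s : good (nop X (c (~~ s))) by apply: gn.
have gBX s : good (nop (b s) X) by apply: gn.
have BBst s : nop (b s) (b s) (- 1) v = b s (- 1) (b s (- 1) v) by apply: nopv.
have Gst s : nop X (c (~~ s)) (- 1) v = c (~~ s) (- 1) (X (- 1) v).
  by rewrite nopv // (vertex_op_mode ff) /= scale0r subr0.
have BXst s : nop (b s) X (- 1) v = b s (- 1) (X (- 1) v) by apply: nopv.
split; first split.
- move=> s; rewrite ZE.
  exact: (affine_fields_module ff cartan_field_good lowering_field_good gBB gG gBX
            cartan_state lowering_state BBst Gst BXst).
- move=> s x y m n w; rewrite !ZE.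
  exact: (affine_fields_commute ff cartan_field_good lowering_field_good gG gBX
            cartan_state lowering_state Gst BXst).
exists (state_field vg), v, D, (stress kappa mode (- 1) v); split.
  apply: conformal_voa => //; rewrite /stress /stress_part /sadd /sscale !nopv //;
    try exact: (good_sderiv vg).
  by rewrite /sderiv opprK !scale1r.
(* Each current is a good series, hence the field of its own state. *)
move=> s x; exists (Z s x (- 1) v); apply: Y_unique; rewrite ZE.
exact: (affine_fields_good ff cartan_field_good lowering_field_good).
Qed.

End Realization.

Section FockRealization.
Variables (C : numFieldType) (kappa : C).
Hypothesis kappa_neq0 : kappa != 0.
Local Notation F := (Fock C).

Lemma mode_shift mu i n (v : F) : mode kappa i n (shift mu v) =
  shift mu (mode kappa i n v) + (if (n == 0) && is_heis i then mu%:~R *: shift mu v else 0).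
Proof.
case: n => [p|p]; last by rewrite !mode_neg shift_create addr0.
case: i => -[] s.
- by rewrite andbF addr0 modeBeta !beta_nneg shift_annihilate.
- have gE u : @gamma C s p u = - annihilate (Beta, s, p) u by [].
  by rewrite andbF addr0 modeGamma !gE (linfN (shift_linear mu)) shift_annihilate.
- case: p => [|p]; first exact: momentum_shift.
  have aE u : afield kappa s p.+1 u = (2 * hkappa kappa s * p.+1%:R) *: annihilate (Heis, s, p) u by [].
  by rewrite addr0 modeHeis !aE (linfZ (shift_linear mu)) shift_annihilate.
Qed.

Lemma fock_free_fields :
  free_fields kappa (mode kappa) (fun l => ket C (mset0, l)) (@shift C).
Proof.
split.
- exact: kappa_neq0.
- exact: mode_field.
- exact: mode_comm.
- exact: mode_ket0.
- exact: shift_linear.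
- by move=> mu l; rewrite shiftE.
- exact: mode_shift.
- move=> P PL P0 PX; apply: fock_ind => // -[i p] v Pv.
  by rewrite -(mode_neg kappa); apply: PX.
Qed.

End FockRealization.

(** Identifies the exponentials in the definition of [YY], given as sums of powers of series, with
    those built from [nexp]. *)
Lemma vexp_seriesE (C : numFieldType) (V : lmodType C) (kappa : C)
    (mode : boson * bool -> series V) (pos s : bool) (mu : int) (A : series V) :
  (forall n, linear (mode (Heis, s) n)) ->
  (forall j v, A j v = if (if pos then 0 < j + 1 else j + 1 < 0)
     then (- (j + 1))%:~R^-1 *: mode (Heis, s) (j + 1) v else 0) ->
  sexp (sscale (mu%:~R / (2 * hkappa kappa s)) A) = vexp_series kappa mode pos s mu.
Proof.
move=> modeL AE; rewrite /vexp_series -sexp_reflect.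
- congr sexp; apply: eq_reflect_series => [N v|n v nN]; rewrite /sscale AE.
    rewrite (_ : reflect_index pos N + 1 = signed pos N); last first.
      by rewrite /reflect_index /signed; case: pos {AE}; lia.
    rewrite (_ : (if pos then _ else _) = (0 < N)%N); last by rewrite /signed; case: pos {AE}; lia.
    case: N => [|N] /=; last by rewrite scalerA.
    by rewrite scaler0 /vexp_coef /signed; case: pos {AE}; rewrite ?oppr0 invr0 mulr0 scale0r.
  case: ifP => h; last by rewrite scaler0.
  have := nN (absz (n + 1)); rewrite /reflect_index; case: pos {AE nN} h; lia.
- by move=> i x u w; rewrite /vexp_coef modeL; lmod_ring C V.
- move=> v; rewrite /vexp_coef /signed.
  by case: pos {AE}; rewrite ?oppr0 invr0 mulr0 scale0r.
Qed.

Lemma YY_vertex_op (C : numFieldType) (kappa : C) mu :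
  YY kappa mu = vertex_op kappa (mode kappa) (@shift C) mu.
Proof.
have L s n := mode_linear kappa (Heis, s) n.
have neg s : vexp kappa s mu (aint_neg kappa s) = vexp_series kappa (mode kappa) false s mu.
  exact (vexp_seriesE (pos := false) kappa mu (L s) (fun _ _ => erefl)).
have pos s : vexp kappa s mu (aint_pos kappa s) = vexp_series kappa (mode kappa) true s mu.
  exact (vexp_seriesE (pos := true) kappa mu (L s) (fun _ _ => erefl)).
by rewrite /YY !neg !pos.
Qed.

Theorem theorem2p4 (R : realType) (kappa : R[i]) (kappa_neq0 : kappa != 0) :
  (is_affine_sl2_module (kappa - dual_coxeter R[i]) (sl2_field kappa false) /\
   is_affine_sl2_module (- kappa - dual_coxeter R[i]) (sl2_field kappa true) /\
   (forall (x y : sl2_basis) (m n : int) (v : Fock R[i]),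
      sl2_field kappa false x m (sl2_field kappa true y n v) =
      sl2_field kappa true y n (sl2_field kappa false x m v))) /\
  (exists (Y : Fock R[i] -> series (Fock R[i])) (vac : Fock R[i])
          (D : Fock R[i] -> Fock R[i]) (omega : Fock R[i]),
     is_voa_of_rank Y vac D omega 6 /\
     (forall (s : bool) (x : sl2_basis), exists u : Fock R[i],
        Y u = sl2_field kappa s x)).
Proof.
have eE s : sl2_field kappa s sl2e = mode kappa (Gamma, s) by [].
have hE s : sl2_field kappa s sl2h = cartan_field (mode kappa) s by [].
have fE s : sl2_field kappa s sl2f = lowering_field kappa (mode kappa) (@shift R[i]) s.
  by rewrite /sl2_field YY_vertex_op.
have [[aff com] voa] := affine_sl2_voa (fock_free_fields kappa_neq0) eE hE fE.
split; last exact: voa.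
split; first exact: (aff false).
split; first exact: (aff true).
by move=> x y m n w; apply: (com false).
Qed.
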